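(* Let $k=-2+m+\tfrac i3$ for some $m\in\mathbb Z_{\ge0}$ and $i\in\{1,2\}$, and let $n=3k+7$. Suppose that $v_0\in N(k,0)_{(k\Lambda_0+n\theta^\vee-n\delta)}$ is a singular vector. If $n$ is even, then $$v_0\equiv\sum_{j=0}^{d(n)-1} b_j\,u^{n/2-3j}v^{2j}.\mathbf 1 \quad \bmod\ \mathcal U(\hat{\mathfrak g}_-)w.\mathbf 1,$$ where $b_0\in\mathbb C\setminus\{0\}$ and $$b_j=\frac{2^j\binom{n/2}{2}\binom{n/2-3}{2}\cdots\binom{n/2-3j+3}{2}}{3^j(2j)!}\,b_0\qquad (j=1,\dots,d(n)-1).$$ If $n$ is odd, then $$v_0\equiv\sum_{j=0}^{d(n)-1} b_j\,u^{(n-3)/2-3j}v^{1+2j}.\mathbf 1 \quad \bmod\ \mathcal U(\hat{\mathfrak g}_-)w.\mathbf 1,$$ where $b_0\in\mathbb C\setminus\{0\}$ and $$b_j=\frac{2^j\binom{(n-3)/2}{2}\binom{(n-3)/2-3}{2}\cdots\binom{(n-3)/2-3j+3}{2}}{3^j(2j+1)!}\,b_0\qquad (j=1,\dots,d(n)-1).$$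
   Context: $\mathfrak g$ is the simple complex Lie algebra of type $G_2$ with Cartan subalgebra $\mathfrak h$, simple roots $\alpha$ (short) and $\beta$ (long), positive roots $\Delta_+=\{\alpha,\beta,\alpha+\beta,2\alpha+\beta,3\alpha+\beta,3\alpha+2\beta\}$, and $\mathfrak g=\mathfrak n_-\oplus\mathfrak h\oplus\mathfrak n_+$. For $i\alpha+j\beta\in\Delta_+$, $E_{ij}$ and $F_{ij}$ are root vectors of weight $i\alpha+j\beta$ and $-(i\alpha+j\beta)$ with $[E_{ij},F_{ij}]=H_{ij}:=(i\alpha+j\beta)^\vee$, normalized by $E_{11}=[E_{10},E_{01}]$, $E_{21}=\frac12[E_{11},E_{10}]$, $E_{31}=\frac13[E_{21},E_{10}]$, $E_{32}=[E_{31},E_{01}]$. The notation $\theta^\vee$ means the highest short root $2\alpha+\beta$. $\hat{\mathfrak g}=\mathfrak g\otimes\mathbb C[t,t^{-1}]\oplus\mathbb CK$ (extended by the degree derivation when weights are considered) is the affine Lie algebra of type $G_2^{(1)}$, with $[X(r),Y(s)]=[X,Y](r+s)+r\delta_{r+s,0}(X,Y)K$, $X(r)=X\otimes t^r$, where $(\cdot,\cdot)$ is the invariant form with long roots of square length $2$. Put $\hat{\mathfrak g}_\pm=\mathfrak g\otimes t^{\pm1}\mathbb C[t^{\pm1}]$ and $\hat{\mathfrak n}_+=\mathfrak n_+\oplus\hat{\mathfrak g}_+$. $N(k,0)=\mathcal U(\hat{\mathfrak g})\otimes_{\mathcal U(\mathfrak g\oplus\mathbb CK\oplus\hat{\mathfrak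 g}_+)}\mathbb C$ is the vacuum module ($\mathfrak g,\hat{\mathfrak g}_+$ act by $0$ and $K$ by $k$ on $\mathbb C$), with vacuum vector $\mathbf 1$; it is a free rank one $\mathcal U(\hat{\mathfrak g}_-)$-module on $\mathbf 1$. It is graded by weights: $\mathbf 1$ has weight $k\Lambda_0$ and $X(-r)$ with $X$ of $\mathfrak h$-weight $\gamma$ has weight $\gamma-r\delta$; $N(k,0)_{(\lambda)}$ is the space of weight $\lambda$. A singular vector is a nonzero vector annihilated by $\hat{\mathfrak n}_+$. Elements of $\mathcal U(\hat{\mathfrak g}_-)$: $a=E_{21}(-1)$, $b=E_{31}(-1)E_{11}(-1)-E_{32}(-1)E_{10}(-1)$, $c=E_{31}(-1)^2E_{01}(-1)-E_{32}(-1)E_{31}(-1)H_{01}(-1)-E_{32}(-1)^2F_{01}(-1)$, $w=E_{31}(-1)E_{32}(-2)-E_{32}(-1)E_{31}(-2)$, $u=\frac13a^2-b$, $v=\frac29a^3-ab-3c$. For $n\in\mathbb Z_{\ge 0}$, $d(n)=\lfloor\frac{n+6}{6}\rfloor$ if $n$ is even and $d(n)=\lfloor\frac{n+3}{6}\rfloor$ if $n$ is odd. *)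

(* Defs.v *)
From HB Require Import structures.
From mathcomp Require Import all_boot all_order all_algebra.
From mathcomp Require Import generic_quotient ring_quotient.
From mathcomp Require Import finmap monalg.
From mathcomp Require Import mathcomp_extra boolp classical_sets reals complex.

Set Implicit Arguments.
Unset Strict Implicit.
Unset Printing Implicit Defensive.

Import GRing.Theory.

Local Open Scope classical_set_scope.
Local Open Scope quotient_scope.
Local Open Scope ring_scope.

Reserved Notation "[ 'lie' x , y ]" (format "[ 'lie'  x ,  y ]").

HB.mixin Record isLieAlgebra (K : fieldType) L of GRing.Lmodule K L := {
  lie : L -> L -> L;
  lieDl : forall (a : K) x y z, lie (a *: x + y) z = a *: lie x z + lie y z;
  lieDr : forall (a : K) x y z, lie x (a *: y + z) = a *: lie x y + lie x z;
  liexx : forall x, lie x x = 0;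
  jacobi : forall x y z,
    lie x (lie y z) + lie y (lie z x) + lie z (lie x y) = 0
}.

#[short(type="lieAlgType")]
HB.structure Definition LieAlgebra (K : fieldType) :=
  {L of GRing.Lmodule K L & isLieAlgebra K L}.

#[short(type="finLieAlgType")]
HB.structure Definition FinLieAlgebra (K : fieldType) :=
  {L of Vector K L & isLieAlgebra K L}.

Notation "[ 'lie' x , y ]" := (lie x y) : ring_scope.

Section LieTheory.
Variables (K : fieldType) (L : lieAlgType K).
Implicit Types x y z : L.

Lemma lieC x y : [lie x, y] = - [lie y, x].
Proof.
have lDl (u v w : L) : [lie u + v, w] = [lie u, w] + [lie v, w].
  by have := lieDl (1 : K) u v w; rewrite !scale1r.
have lDr (u v w : L) : [lie u, v + w] = [lie u, v] + [lie u, w].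
  by have := lieDr (1 : K) u v w; rewrite !scale1r.
have := liexx (x + y); rewrite lDl !lDr !liexx add0r addr0.
by move/eqP; rewrite addr_eq0 => /eqP.
Qed.

End LieTheory.

Record invForm (K : fieldType) (L : lieAlgType K) := InvForm {
  form :> L -> L -> K;
  formDl : forall (a : K) x y z, form (a *: x + y) z = a * form x z + form y z;
  formC : forall x y, form x y = form y x;
  form_inv : forall x y z, form [lie x, y] z = form x [lie y, z]
}.

Section Laurent.
Variables (K : fieldType) (L : lmodType K).

Definition laurent : Type := {malg L[int]}.
HB.instance Definition _ := GRing.Zmodule.on laurent.
Implicit Types f g : laurent.

Definition mono (x : L) (r : int) : laurent := mkmalgU r x.

Definition laurent_scale (a : K) f : laurent :=
  \sum_(r <- msupp f) mono (a *: mcoeff r f) r.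

Lemma laurent_scaleE a f r : mcoeff r (laurent_scale a f) = a *: mcoeff r f.
Proof.
rewrite [in RHS](monalgE f) /laurent_scale !raddf_sum.
by apply: eq_bigr => s _; rewrite /= /mono !mcoeffU scalerMnr.
Qed.

Lemma laurent_scaleA a b f :
  laurent_scale a (laurent_scale b f) = laurent_scale (a * b) f.
Proof. by apply/malgP => r; rewrite !laurent_scaleE scalerA. Qed.
Lemma laurent_scale1 : left_id 1 laurent_scale.
Proof. by move=> f; apply/malgP => r; rewrite laurent_scaleE scale1r. Qed.
Lemma laurent_scaleDr : right_distributive laurent_scale +%R.
Proof.
move=> a f g; apply/malgP => r.
by rewrite !(laurent_scaleE, mcoeffD) scalerDr.
Qed.
Lemma laurent_scaleDl f : {morph laurent_scale^~ f : a b / a + b}.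
Proof.
by move=> a b; apply/malgP => r; rewrite !(laurent_scaleE, mcoeffD) scalerDl.
Qed.

HB.instance Definition _ := GRing.Zmodule_isLmodule.Build K laurent
  laurent_scaleA laurent_scale1 laurent_scaleDr laurent_scaleDl.

Lemma coefZ a f r : mcoeff r (a *: f : laurent) = a *: mcoeff r f.
Proof. exact: laurent_scaleE. Qed.

Lemma mono_lin r a x y : mono (a *: x + y) r = a *: mono x r + mono y r.
Proof.
apply/malgP => s; rewrite mcoeffD coefZ !mcoeffU.
by case: (r == s); rewrite ?mulr1n // !mulr0n scaler0 addr0.
Qed.

Definition lext (V : zmodType) (phi : int -> L -> V) f : V :=
  \sum_(r <- msupp f) phi r (mcoeff r f).

Section Lext.
Variables (V : lmodType K) (phi : int -> L -> V).
Hypothesis phi_lin : forall r a x y, phi r (a *: x + y) = a *: phi r x + phi r y.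

Let phi0 r : phi r 0 = 0.
Proof. by have := phi_lin r (-1) 0 0; rewrite !scaleN1r !addNr. Qed.

Lemma lextw (d : {fset int}) f : fsubset (msupp f) d ->
  lext phi f = \sum_(r <- d) phi r (mcoeff r f).
Proof.
by move=> le; apply: big_fset_incl => // r _ /mcoeff_outdom ->.
Qed.

Lemma lext_lin a f g : lext phi (a *: f + g) = a *: lext phi f + lext phi g.
Proof.
pose d := fsetU (msupp f) (fsetU (msupp g) (msupp (a *: f + g))).
rewrite (lextw (d := d)) ?(@lextw d f) ?(@lextw d g).
- rewrite scaler_sumr -big_split; apply: eq_bigr => r _ /=.
  by rewrite mcoeffD coefZ phi_lin.
- by rewrite /d fsetUA fsetUC fsetUA fsubsetUr.
- by rewrite /d fsubsetUl.
- by rewrite /d !fsetUA fsubsetUr.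
Qed.

Lemma lext_mono x r : lext phi (mono x r) = phi r x.
Proof.
rewrite (lextw (d := [fset r]%fset)) ?msuppU_le //.
by rewrite big_seq_fset1 mcoeffUU.
Qed.

End Lext.

Lemma laurent_ind (P : laurent -> Prop) : P 0 ->
  (forall f g, P f -> P g -> P (f + g)) -> (forall x r, P (mono x r)) ->
  forall f, P f.
Proof. by move=> P0 PD Pm f; rewrite (monalgE f); apply: (big_ind P) => // *; apply: Pm. Qed.

End Laurent.

Arguments mono {K L} x r.

Section Affine.
Variables (K : fieldType) (L : lieAlgType K).

(** [(f, a)] stands for [f + a c] with [f] in [L (x) K[t,t^-1]] and [c] the
    central element. The bracket on [affine B] depends on [B], the
    underlying space does not. *)
Definition affine (B : invForm L) : Type := (laurent L * K^o)%type.
HB.instance Definition _ B := GRing.Lmodule.on (affine B).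

Variable B : invForm L.

(** [(sum_r x_r t^r, sum_s y_s t^s) |-> sum_{r,s} [x_r, y_s] t^(r+s)] *)
Definition loop_lie (f g : laurent L) : laurent L :=
  lext (fun r x => lext (fun s y => mono [lie x, y] (r + s)) g) f.

(** [(sum_r x_r t^r, sum_s y_s t^s) |-> sum_{r,s} r delta_{r+s,0} (x_r, y_s)] *)
Definition cocycle (f g : laurent L) : K^o :=
  lext (V := K^o) (fun r x => lext (V := K^o) (fun s y =>
    if r + s == 0 then r%:~R * B x y else 0) g) f.

Definition affine_lie (p q : affine B) : affine B :=
  (loop_lie p.1 q.1, cocycle p.1 q.1).

Lemma formDr (a : K) x y z : B x (a *: y + z) = a * B x y + B x z.
Proof. by rewrite ![B x _]formC formDl. Qed.

Let lie_linl r s (y : L) a x x' : mono [lie a *: x + x', y] (r + s) =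
  a *: mono [lie x, y] (r + s) + mono [lie x', y] (r + s).
Proof. by rewrite lieDl mono_lin. Qed.
Let lie_linr r (x : L) s a y y' : mono [lie x, a *: y + y'] (r + s) =
  a *: mono [lie x, y] (r + s) + mono [lie x, y'] (r + s).
Proof. by rewrite lieDr mono_lin. Qed.

Let coc r s (x y : L) : K^o := if r + s == 0 then r%:~R * B x y else 0.
Let coc_linl r s y a x x' : coc r s (a *: x + x') y =
  a *: coc r s x y + coc r s x' y.
Proof.
rewrite /coc; case: ifP => _; last by rewrite scaler0 addr0.
by rewrite formDl mulrDr [a *: _]/(a * _) mulrCA.
Qed.
Let coc_linr r x s a y y' : coc r s x (a *: y + y') =
  a *: coc r s x y + coc r s x y'.
Proof.
rewrite /coc; case: ifP => _; last by rewrite scaler0 addr0.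
by rewrite formDr mulrDr [a *: _]/(a * _) mulrCA.
Qed.

Let lext_fun (V : lmodType K) (phi : int -> L -> int -> L -> V) :
  (forall r s y a x x', phi r (a *: x + x') s y =
     a *: phi r x s y + phi r x' s y) ->
  forall g r a x x', lext (phi r (a *: x + x')) g =
     a *: lext (phi r x) g + lext (phi r x') g.
Proof.
move=> H g r a x x'; rewrite /lext scaler_sumr -big_split.
by apply: eq_bigr => s _ /=.
Qed.

Lemma loop_lieDl a f f' g : loop_lie (a *: f + f') g =
  a *: loop_lie f g + loop_lie f' g.
Proof.
apply: lext_lin => r b x x'.
apply: (lext_fun (phi := fun r x s y => mono [lie x, y] (r + s))) => *.
exact: lie_linl.
Qed.

Lemma loop_lieDr a f g g' : loop_lie f (a *: g + g') =
  a *: loop_lie f g + loop_lie f g'.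
Proof.
rewrite /loop_lie {1 3 5}/lext scaler_sumr -big_split.
by apply: eq_bigr => r _ /=; apply: lext_lin => *; apply: lie_linr.
Qed.

Lemma loop_lie_mono x r y s :
  loop_lie (mono x r) (mono y s) = mono [lie x, y] (r + s).
Proof.
rewrite /loop_lie lext_mono => [|r' a x' x''].
  by rewrite lext_mono // => *; apply: lie_linr.
apply: (lext_fun (phi := fun r x s y => mono [lie x, y] (r + s))) => *.
exact: lie_linl.
Qed.

Lemma cocycleDl a f f' g : cocycle (a *: f + f') g =
  a *: cocycle f g + cocycle f' g.
Proof.
apply: lext_lin => r b x x'.
by apply: (lext_fun (phi := fun r x s y => coc r s x y)) => *; apply: coc_linl.
Qed.

Lemma cocycleDr a f g g' : cocycle f (a *: g + g') =
  a *: cocycle f g + cocycle f g'.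
Proof.
rewrite /cocycle {1 3 5}/lext scaler_sumr -big_split.
by apply: eq_bigr => r _ /=; apply: lext_lin => *; apply: coc_linr.
Qed.

Lemma cocycle_mono x r y s : cocycle (mono x r) (mono y s) =
  if r + s == 0 then r%:~R * B x y else 0.
Proof.
rewrite /cocycle lext_mono => [|r' a x' x''].
  by rewrite lext_mono // => *; apply: coc_linr.
by apply: (lext_fun (phi := fun r x s y => coc r s x y)) => *; apply: coc_linl.
Qed.

Lemma affine_lieDl (a : K) p q u :
  affine_lie (a *: p + q) u = a *: affine_lie p u + affine_lie q u.
Proof. by rewrite /affine_lie /= loop_lieDl cocycleDl. Qed.

Lemma affine_lieDr (a : K) p q u :
  affine_lie p (a *: q + u) = a *: affine_lie p q + affine_lie p u.
Proof. by rewrite /affine_lie /= loop_lieDr cocycleDr. Qed.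

Let lieP (P : affine B -> Prop) : P 0 ->
  (forall p q, P p -> P q -> P (p + q)) -> (forall x r, P (mono x r, 0)) ->
  (forall c : K, P (0, c)) -> forall p, P p.
Proof.
move=> P0 PD Pm Pc [f c].
have -> : (f, c) = (f, 0) + (0, c) :> affine B.
  by rewrite [RHS]/GRing.add /= /add_pair /= addr0 add0r.
apply: (PD) => //; move: f; apply: laurent_ind => // f g Pf Pg.
suff -> : (f + g, 0) = (f, 0) + (g, 0) :> affine B by apply: PD.
by rewrite [RHS]/GRing.add /= /add_pair /= addr0.
Qed.

Let lDl p q u : affine_lie (p + q) u = affine_lie p u + affine_lie q u.
Proof. by have := affine_lieDl 1 p q u; rewrite !scale1r. Qed.
Let lDr p q u : affine_lie p (q + u) = affine_lie p q + affine_lie p u.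
Proof. by have := affine_lieDr 1 p q u; rewrite !scale1r. Qed.
Let l0l u : affine_lie 0 u = 0.
Proof. by apply: (addIr (affine_lie 0 u)); rewrite -lDl !add0r. Qed.
Let l0r u : affine_lie u 0 = 0.
Proof. by apply: (addIr (affine_lie u 0)); rewrite -lDr !add0r. Qed.
Let lcl c u : affine_lie (0, c) u = 0.
Proof.
rewrite /affine_lie /= /loop_lie /cocycle /lext msupp0 !big_seq_fset0.
by [].
Qed.
Let lcr c u : affine_lie u (0, c) = 0.
Proof.
rewrite /affine_lie /= /loop_lie /cocycle /lext msupp0.
by rewrite !big1 // => *; rewrite big_seq_fset0.
Qed.
Let lmm x r y s : affine_lie (mono x r, 0) (mono y s, 0) =
  (mono [lie x, y] (r + s), if r + s == 0 then r%:~R * B x y else 0).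
Proof. by rewrite /affine_lie /= loop_lie_mono cocycle_mono. Qed.

Let pairD (f g : laurent L) (c d : K^o) :
  (f, c) + (g, d) = (f + g, c + d) :> affine B.
Proof. by []. Qed.

Let mono0 r : mono (0 : L) r = 0. Proof. exact: monalgU0. Qed.
Let monoD r (x y : L) : mono x r + mono y r = mono (x + y) r.
Proof. by rewrite /mono monalgUD. Qed.

Let lC p q : affine_lie p q + affine_lie q p = 0.
Proof.
move: p; apply: lieP => [|p p' e e'|x r|c].
- by rewrite l0l l0r addr0.
- by rewrite lDl lDr addrACA e e' addr0.
- move: q; apply: lieP => [|p p' e e'|y s|c].
  + by rewrite l0l l0r addr0.
  + by rewrite lDl lDr addrACA e e' addr0.
  + rewrite !lmm pairD (addrC s r) monoD lieC addNr mono0.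
    congr (_, _); case: eqP => [/eqP|]; last by rewrite addr0.
    rewrite addr_eq0 => /eqP ->; rewrite rmorphN /= mulNr formC.
    exact: addNr.
  + by rewrite lcl lcr addr0.
- by rewrite lcl lcr addr0.
Qed.

Lemma affine_liexx p : affine_lie p p = 0.
Proof.
move: p; apply: lieP => [|p q e f|x r|c].
- by rewrite l0l.
- by rewrite lDl !lDr e f addr0 add0r lC.
- rewrite lmm liexx mono0; congr (_, _); case: eqP => // /eqP.
  rewrite -mulr2n -mulr_natr mulf_eq0 orbF => /eqP ->.
  by rewrite mul0r.
- by rewrite lcl.
Qed.

Lemma affine_jacobi p q u :
  affine_lie p (affine_lie q u) + affine_lie q (affine_lie u p)
    + affine_lie u (affine_lie p q) = 0.
Proof.
have D (a b c a' b' c' : affine B) : a + b + c = 0 -> a' + b' + c' = 0 ->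
    (a + a') + (b + b') + (c + c') = 0.
  by move=> e e'; rewrite (addrACA a) (addrACA (a + b)) e e' addr0.
move: p; apply: lieP => [|p p' e e'|x r|c].
- by rewrite !(l0l, l0r) !addr0.
- by rewrite !(lDl, lDr); apply: D.
- move: q; apply: lieP => [|q q' e e'|y s|c].
  + by rewrite !(l0l, l0r) !addr0.
  + by rewrite !(lDl, lDr); apply: D.
  + move: u; apply: lieP => [|u u' e e'|z t|c].
    * by rewrite !(l0l, l0r) !addr0.
    * by rewrite !(lDl, lDr); apply: D.
    * rewrite /affine_lie /= !loop_lie_mono !cocycle_mono !pairD.
      rewrite [s + (t + r)]addrA [_ + r]addrC [t + (r + s)]addrC -[r + s + t]addrA.
      rewrite !monoD jacobi mono0; congr (_, _); case: eqP => [e|_]; last first.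
        by rewrite !addr0.
      rewrite -![B y _]form_inv -[B z _]form_inv [B [lie y, z] x]formC.
      rewrite [B [lie z, x] y]formC -[B y _]form_inv [B [lie y, z] x]formC.
      rewrite -!mulrDl -!rmorphD /= -addrA e; exact: mul0r.
    * by rewrite !(lcl, lcr, l0l, l0r) !addr0.
  + by rewrite !(lcl, lcr, l0l, l0r) !addr0.
- by rewrite !(lcl, lcr, l0l, l0r) !addr0.
Qed.

End Affine.

HB.instance Definition _ (K : fieldType) (L : lieAlgType K) (B : invForm L) :=
  isLieAlgebra.Build K (affine B) (@affine_lieDl K L B) (@affine_lieDr K L B)
    (@affine_liexx K L B) (@affine_jacobi K L B).

(** [U(L)] is the associative unital [K]-algebra generated by the elements of
    [L], subject to the linearity of [L -> U(L)] and to
    [[x, y] = x y - y x]; it is built as a quotient of formal expressions,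
    with opposites written as products by the constant [-1]. *)

Section Enveloping.
Variables (K : fieldType) (L : lieAlgType K).

Inductive uterm : Type :=
  | UGen of L
  | UConst of K
  | UAdd of uterm & uterm
  | UMul of uterm & uterm.

HB.instance Definition _ := gen_eqMixin uterm.
HB.instance Definition _ := gen_choiceMixin uterm.

Implicit Types (s t u : uterm) (x y : L) (a b : K).

Inductive ueq : uterm -> uterm -> Prop :=
  | ueq_refl s : ueq s s
  | ueq_sym s t : ueq s t -> ueq t s
  | ueq_trans s t u : ueq s t -> ueq t u -> ueq s u
  | ueq_cadd s s' t t' : ueq s s' -> ueq t t' -> ueq (UAdd s t) (UAdd s' t')
  | ueq_cmul s s' t t' : ueq s s' -> ueq t t' -> ueq (UMul s t) (UMul s' t')
  | ueq_addA s t u : ueq (UAdd s (UAdd t u)) (UAdd (UAdd s t) u)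
  | ueq_addC s t : ueq (UAdd s t) (UAdd t s)
  | ueq_add0 s : ueq (UAdd (UConst 0) s) s
  | ueq_addN s : ueq (UAdd (UMul (UConst (-1)) s) s) (UConst 0)
  | ueq_mulA s t u : ueq (UMul s (UMul t u)) (UMul (UMul s t) u)
  | ueq_mul1 s : ueq (UMul (UConst 1) s) s
  | ueq_mulDl s t u : ueq (UMul (UAdd s t) u) (UAdd (UMul s u) (UMul t u))
  | ueq_mulDr s t u : ueq (UMul s (UAdd t u)) (UAdd (UMul s t) (UMul s u))
  | ueq_constD a b : ueq (UConst (a + b)) (UAdd (UConst a) (UConst b))
  | ueq_constM a b : ueq (UConst (a * b)) (UMul (UConst a) (UConst b))
  | ueq_constC a s : ueq (UMul (UConst a) s) (UMul s (UConst a))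
  | ueq_genD x y : ueq (UGen (x + y)) (UAdd (UGen x) (UGen y))
  | ueq_genZ a x : ueq (UGen (a *: x)) (UMul (UConst a) (UGen x))
  | ueq_lie x y : ueq (UGen [lie x, y])
      (UAdd (UMul (UGen x) (UGen y))
            (UMul (UConst (-1)) (UMul (UGen y) (UGen x)))).

Definition ueqb s t := `[< ueq s t >].

Lemma ueqb_refl : reflexive ueqb.
Proof. by move=> s; apply/asboolP/ueq_refl. Qed.
Lemma ueqb_sym : symmetric ueqb.
Proof. by move=> s t; apply/asboolP/asboolP; apply: ueq_sym. Qed.
Lemma ueqb_trans : transitive ueqb.
Proof.
by move=> t s u /asboolP st /asboolP tu; apply/asboolP/(ueq_trans st tu).
Qed.

Canonical ueq_equiv := EquivRel ueqb ueqb_refl ueqb_sym ueqb_trans.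

Definition envel : Type := {eq_quot ueqb}.
HB.instance Definition _ : EqQuotient _ ueqb envel := EqQuotient.on envel.
HB.instance Definition _ := Choice.on envel.

Definition ucls s : envel := \pi_envel s.

Lemma uclsP s t : ucls s = ucls t <-> ueq s t.
Proof.
by split=> [/eqmodP/asboolP //|st]; apply/eqmodP/asboolP.
Qed.

Lemma ucls_ind (P : envel -> Prop) : (forall s, P (ucls s)) -> forall p, P p.
Proof. by move=> H p; rewrite -[p]reprK; apply: H. Qed.

Lemma repr_ucls s : ueq (repr (ucls s)) s.
Proof. by apply/uclsP; rewrite /ucls reprK. Qed.

Definition uadd (p q : envel) : envel := ucls (UAdd (repr p) (repr q)).
Definition umul (p q : envel) : envel := ucls (UMul (repr p) (repr q)).
Definition uscale a (p : envel) : envel := umul (ucls (UConst a)) p.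

Lemma uaddE s t : uadd (ucls s) (ucls t) = ucls (UAdd s t).
Proof. by apply/uclsP/ueq_cadd; apply: repr_ucls. Qed.
Lemma umulE s t : umul (ucls s) (ucls t) = ucls (UMul s t).
Proof. by apply/uclsP/ueq_cmul; apply: repr_ucls. Qed.

Let uE := (uaddE, umulE).

Lemma uaddA : associative uadd.
Proof.
do 3!elim/ucls_ind=> ?; rewrite !uE; apply/uclsP/ueq_addA.
Qed.
Lemma uaddC : commutative uadd.
Proof. by do 2!elim/ucls_ind=> ?; rewrite !uE; apply/uclsP/ueq_addC. Qed.
Lemma uadd0 : left_id (ucls (UConst 0)) uadd.
Proof. by elim/ucls_ind=> ?; rewrite !uE; apply/uclsP/ueq_add0. Qed.
Lemma uaddN : left_inverse (ucls (UConst 0)) (uscale (-1)) uadd.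
Proof. by elim/ucls_ind=> ?; rewrite /uscale !uE; apply/uclsP/ueq_addN. Qed.

HB.instance Definition _ := GRing.isZmodule.Build envel uaddA uaddC uadd0 uaddN.

Lemma umulA : associative umul.
Proof. by do 3!elim/ucls_ind=> ?; rewrite !uE; apply/uclsP/ueq_mulA. Qed.
Lemma umul1l : left_id (ucls (UConst 1)) umul.
Proof. by elim/ucls_ind=> ?; rewrite !uE; apply/uclsP/ueq_mul1. Qed.
Lemma umulC a p : umul (ucls (UConst a)) p = umul p (ucls (UConst a)).
Proof. by elim/ucls_ind: p => ?; rewrite !uE; apply/uclsP/ueq_constC. Qed.
Lemma umul1r : right_id (ucls (UConst 1)) umul.
Proof. by move=> p; rewrite -umulC umul1l. Qed.
Lemma umulDl : left_distributive umul uadd.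
Proof. by do 3!elim/ucls_ind=> ?; rewrite !uE; apply/uclsP/ueq_mulDl. Qed.
Lemma umulDr : right_distributive umul uadd.
Proof. by do 3!elim/ucls_ind=> ?; rewrite !uE; apply/uclsP/ueq_mulDr. Qed.

Fixpoint ueval (A : algType K) (rho : L -> A) (s : uterm) : A :=
  match s with
  | UGen x => rho x
  | UConst a => a%:A
  | UAdd s t => ueval rho s + ueval rho t
  | UMul s t => ueval rho s * ueval rho t
  end.

Lemma ueval_ueq (A : algType K) (rho : L -> A) :
  (forall a x y, rho (a *: x + y) = a *: rho x + rho y) ->
  (forall x y, rho [lie x, y] = rho x * rho y - rho y * rho x) ->
  forall s t, ueq s t -> ueval rho s = ueval rho t.
Proof.
move=> rho_lin rho_lie; have rho0 : rho 0 = 0.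
  by have := rho_lin (-1) 0 0; rewrite !scaleN1r !addNr.
move=> s t; elim=> {s t} //=.
- by move=> s t u _ -> _ ->.
- by move=> s s' t t' _ -> _ ->.
- by move=> s s' t t' _ -> _ ->.
- by move=> *; rewrite addrA.
- by move=> *; rewrite addrC.
- by move=> *; rewrite scale0r add0r.
- by move=> *; rewrite scale0r -scalerAl mul1r scaleN1r addNr.
- by move=> *; rewrite mulrA.
- by move=> *; rewrite scale1r mul1r.
- by move=> *; rewrite mulrDl.
- by move=> *; rewrite mulrDr.
- by move=> *; rewrite scalerDl.
- by move=> *; rewrite -scalerAl mul1r scalerA.
- by move=> *; rewrite -scalerAl mul1r -scalerAr mulr1.
- by move=> x y; have := rho_lin 1 x y; rewrite !scale1r.
- by move=> a x; have := rho_lin a x 0; rewrite rho0 !addr0 -scalerAl mul1r.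
- by move=> *; rewrite rho_lie -scalerAl mul1r scaleN1r.
Qed.

Lemma uone_neq0 : ucls (UConst 1) != 0 :> envel.
Proof.
apply/eqP => /uclsP/(ueval_ueq (A := K^o) (rho := fun=> 0)) /=.
move=> /(_ _ _)/eqP; rewrite scale1r scale0r oner_eq0 => H.
suff: false by []; apply: H => *; first by rewrite scaler0 addr0.
by rewrite mul0r subr0.
Qed.

HB.instance Definition _ := GRing.Zmodule_isNzRing.Build envel
  umulA umul1l umul1r umulDl umulDr uone_neq0.

Lemma uscaleA a b p : uscale a (uscale b p) = uscale (a * b) p.
Proof.
rewrite /uscale umulA umulE; congr umul; apply/uclsP/ueq_sym/ueq_constM.
Qed.
Lemma uscale1 : left_id 1 uscale. Proof. exact: umul1l. Qed.
Lemma uscaleDr : right_distributive uscale uadd.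
Proof. by move=> a; apply: umulDr. Qed.
Lemma uscaleDl p : {morph uscale^~ p : a b / a + b >-> uadd a b}.
Proof.
move=> a b; rewrite /uscale -umulDl uaddE; congr umul.
by apply/uclsP/ueq_constD.
Qed.

HB.instance Definition _ := GRing.Zmodule_isLmodule.Build K envel
  uscaleA uscale1 uscaleDr uscaleDl.

Lemma uscaleAl a (p q : envel) : a *: (p * q) = (a *: p) * q.
Proof. exact: umulA. Qed.
HB.instance Definition _ := GRing.Lmodule_isLalgebra.Build K envel uscaleAl.

Lemma uscaleAr a (p q : envel) : a *: (p * q) = p * (a *: q).
Proof.
by rewrite uscaleAl [a *: p]umulC [LHS](esym (umulA _ _ _)).
Qed.
HB.instance Definition _ := GRing.Lalgebra_isAlgebra.Build K envel uscaleAr.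

Definition uin x : envel := ucls (UGen x).

Lemma uin_lin a x y : uin (a *: x + y) = a *: uin x + uin y.
Proof.
transitivity (uadd (umul (ucls (UConst a)) (ucls (UGen x))) (ucls (UGen y))) => //.
rewrite umulE uaddE; apply/uclsP.
by apply: (ueq_trans (ueq_genD _ _)); apply: ueq_cadd; constructor.
Qed.

Lemma uin_lie x y : uin [lie x, y] = uin x * uin y - uin y * uin x.
Proof.
pose X := ucls (UGen x); pose Y := ucls (UGen y).
transitivity (uadd (umul X Y) (umul (ucls (UConst (-1))) (umul Y X))) => //.
rewrite /X /Y !umulE uaddE; exact/uclsP/ueq_lie.
Qed.

End Enveloping.

Definition subspace (K : pzRingType) (V : lmodType K) (S : set V) : Prop :=
  S 0 /\ forall (a : K) x y, S x -> S y -> S (a *: x + y).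

Definition subalgebra (K : pzRingType) (A : algType K) (S : set A) : Prop :=
  [/\ subspace S, S 1 & forall x y, S x -> S y -> S (x * y)].

Definition left_ideal (U : nzRingType) (S : set U) : Prop :=
  [/\ S 0, forall x y, S x -> S y -> S (x + y)
     & forall a x, S x -> S (a * x)].

Section LeftQuotient.
Variables (U : nzRingType) (G : set U).

Definition gen_left_ideal : {pred U} := fun x => `[< smallest (@left_ideal U) G x >].

Lemma gen_left_idealP : left_ideal (smallest (@left_ideal U) G).
Proof.
split; first by move=> J [[J0 _ _] _]; exact: J0.
  move=> x y Sx Sy J JG; case: (JG) => -[_ JD _] _.
  by apply: JD; [apply: Sx | apply: Sy].
move=> a x Sx J JG; case: (JG) => -[_ _ JM] _; apply: JM; exact: Sx.
Qed.

Lemma gen_left_ideal_zmod : zmod_closed gen_left_ideal.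
Proof.
case: gen_left_idealP => S0 SD SM; split; first exact/asboolP.
move=> x y /asboolP Sx /asboolP Sy; apply/asboolP; rewrite -mulN1r.
by apply: SD => //; apply: SM.
Qed.

HB.instance Definition _ := GRing.isZmodClosed.Build U gen_left_ideal
  gen_left_ideal_zmod.

Definition lquot : Type := Quotient.quot gen_left_ideal.
HB.instance Definition _ := GRing.Zmodule.on lquot.

Definition lcls (x : U) : lquot := \pi_(Quotient.quot gen_left_ideal) x.

Lemma lclsP x y : lcls x = lcls y <-> smallest (@left_ideal U) G (x - y).
Proof.
split=> [/eqP|/asboolP xy]; first by rewrite -Quotient.idealrBE => /asboolP.
by apply/eqP; rewrite -Quotient.idealrBE.
Qed.

Lemma lclsD x y : lcls (x + y) = lcls x + lcls y.
Proof. exact: Quotient.pi_add. Qed.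

Definition lscale (a : U) (v : lquot) : lquot :=
  lcls (a * repr (v : Quotient.quot gen_left_ideal)).

Lemma lscaleE a x : lscale a (lcls x) = lcls (a * x).
Proof.
apply/lclsP; rewrite -mulrBr; case: gen_left_idealP => _ _; apply.
by apply/lclsP; rewrite /lcls reprK.
Qed.

Lemma lcls_ind (P : lquot -> Prop) : (forall x, P (lcls x)) -> forall v, P v.
Proof.
by move=> H v; rewrite -[v](reprK (v : Quotient.quot gen_left_ideal)); apply: H.
Qed.

Lemma lscaleA a b v : lscale a (lscale b v) = lscale (a * b) v.
Proof. by elim/lcls_ind: v => x; rewrite !lscaleE mulrA. Qed.
Lemma lscale1 : left_id 1 lscale.
Proof. by elim/lcls_ind => x; rewrite lscaleE mul1r. Qed.
Lemma lscaleDr : right_distributive lscale +%R.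
Proof.
by move=> a; do 2!elim/lcls_ind => ?; rewrite -lclsD !lscaleE mulrDr lclsD.
Qed.
Lemma lscaleDl v : {morph lscale^~ v : a b / a + b}.
Proof. by move=> a b; elim/lcls_ind: v => x; rewrite !lscaleE mulrDl lclsD. Qed.

HB.instance Definition _ := GRing.Zmodule_isLmodule.Build U lquot
  lscaleA lscale1 lscaleDr lscaleDl.

End LeftQuotient.

Section Vacuum.
Variables (K : fieldType) (L : lieAlgType K) (B : invForm L).

Local Notation U := (envel (affine B)).

Definition loop (x : L) (r : int) : U := uin ((mono x r, 0) : affine B).

(** [g (+) K c (+) g^_+] *)
Definition affine_ge0 : set (affine B) :=
  [set p | forall r : int, r < 0 -> mcoeff r p.1 = 0].
Definition affine_lt0 : set (affine B) :=
  [set p | p.2 = 0 /\ forall r : int, 0 <= r -> mcoeff r p.1 = 0].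

(** [U(g^_-)] is identified with its image in [U(g^)], the subalgebra generated
    by [g^_-]. *)
Definition U_minus : set U :=
  smallest (@subalgebra K U) [set uin p | p in affine_lt0].

(** The module induced from the one-dimensional representation
    [chi : (f, a) |-> k a] of [p := affine_ge0], that is
    [U(g^) (x)_{U(p)} K = U(g^) / U(g^) {x - chi(x) | x in p}]. *)
Definition vacuum_rel (k : K) : set U :=
  [set uin p - (k * p.2)%:A | p in affine_ge0].

Definition vacmod (k : K) : lmodType U := lquot (vacuum_rel k).

Definition vac (k : K) : vacmod k := lcls (vacuum_rel k) 1.

End Vacuum.

Arguments loop {K L} B x r.
Arguments U_minus {K L} B.
Arguments vacuum_rel {K L} B k.
Arguments vac {K L} B k.
Arguments vacmod {K L} B k.

Section LieNotions.
Variables (K : fieldType) (g : finLieAlgType K).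
Implicit Types (x y : g) (h I : {vspace g}).

Definition simple_lie : Prop :=
  (exists x y, [lie x, y] != 0) /\
  forall I, (forall x y, y \in I -> [lie x, y] \in I) ->
    I = 0%VS \/ I = fullv.

(** A nilpotent self-normalizing subalgebra; nilpotency is expressed on the
    iterated brackets spanning the lower central series. *)
Definition cartan_subalgebra h : Prop :=
  [/\ {in h &, forall x y, [lie x, y] \in h},
      exists m, forall (s : seq g) x, size s = m -> {subset s <= h} ->
        x \in h -> foldr lie x s = 0
    & forall x, {in h, forall y, [lie x, y] \in h} -> x \in h].

Definition weight_space h (f : g -> K) : set g :=
  [set x | {in h, forall y, [lie y, x] = f y *: x}].

Definition is_root h (f : g -> K) : Prop :=
  (exists2 y, y \in h & f y != 0) /\ (exists2 x, x != 0 & weight_space h f x).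

(** [t] is the element of [h] corresponding to the functional [f] under the
    identification of [h] with its dual given by [B]. *)
Definition dual_elt (B : invForm g) h (f : g -> K) (t : g) : Prop :=
  t \in h /\ {in h, forall y, B t y = f y}.

Definition sq_length (B : invForm g) h (f : g -> K) (a : K) : Prop :=
  exists2 t, dual_elt B h f t & B t t = a.

(** [c = 2 f / (f, f)] *)
Definition is_coroot (B : invForm g) h (f : g -> K) (c : g) : Prop :=
  exists2 t, dual_elt B h f t & B t t != 0 /\ c = (2 / B t t) *: t.

End LieNotions.

(** The pair [(i, j)] stands for [i alpha + j beta]. *)
Definition lincomb (K : fieldType) (g : finLieAlgType K)
    (alpha beta : {scalar g}) (w : int * int) (y : g) : K :=
  w.1%:~R * alpha y + w.2%:~R * beta y.

Definition posroots : seq (int * int) :=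
  [:: (1, 0); (0, 1); (1, 1); (2, 1); (3, 1); (3, 2)].
Definition long_posroots : seq (int * int) := [:: (0, 1); (3, 1); (3, 2)].

(** [E w], [F w] and [H w] are only meaningful for [w \in posroots]; only the
    restrictions of [alpha] and [beta] to [cartan] matter. *)
Record G2_data (K : fieldType) (g : finLieAlgType K) := G2Data {
  cartan : {vspace g};
  alpha : {scalar g};
  beta : {scalar g};
  bform : invForm g;
  E : int * int -> g;
  F : int * int -> g;
  H : int * int -> g;
  rootfun := lincomb alpha beta;
  G2_simple : simple_lie g;
  G2_cartan : cartan_subalgebra cartan;
  G2_free : forall a b : K,
    {in cartan, forall y, a * alpha y + b * beta y = 0} -> a = 0 /\ b = 0;
  G2_roots : forall f : {scalar g}, is_root cartan f <->
    exists2 w, w \in posroots &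
      {in cartan, f =1 rootfun w} \/ {in cartan, f =1 rootfun (- w)};
  G2_long : {in long_posroots, forall w, sq_length bform cartan (rootfun w) 2};
  G2_E : {in posroots, forall w, weight_space cartan (rootfun w) (E w)};
  G2_F : {in posroots, forall w, weight_space cartan (rootfun (- w)) (F w)};
  G2_H : {in posroots, forall w, is_coroot bform cartan (rootfun w) (H w)};
  G2_EF : {in posroots, forall w, [lie E w, F w] = H w};
  G2_E11 : E (1, 1) = [lie E (1, 0), E (0, 1)];
  G2_E21 : E (2, 1) = 2^-1 *: [lie E (1, 1), E (1, 0)];
  G2_E31 : E (3, 1) = 3^-1 *: [lie E (2, 1), E (1, 0)];
  G2_E32 : E (3, 2) = [lie E (3, 1), E (0, 1)]
}.

Section G2.
Variables (K : fieldType) (g : finLieAlgType K) (D : G2_data g).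

Local Notation U := (envel (affine (bform D))).

Definition nplus : set g :=
  smallest (@subspace K g)
    [set x | exists2 w, w \in posroots & weight_space (cartan D) (rootfun D w) x].

(** [n_+ (+) g^_+] *)
Definition affine_nplus : set (affine (bform D)) :=
  [set p | [/\ p.2 = 0, nplus (mcoeff 0 p.1)
             & forall r : int, r < 0 -> mcoeff r p.1 = 0]].

Definition singular (k : K) (x : vacmod (bform D) k) : Prop :=
  x != 0 /\ forall p, affine_nplus p -> uin p *: x = 0.

(** Products [X_1(-r_1) ... X_l(-r_l)] with [r_i > 0] and [X_i] of weight
    [gamma_i], where [w = sum gamma_i] and [m = sum r_i]. *)
Inductive wt_monomial : U -> int * int -> nat -> Prop :=
  | wt_one : wt_monomial 1 0 0
  | wt_mul x w r p w' m : weight_space (cartan D) (rootfun D w) x -> (0 < r)%N ->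
      wt_monomial p w' m ->
      wt_monomial (loop (bform D) x (- r%:Z) * p) (w + w') (r + m).

(** [N(k,0)_(lambda)] for [lambda = k Lambda_0 + w - m delta]. *)
Definition vac_weight_space (k : K) (w : int * int) (m : nat) :
    set (vacmod (bform D) k) :=
  [set p *: vac (bform D) k | p in
     smallest (@subspace K U) [set p | wt_monomial p w m]].

Local Notation "x @ r" := (loop (bform D) x r) (at level 30).
Local Notation E := (E D).
Local Notation F := (F D).
Local Notation H := (H D).

Definition elt_a : U := E (2, 1) @ -1.
Definition elt_b : U :=
  (E (3, 1) @ -1) * (E (1, 1) @ -1) - (E (3, 2) @ -1) * (E (1, 0) @ -1).
Definition elt_c : U :=
  (E (3, 1) @ -1) ^+ 2 * (E (0, 1) @ -1)
  - (E (3, 2) @ -1) * (E (3, 1) @ -1) * (H (0, 1) @ -1)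
  - (E (3, 2) @ -1) ^+ 2 * (F (0, 1) @ -1).
Definition elt_w : U :=
  (E (3, 1) @ -1) * (E (3, 2) @ -2) - (E (3, 2) @ -1) * (E (3, 1) @ -2).
Definition elt_u : U := 3^-1 *: elt_a ^+ 2 - elt_b.
Definition elt_v : U := (2 / 9) *: elt_a ^+ 3 - elt_a * elt_b - 3 *: elt_c.

(** [U(g^_-) w.1] *)
Definition w_submodule (k : K) : set (vacmod (bform D) k) :=
  [set p *: (elt_w *: vac (bform D) k) | p in U_minus (bform D)].

End G2.

Arguments vac_weight_space {K g} D k w m.
Arguments singular {K g} D {k} x.
Arguments w_submodule {K g} D k.

Definition dnum (n : nat) : nat :=
  if odd n then ((n + 3) %/ 6)%N else ((n + 6) %/ 6)%N.

(* Main.v *)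
From HB Require Import structures.
From mathcomp Require Import all_boot all_order all_algebra.
From mathcomp Require Import finmap monalg.
From mathcomp Require Import boolp classical_sets reals complex.
From mathcomp Require Import ring zify.
Require Import Defs.

(** The idea is to evaluate vectors of the vacuum module on a family of linear
    functionals that turn the singular vector equations into equations between
    polynomials.

    Invariants. Let [sl_2] be the subalgebra of [beta], with raising operator
    [E01(0)] and lowering operator [F01(0)], acting on the negative modes by
    brackets. Call [j - i + r] the depth of [X(-r)] when [X] has weight
    [i alpha + j beta]. A vector of weight [k Lambda_0 + n theta^vee - n delta]
    has total depth [0] and is annihilated by [H01(0)]. The only mode
    of negative depth is [E31(-1)], which [F01(0)] produces from [E32(-1)], so
    modulo the image of [F01(0)] it can be eliminated. What is left consists of
    modes of depth zero: [E32(-1)] and the lowest vectors [E21(-1)],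
    [E10(-1)], [F01(-1)], [E31(-2)] of four multiplets. The contractions of
    these multiplets with the doublet [E31(-1)], [E32(-1)] are the elements
    [a], [b], [c], [w], and an induction on the length shows that every vector
    of this weight is a combination of the [a^i b^j c^l w^q] plus an element
    [F01(0) z] ([mon_decomp]). If moreover [E01(0)] annihilates the vector,
    then [F01(0) z] vanishes by the representation theory of [sl_2], because
    [z] has weight 2 ([sl2_descent]). So a singular vector is a combination
    of the [a^i b^j c^l w^q] ([invariant_ordsum]).

    Functionals. A linear form on the affine algebra that is a character both on
    the negative and on the nonnegative half extends to the enveloping algebra
    as a functional vanishing on the annihilator of the vacuum, provided that
    it takes [K] to [k] and [X(r)] to [0] for [r >= 0]. The form
    [X(-1) |-> pi X], [X(-r) |-> 0] for [r > 1] is admissible for every linear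
    form [pi] ([vacfun_vac0]). Choosing [pi] we give [a], [b], [c] arbitrary
    values, while [w] has value zero. A vector thus determines a polynomial in
    the values of [a], [b], [c]: the part of the combination free of [w].

    The equations. Being annihilated by [E11(0)], this polynomial is constant
    along the curves on which [u] and [v] are constant, hence is a polynomial in
    [u] and [v] ([wval_flow]). At [a = 0] the functional takes [F10(1) u^i v^j]
    to [i (i - 1) u^(i-1) v^j - 3 j (j - 1) u^(i+2) v^(j-2)], by
    [3 k + 7 = n = 2 i + 3 j], and multiples of [w] do not contribute
    ([fmode_uv], [fmode_ordmon]). This is the recurrence for the coefficients,
    whose solution is the stated product of binomial coefficients
    ([uv_closed]).

    If the first coefficient were zero, all of them would be, and the singular
    vector would be a combination of multiples of [w]. But [E01(1)] turns
    each factor [w] into [E32(-1)^2], up to terms of value zero, so that the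
    powers of [E01(1)] detect the coefficients of such a combination one power
    of [w] at a time ([ordsum_coef0]); they all vanish, a contradiction. *)

Set Implicit Arguments.
Unset Strict Implicit.
Unset Printing Implicit Defensive.

Import Order.TTheory GRing.Theory Num.Theory.
Local Open Scope ring_scope.

(** * Linear identities in modules *)

Section LinComb.
Variables (K : comPzRingType) (V : lmodType K).

Inductive lterm : Type :=
  | LAtom of nat | LZero | LAdd of lterm & lterm | LOpp of lterm
  | LScale of K & lterm.

Fixpoint leval (env : seq V) t : V :=
  match t with
  | LAtom n => env`_n
  | LZero => 0
  | LAdd s t => leval env s + leval env t
  | LOpp s => - leval env s
  | LScale a s => a *: leval env s
  end.

(** The vectors compared below are products of noncommuting letters, so only
    the linear structure is normalized, through the coefficient of each
    vector. *)
Fixpoint lcoef t (n : nat) : K :=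
  match t with
  | LAtom m => if m == n then 1 else 0
  | LZero => 0
  | LAdd s t => lcoef s n + lcoef t n
  | LOpp s => - lcoef s n
  | LScale a s => a * lcoef s n
  end.

Fixpoint lbound t n : bool :=
  match t with
  | LAtom m => (m < n)%N
  | LZero => true
  | LAdd s t => lbound s n && lbound t n
  | LOpp s | LScale _ s => lbound s n
  end.

Lemma levalE env t : lbound t (size env) ->
  leval env t = \sum_(i < size env) lcoef t i *: env`_i.
Proof.
elim: t => [m|||s IH|a s IH] //=.
- move=> lt; rewrite (bigD1 (Ordinal lt)) //= eqxx scale1r big1 ?addr0 // => i ne.
  by case: eqP => [e|]; rewrite ?scale0r //; case/eqP: ne; apply: val_inj.
- by move=> _; rewrite big1 // => i _; rewrite scale0r.
- move=> s IHs t IHt /andP[/IHs -> /IHt ->]; rewrite -big_split /=.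
  by apply: eq_bigr => i _; rewrite scalerDl.
- by move=> /IH ->; rewrite -sumrN; apply: eq_bigr => i _; rewrite scaleNr.
- by move=> /IH ->; rewrite scaler_sumr; apply: eq_bigr => i _; rewrite scalerA.
Qed.

Fixpoint lall (n : nat) (P : nat -> Prop) : Prop :=
  if n is m.+1 then P m /\ lall m P else True.

Lemma lcombP env s t : lbound s (size env) -> lbound t (size env) ->
  lall (size env) (fun i => lcoef s i = lcoef t i) -> leval env s = leval env t.
Proof.
move=> bs bt H; rewrite !levalE //.
suff H1 (n : nat) : (n < size env)%N -> lcoef s n = lcoef t n.
  by apply: eq_bigr => i _; rewrite H1.
elim: (size env) H => //= k IH [e H] lt; move: lt; rewrite ltnS leq_eqVlt.
by case/orP => [/eqP ->//|]; apply: IH.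
Qed.
End LinComb.

Ltac lmem x l :=
  lazymatch l with
  | nil => constr:(false)
  | cons ?y ?l' => let b := match constr:(Set) with
       | _ => let _ := match constr:(Set) with _ => unify x y end in constr:(true)
       | _ => lmem x l' end in b
  end.
Ltac latoms t l :=
  lazymatch t with
  | @GRing.add _ ?a ?b => let l := latoms a l in latoms b l
  | @GRing.opp _ ?a => latoms a l
  | @GRing.scale _ _ _ ?a => latoms a l
  | @GRing.zero _ => l
  | _ => let b := lmem t l in
         lazymatch b with true => l | false => constr:(cons t l) end
  end.
Ltac lindex x l :=
  lazymatch l with
  | cons ?y ?l' => match constr:(Set) with
       | _ => let _ := match constr:(Set) with _ => unify x y end in constr:(0%N)
       | _ => let n := lindex x l' in constr:(S n) end
  end.
Ltac lreify K t l :=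
  lazymatch t with
  | @GRing.add _ ?a ?b => let a := lreify K a l in let b := lreify K b l in constr:(@LAdd K a b)
  | @GRing.opp _ ?a => let a := lreify K a l in constr:(@LOpp K a)
  | @GRing.scale _ _ ?k ?a => let a := lreify K a l in constr:(@LScale K k a)
  | @GRing.zero _ => constr:(@LZero K)
  | _ => let n := lindex t l in constr:(@LAtom K n)
  end.
(** Reduces an equality of two linear combinations to the equalities of the
    coefficients. Everything that is not a sum, an opposite or a multiple is
    an atom; atoms are identified up to conversion, so products have to be
    brought to a common form beforehand. *)
Ltac lmod K :=
  lazymatch goal with
  | |- @eq ?T ?s ?t =>
    let l := latoms s (@nil T) in let l := latoms t l in
    let s' := lreify K s l in let t' := lreify K t l in
    apply: (@lcombP K _ l s' t' isT isT); rewrite /=; repeat split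
  end.

(** * Brackets, commutators and spans *)

Section LieLinear.
Variables (K : fieldType) (L : lieAlgType K).
Implicit Types x y z : L.

Lemma lieDlE x y z : [lie x + y, z] = [lie x, z] + [lie y, z].
Proof. by have := lieDl (1 : K) x y z; rewrite !scale1r. Qed.
Lemma lieDrE x y z : [lie x, y + z] = [lie x, y] + [lie x, z].
Proof. by have := lieDr (1 : K) x y z; rewrite !scale1r. Qed.
Lemma lie0l x : [lie 0, x] = 0.
Proof. by apply: (addIr [lie 0, x]); rewrite -lieDlE !add0r. Qed.
Lemma lie0r x : [lie x, 0] = 0.
Proof. by rewrite lieC lie0l oppr0. Qed.
Lemma lieZl a x y : [lie a *: x, y] = a *: [lie x, y].
Proof. by have := lieDl a x 0 y; rewrite !(addr0, lie0l). Qed.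
Lemma lieZr a x y : [lie x, a *: y] = a *: [lie x, y].
Proof. by have := lieDr a x y 0; rewrite !(addr0, lie0r). Qed.
Lemma lieNl x y : [lie - x, y] = - [lie x, y].
Proof. by rewrite -scaleN1r lieZl scaleN1r. Qed.
Lemma lieNr x y : [lie x, - y] = - [lie x, y].
Proof. by rewrite -scaleN1r lieZr scaleN1r. Qed.
Lemma lie_derl x y z : [lie x, [lie y, z]] = [lie [lie x, y], z] + [lie y, [lie x, z]].
Proof.
have := jacobi x y z; rewrite (lieC z x) lieNr (lieC z [lie x, y]).
by rewrite -addrA -opprD => /eqP; rewrite subr_eq0 addrC => /eqP; rewrite addrC.
Qed.
Lemma lie_derr x y z : [lie [lie x, y], z] = [lie [lie x, z], y] + [lie x, [lie y, z]].
Proof. by rewrite (lie_derl x y z) (lieC [lie x, z]) addrCA addNr addr0. Qed.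

End LieLinear.

Section Comm.
Variables (K : fieldType) (U : algType K).
Implicit Types p q r : U.
Definition comm p q := p * q - q * p.
Lemma commMr p q r : comm p (q * r) = comm p q * r + q * comm p r.
Proof. by rewrite /comm mulrBl mulrBr !mulrA addrA subrK. Qed.
Lemma commMl p q r : comm (p * q) r = p * comm q r + comm p r * q.
Proof. by rewrite /comm mulrBl mulrBr !mulrA addrA subrK. Qed.
Lemma comm_linr a p q r : comm p (a *: q + r) = a *: comm p q + comm p r.
Proof. by rewrite /comm mulrDr mulrDl -scalerAl -scalerAr opprD addrACA scalerBr. Qed.
Lemma comm1r p : comm p 1 = 0. Proof. by rewrite /comm mulr1 mul1r subrr. Qed.
Lemma comm1l p : comm 1 p = 0. Proof. by rewrite /comm mulr1 mul1r subrr. Qed.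
Lemma comm0r p : comm p 0 = 0. Proof. by rewrite /comm mulr0 mul0r subrr. Qed.
Lemma commDr p q r : comm p (q + r) = comm p q + comm p r.
Proof. by have := comm_linr 1 p q r; rewrite !scale1r. Qed.
Lemma commZr a p q : comm p (a *: q) = a *: comm p q.
Proof. by have := comm_linr a p q 0; rewrite comm0r !addr0. Qed.
Lemma commNr p q : comm p (- q) = - comm p q.
Proof. by rewrite -scaleN1r commZr scaleN1r. Qed.
Lemma commBr p q r : comm p (q - r) = comm p q - comm p r.
Proof. by rewrite commDr commNr. Qed.
Lemma comm_mulE p q : p * q = q * p + comm p q.
Proof. by rewrite /comm addrC subrK. Qed.
Lemma comm_eq0 p q : comm p q = 0 -> p * q = q * p.
Proof. by move=> e; rewrite comm_mulE e addr0. Qed.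
Lemma commX0 p q n : comm p q = 0 -> comm p (q ^+ n) = 0.
Proof.
move=> e; elim: n => [|n IH]; first by rewrite expr0 comm1r.
by rewrite exprS commMr e IH mul0r mulr0 addr0.
Qed.
Lemma comm_sym0 p q : comm p q = 0 -> comm q p = 0.
Proof. by move=> e; rewrite /comm -opprB -/(comm p q) e oppr0. Qed.
Lemma commM0r p q r : comm p q = 0 -> comm p r = 0 -> comm p (q * r) = 0.
Proof. by move=> e1 e2; rewrite commMr e1 e2 mul0r mulr0 addr0. Qed.
End Comm.

Section Span.
Variables (K : fieldType) (V : lmodType K).
Implicit Types (S : set V) (x y : V).
Local Open Scope classical_set_scope.
Definition span S : set V := smallest (@subspace K V) S.
Lemma span_sub S x : S x -> span S x.
Proof. by move=> Sx T [_ ST]; apply: ST. Qed.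
Lemma span_subspace S : subspace (span S).
Proof.
split; first by move=> T [[T0 _] _].
move=> a x y Hx Hy T HT; have [_ TL] := HT.1.
by apply: TL; [apply: Hx | apply: Hy].
Qed.
Lemma span_min S (T : set V) x : subspace T -> (forall y, S y -> T y) -> span S x -> T x.
Proof. by move=> HT ST; apply; split. Qed.
Lemma subspaceD (T : set V) x y : subspace T -> T x -> T y -> T (x + y).
Proof. by case=> _ H Tx Ty; rewrite -[x]scale1r; apply: H. Qed.
Lemma subspaceZ (T : set V) a x : subspace T -> T x -> T (a *: x).
Proof. by case=> T0 H Tx; rewrite -[_ *: _]addr0; apply: H. Qed.
Lemma subspaceN (T : set V) x : subspace T -> T x -> T (- x).
Proof. by move=> H Tx; rewrite -scaleN1r; apply: subspaceZ. Qed.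
Lemma subspaceB (T : set V) x y : subspace T -> T x -> T y -> T (x - y).
Proof. by move=> H Tx Ty; apply: subspaceD => //; apply: subspaceN. Qed.
End Span.

(** * Commutator identities for an [sl_2]-triple *)

Section Sl2.
Variables (K : numFieldType) (U : algType K).
Variables (f X Y : U).
Hypothesis XY : X * Y = Y * X.

(** With [X], [Y] a doublet and [e0], [h0], [f0] a triplet for the [sl_2]
    whose lowering operator is [f], this is the invariant obtained by
    contracting the square of the doublet, which is again a triplet, with
    the given triplet. *)
Lemma comm_triplet e0 h0 f0 : comm f X = 0 -> comm f Y = - X -> comm f e0 = - h0 ->
  comm f h0 = 2 *: f0 -> comm f f0 = 0 ->
  comm f (X ^+ 2 * e0 - Y * X * h0 - Y ^+ 2 * f0) = 0.
Proof.
move=> fX fY fe fh ff.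
rewrite !commBr !commMr fe fh ff !fX !fY.
rewrite !(mul0r, mulr0, addr0, add0r) !(mulrN, mulNr, mulrDl).
rewrite -[Y * X * _]scalerAr -XY expr2.
by lmod K; ring.
Qed.

(** Both the invariant [X hi - Y lo] and the image under [f] of [hi Y^(s+1)
    Z] relate the two monomials [X hi Y^s Z] and [lo Y^(s+1) Z]; eliminating
    the first one leaves the monomial in the lowest vector [lo]. *)
Lemma peel_doublet s hi lo Z : comm f (Y ^+ s.+1) = - (s.+1%:R *: (X * Y ^+ s)) ->
  comm f hi = - lo -> comm f Z = 0 -> comm hi X = 0 -> comm lo Y = 0 ->
  s.+2%:R *: (lo * (Y ^+ s.+1 * Z)) =
  - (s.+1%:R *: ((X * hi - Y * lo) * (Y ^+ s * Z)) + comm f (hi * (Y ^+ s.+1 * Z))).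
Proof.
move=> fYs fh fZ hX lY.
rewrite 2!commMr fh fZ mulr0 addr0 fYs mulrBl.
rewrite -(comm_eq0 hX) -(comm_eq0 lY) -(mulrA lo) -(mulrA hi).
rewrite [Y * (Y ^+ s * Z)]mulrA -exprS !(mulNr, mulrN) -scalerAl -scalerAr.
rewrite -[s.+2%:R]natr1 !mulrA.
by lmod K; ring.
Qed.

(** The analogue of [peel_doublet] for a triplet: the three monomials in
    [e0], [h0] and [f0] are related by the invariant and by two images under
    [f], which leaves the monomial in the lowest vector [f0]. The last
    summand collects the commutators of the triplet with the powers of [Y]. *)
Lemma peel_triplet s e0 h0 f0 Z : comm f X = 0 -> comm f e0 = - h0 ->
  comm f h0 = 2 *: f0 -> comm f Z = 0 ->
  comm f (Y ^+ s.+1) = - (s.+1%:R *: (X * Y ^+ s)) ->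
  comm f (Y ^+ s.+2) = - (s.+2%:R *: (X * Y ^+ s.+1)) ->
  Y ^+ s.+2 * f0 * Z = (- (s.+3%:R^-1 * s.+1%:R)) *:
      ((X ^+ 2 * e0 - Y * X * h0 - Y ^+ 2 * f0) * (Y ^+ s * Z))
   + comm f (s.+3%:R^-1 *: (Y ^+ s.+2 * h0 * Z) - s.+3%:R^-1 *: (X * Y ^+ s.+1 * e0 * Z))
   + (s.+3%:R^-1 * s.+1%:R) *: ((X ^+ 2 * comm e0 (Y ^+ s) - Y * X * comm h0 (Y ^+ s)
   - Y ^+ 2 * comm f0 (Y ^+ s)) * Z).
Proof.
move=> fX fe fh fZ fY1 fY2.
pose al := X ^+ 2 * Y ^+ s * e0 * Z.
pose be := X * Y ^+ s.+1 * h0 * Z.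
pose ga := Y ^+ s.+2 * f0 * Z.
have f1 : comm f (X * Y ^+ s.+1 * e0 * Z) = - (s.+1%:R *: al) - be.
  rewrite 3!commMr fX fZ fe fY1 mul0r add0r mulr0 addr0 !mulrDl.
  rewrite !(mulrN, mulNr) -!scalerAr -!scalerAl; congr (- (_ *: _) - _).
  by rewrite /al expr2 !mulrA.
have f2 : comm f (Y ^+ s.+2 * h0 * Z) = 2 *: ga - s.+2%:R *: be.
  rewrite 2!commMr fZ fh fY2 mulr0 addr0 !mulrDl.
  by rewrite addrC !mulNr -!scalerAr -!scalerAl.
set corr := (X ^+ 2 * _ - _ - _) * Z.
have ec : (X ^+ 2 * e0 - Y * X * h0 - Y ^+ 2 * f0) * (Y ^+ s * Z) = al - be - ga + corr.
  rewrite /corr !mulrBl /comm !mulrBr !mulrBl /al /be /ga !mulrA.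
  rewrite -XY -[Y ^+ s.+2]/(Y ^+ (2 + s)) exprD [Y ^+ s.+1]exprS !mulrA.
  by lmod K; ring.
rewrite ec commBr !commZr f1 f2 -/ga.
rewrite -[s.+3%:R]natr1 -[s.+2%:R]natr1.
have n1 : 1 + s%:R + 1 + 1 != 0 :> K by rewrite -[1]/(1%:R) -!natrD pnatr_eq0.
by lmod K; field.
Qed.
Lemma scale_solve (V : lmodType K) (n m : K) (L V1 V2 : V) : n != 0 ->
  n *: L = - (m *: V1 + V2) -> L = (- (n^-1 * m)) *: V1 + (- n^-1) *: V2.
Proof.
move=> n0 E; rewrite -[LHS]scale1r -(mulVf n0) -scalerA E.
by lmod K; ring.
Qed.
End Sl2.

Section Sl2Raising.
Variables (K : numFieldType) (U : algType K).
Variables (e X Y : U).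

Lemma comm_triplet_up e0 h0 f0 : X * Y = Y * X -> comm e X = - Y -> comm e Y = 0 ->
  comm e e0 = 0 -> comm e h0 = - 2 *: e0 -> comm e f0 = h0 ->
  comm e (X ^+ 2 * e0 - Y * X * h0 - Y ^+ 2 * f0) = 0.
Proof.
move=> XY eX eY ee eh ef.
rewrite !commBr !commMr ee eh ef !eX !eY.
rewrite !(mul0r, mulr0, addr0, add0r) !(mulrN, mulNr, mulrDl).
rewrite -[Y * X * (_ *: _)]scalerAr -XY expr2.
by lmod K; ring.
Qed.

Lemma comm_doublet_up hi lo : comm e X = - Y -> comm e Y = 0 -> comm e hi = 0 ->
  comm e lo = - hi -> comm e (X * hi - Y * lo) = 0.
Proof.
move=> eX eY eh el; rewrite commBr !commMr eX eY eh el.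
by rewrite mul0r mulr0 addr0 add0r mulrN mulNr opprK addNr.
Qed.

Lemma comm_jacobi (p q z : U) : comm p (comm q z) = comm q (comm p z) + comm (comm p q) z.
Proof.
rewrite /comm !mulrBr !mulrBl !mulrA; by lmod K; ring.
Qed.

(** If [e f z] is zero modulo the subspace [S] then so is [z]: the vectors
    [e^j f z] and [f e^j z] differ by [j (j + 1) e^(j-1) z], so membership
    in [S] descends along the chain of the [e^j z], which reaches [S]. *)
Lemma sl2_descent (S : set U) (f h z : U) : subspace S ->
  (forall p, S p -> S (comm e p)) -> (forall p, S p -> S (comm f p)) ->
  comm e f = h ->
  (forall j, comm h (iter j (comm e) z) = (2 * j.+1%:R) *: iter j (comm e) z) ->
  (exists N, S (iter N (comm e) z)) -> S (comm e (comm f z)) -> S z.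
Proof.
move=> SS Se Sf efh hz [N SN] Sefz.
have chain j : iter j (comm e) (comm f z) =
    comm f (iter j (comm e) z) + (j%:R * j.+1%:R) *: iter j.-1 (comm e) z.
  elim: j => [|j IH]; first by rewrite /= mul0r scale0r addr0.
  rewrite iterS IH commDr commZr comm_jacobi efh hz /= -addrA; congr (_ + _).
  case: j {IH} => [|j] /=.
    by lmod K; ring.
  rewrite -scalerDl; congr (_ *: _); rewrite -[j.+3%:R]natr1 -[j.+2%:R]natr1.
  by ring.
have Sj j : S (iter j.+1 (comm e) (comm f z)).
  by elim: j => [|j IH]; [exact: Sefz | rewrite iterS; apply: Se].
have down j : S (iter j.+1 (comm e) z) -> S (iter j (comm e) z).
  move=> H; have := Sj j; rewrite chain /= => H2.
  have n0 : (j.+1%:R * j.+2%:R : K) != 0 by rewrite mulf_neq0 // pnatr_eq0.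
  rewrite -[iter j _ z]scale1r -(mulVf n0) -scalerA; apply: subspaceZ => //.
  have := subspaceB SS H2 (Sf _ H); rewrite /= addrAC subrr add0r; exact.
by elim: N SN => // N IH /down.
Qed.
End Sl2Raising.

(** * Polynomial identities and reindexing *)

Section Sums.
Variable K : numFieldType.

Lemma poly_eq0_horner (P : {poly K}) : (forall s, P.[s] = 0) -> P = 0.
Proof.
move=> H; apply: (@roots_geq_poly_eq0 _ P [seq i%:R | i <- iota 0 (size P)]).
- by apply/allP => s _; rewrite /root H.
- rewrite map_inj_uniq ?iota_uniq // => i j /eqP.
  by rewrite eqr_nat => /eqP.
- by rewrite size_map size_iota.
Qed.

Lemma deriv_eq0_const (P : {poly K}) s t : (forall s, P^`().[s] = 0) -> P.[s] = P.[t].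
Proof.
move=> /poly_eq0_horner H.
have -> : P = (P`_0)%:P; last by rewrite !hornerC.
apply/polyP => -[|i]; rewrite coefC //=.
have := congr1 (fun Q : {poly K} => Q`_i) H; rewrite coef_deriv coef0 => /eqP.
by rewrite -mulr_natr mulf_eq0 pnatr_eq0 orbF => /eqP.
Qed.

Lemma poly1_coef N (be : nat -> K) : (forall x, \sum_(i < N) be i * x ^+ i = 0) ->
  forall i, (i < N)%N -> be i = 0.
Proof.
move=> H i lt; have H0 : \poly_(i < N) be i = 0.
  by apply: poly_eq0_horner => s; rewrite horner_poly H.
by have := congr1 (fun Q : {poly K} => Q`_i) H0; rewrite coef_poly lt coef0.
Qed.

Lemma poly3_coef N (be : nat -> nat -> nat -> K) :
  (forall x y z, \sum_(a < N) \sum_(b < N) \sum_(c < N)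
     be a b c * (x ^+ a * y ^+ b * z ^+ c) = 0) ->
  forall a b c, (a < N)%N -> (b < N)%N -> (c < N)%N -> be a b c = 0.
Proof.
move=> H a b c la lb lc.
have H1 y z : \sum_(b < N) \sum_(c < N) be a b c * (y ^+ b * z ^+ c) = 0.
  apply: (poly1_coef (N := N) (be := fun a => \sum_(b < N) \sum_(c < N)
    be a b c * (y ^+ b * z ^+ c))) => // x.
  rewrite -[RHS](H x y z); apply: eq_bigr => i _; rewrite mulr_suml.
  by apply: eq_bigr => j _; rewrite mulr_suml; apply: eq_bigr => l _; ring.
have H2 z : \sum_(c < N) be a b c * z ^+ c = 0.
  apply: (poly1_coef (N := N) (be := fun b => \sum_(c < N) be a b c * z ^+ c)) => // y.
  rewrite -[RHS](H1 y z); apply: eq_bigr => j _; rewrite mulr_suml.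
  by apply: eq_bigr => l _; ring.
exact: (poly1_coef (be := be a b)).
Qed.

Lemma sum_delta n (a : nat) (V : lmodType K) (G : nat -> V) : (a <= n)%N ->
  \sum_(i < n.+1) (i == a :> nat)%:R *: G i = G a.
Proof.
move=> le; rewrite (bigD1 (Ordinal (le : a < n.+1)%N)) //= eqxx scale1r big1 ?addr0 // => i ne.
by case: eqP => [ea|]; rewrite ?scale0r //; case/eqP: ne; apply: val_inj.
Qed.

(** The solutions of [2 b + 3 c = 2 M + 3 ep] are [b = M - 3 t] and [c = ep
    + 2 t]. *)
Lemma reindex_uv (V : zmodType) M ep n (G : nat -> nat -> V) : (ep <= 1)%N ->
  n = (2 * M + 3 * ep)%N -> (forall b c, (2 * b + 3 * c)%N != n -> G b c = 0) ->
  \sum_(b < n.+1) \sum_(c < n.+1) G b c = \sum_(t < (M %/ 3).+1) G (M - 3 * t)%N (ep + 2 * t)%N.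
Proof.
move=> ep1 nE H0; rewrite pair_bigA /=.
rewrite (bigID (fun p : 'I_n.+1 * 'I_n.+1 => (2 * p.1 + 3 * p.2)%N == n)) /=.
rewrite [X in _ + X]big1 ?addr0 => [|p /H0 //].
pose h (t : 'I_(M %/ 3).+1) : 'I_n.+1 * 'I_n.+1 :=
  (inord (M - 3 * t), inord (ep + 2 * t)).
pose h' (p : 'I_n.+1 * 'I_n.+1) : 'I_(M %/ 3).+1 := inord (p.2 %/ 2).
have t3 (t : 'I_(M %/ 3).+1) : (3 * t <= M)%N.
  by have := ltn_ord t; lia.
rewrite (reindex_onto h h') /=; last first.
  move=> [b c] /= /eqP E; rewrite /h /h' /= inordK; last by lia.
  by congr pair; apply: val_inj; rewrite /= inordK; lia.
rewrite (eq_bigl xpredT) => [|t]; last first.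
  have := t3 t => lt; rewrite !inordK; try lia.
  apply/andP; split; first by apply/eqP; lia.
  by apply/eqP; apply: val_inj; rewrite /= !inordK; lia.
by apply: eq_bigr => t _; have := t3 t => lt; rewrite !inordK //; lia.
Qed.

(** The exponent of [s] in the second part of the term [t + 1] is the one in
    the first part of the term [t], so the coefficient of [s^(ep + 2 t)]
    involves just two consecutive unknowns. *)
Lemma uv_recurrence M ep (b : nat -> K) :
  (forall s : K, \sum_(t < (M %/ 3).+1) b t *
     (((M - 3 * t) * (M - 3 * t).-1)%:R * s ^+ (ep + 2 * t)
      - 3 * ((ep + 2 * t) * (ep + 2 * t).-1)%:R * s ^+ (ep + 2 * t).-2) = 0) ->
  (ep <= 1)%N ->
  forall t, (t < M %/ 3)%N ->
    3 * ((ep + 2 * t.+1) * (ep + 2 * t.+1).-1)%:R * b t.+1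
    = ((M - 3 * t) * (M - 3 * t).-1)%:R * b t.
Proof.
move=> H ep1 t lt; set d := (M %/ 3)%N in H lt.
pose c t := ((M - 3 * t) * (M - 3 * t).-1)%:R : K.
pose c' t := 3 * ((ep + 2 * t) * (ep + 2 * t).-1)%:R : K.
pose P : {poly K} := \sum_(t < d) (c t * b t - c' t.+1 * b t.+1) *: 'X^(ep + 2 * t)
  + (c d * b d) *: 'X^(ep + 2 * d).
have P0 : P = 0.
  apply: poly_eq0_horner => s; rewrite -[RHS](H s) /P hornerD horner_sum hornerZ hornerXn.
  rewrite [in RHS](eq_bigr (fun t : 'I_d.+1 => c t * b t * s ^+ (ep + 2 * t)
    - c' t * b t * s ^+ (ep + 2 * t).-2)); last by move=> i _; rewrite /c /c'; ring.
  rewrite sumrB big_ord_recr /= [X in _ = _ - X]big_ord_recl /=.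
  (* The second part of the term t = 0 carries the coefficient ep (ep - 1),
     which is zero although the exponent ep - 2 is truncated. *)
  have -> : c' 0%N = 0.
    by rewrite /c' muln0 addn0; case: (ep) ep1 => [|[|]] //; rewrite ?muln0 ?mul0n mulr0.
  rewrite !mul0r add0r addrAC -sumrB; congr (_ + _).
  apply: eq_bigr => i _; rewrite hornerZ hornerXn mulrBl; congr (_ - _).
  by congr (_ * _ ^+ _); rewrite /bump /=; lia.
have := congr1 (fun Q : {poly K} => Q`_(ep + 2 * t)) P0.
rewrite coef0 coefD poly.coefZ coefXn coef_sum (bigD1 (Ordinal lt)) //= poly.coefZ coefXn eqxx
  mulr1.
rewrite big1 ?addr0 => [|i ne]; last first.
  rewrite poly.coefZ coefXn; case: eqP => [E|]; last by rewrite mulr0.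
  by case/eqP: ne; apply: val_inj => /=; lia.
case: eqP => [|_]; first by lia.
by rewrite mulr0 addr0 => /eqP; rewrite subr_eq0 => /eqP <-.
Qed.

Lemma bin2_mul2 (n : nat) : (2 * 'C(n, 2))%N = (n * n.-1)%N.
Proof. by rewrite mulnC -[2%N]/(2`!) bin_ffact ffactnS ffactn1. Qed.

(** The recurrence telescopes: [N (N - 1)] is twice the binomial
    coefficient, and the factors [(ep + 2 t + 2) (ep + 2 t + 1)] multiply up
    to the factorial of [ep + 2 j] because [ep] is 0 or 1. *)
Lemma uv_closed M ep (b : nat -> K) d :
  (forall t, (t < d)%N ->
    3 * ((ep + 2 * t.+1) * (ep + 2 * t.+1).-1)%:R * b t.+1
    = ((M - 3 * t) * (M - 3 * t).-1)%:R * b t) ->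
  (ep <= 1)%N ->
  forall j, (j <= d)%N -> b j = (2 ^+ j * \prod_(l < j) 'C(M - 3 * l, 2)%N%:R)
                / (3 ^+ j * (ep + 2 * j)`!%N%:R) * b 0%N.
Proof.
move=> H ep1; elim=> [|j IH] jd.
  rewrite big_ord0 !expr0 !mul1r muln0 addn0.
  by case: (ep) ep1 => [|[|]] //; rewrite invr1 mul1r.
have := H j jd; rewrite IH; last exact: ltnW.
rewrite -(bin2_mul2 (M - 3 * j)) big_ord_recr /=.
have -> : (ep + 2 * j.+1 = (ep + 2 * j).+2)%N by lia.
rewrite /= !factS !natrM !exprS.
set f1 := (ep + 2 * j)`!%:R; set x := (ep + 2 * j).+2%:R; set y := (ep + 2 * j).+1%:R.
have f1n : f1 != 0 by rewrite /f1 pnatr_eq0 -lt0n fact_gt0.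
have xn : x != 0 by rewrite /x pnatr_eq0.
have yn : y != 0 by rewrite /y pnatr_eq0.
clearbody f1 x y.
have n3 : (3 : K) != 0 by rewrite pnatr_eq0.
have n3j : (3 : K) ^+ j != 0 by rewrite expf_neq0.
move: (\prod_(i < j) _) (b 0%N) (b j.+1) (3 ^+ j) (2 ^+ j) n3j => pr b0 bj t3 t2 n3j E.
apply: (mulfI (mulf_neq0 n3 (mulf_neq0 xn yn))); rewrite E; field.
by rewrite f1n yn xn n3j.
Qed.

End Sums.

Lemma dnumE n M ep : (ep <= 1)%N -> n = (2 * M + 3 * ep)%N -> dnum n = (M %/ 3).+1.
Proof.
move=> ep1 ->; rewrite /dnum.
have -> : odd (2 * M + 3 * ep) = odd ep by rewrite oddD !oddM /=.
by case: ep ep1 => [|[|]] //= _; lia.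
Qed.

(** * A functional on an enveloping algebra from two characters *)

Section Whittaker.
Variables (K : fieldType) (L : lieAlgType K).
Implicit Types (x y z : L) (s t : seq L) (phi psi : seq L -> K).

(** The transpose of the derivation of the tensor algebra that extends the
    bracket with [x]. *)
Fixpoint wderiv phi x s : K :=
  if s is y :: s' then phi ([lie x, y] :: s') + wderiv (fun t => phi (y :: t)) x s'
  else 0.

Lemma eq_wderiv phi psi x s :
  (forall t, size t = size s -> phi t = psi t) -> wderiv phi x s = wderiv psi x s.
Proof.
elim: s phi psi => //= y s IH phi psi e; rewrite e //; congr (_ + _).
by apply: IH => t st; apply: e; rewrite /= st.
Qed.

Lemma wderiv_lin a phi psi x s :
  wderiv (fun t => a * phi t + psi t) x s = a * wderiv phi x s + wderiv psi x s.
Proof.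
elim: s phi psi => [|y s IH] phi psi /=; first by rewrite mulr0 addr0.
by rewrite IH mulrDr addrACA.
Qed.

Lemma wderivZ a phi x s :
  wderiv (fun t => a * phi t) x s = a * wderiv phi x s.
Proof.
by elim: s phi => [|y s IH] phi /=; rewrite ?mulr0 // IH mulrDr.
Qed.

Lemma wderivD phi psi x s :
  wderiv (fun t => phi t + psi t) x s = wderiv phi x s + wderiv psi x s.
Proof.
elim: s phi psi => [|y s IH] phi psi /=; first by rewrite addr0.
by rewrite IH addrACA.
Qed.

Lemma wderiv_cat phi x s t :
  wderiv phi x (s ++ t) =
  wderiv (fun s' => phi (s' ++ t)) x s + wderiv (fun t' => phi (s ++ t')) x t.
Proof.
elim: s phi => [|y s IH] phi /=; first by rewrite add0r.
by rewrite IH addrA.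
Qed.

Definition multilin n phi := forall s t a x y, (size s + size t < n)%N ->
  phi (s ++ (a *: x + y) :: t) = a * phi (s ++ x :: t) + phi (s ++ y :: t).
Definition exchange n phi := forall s t x y, ((size s + size t).+1 < n)%N ->
  phi (s ++ x :: y :: t) = phi (s ++ y :: x :: t) + phi (s ++ [lie x, y] :: t).
(** On words of length at most [n], the functional [phi] is compatible with
    the relations of the enveloping algebra. The bound on the length is what
    the construction of [wfun] is inductive in. *)
Definition lieword n phi := multilin n phi /\ exchange n phi.

Lemma multilin_cons n phi y : multilin n.+1 phi -> multilin n (fun t => phi (y :: t)).
Proof. by move=> H s t a x z lt; apply: (H (y :: s)). Qed.
Lemma lieword_cons n phi y : lieword n.+1 phi -> lieword n (fun t => phi (y :: t)).
Proof.
case=> H1 H2; split; first exact: multilin_cons.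
by move=> s t x z lt; apply: (H2 (y :: s)).
Qed.

Lemma wderiv_linx n phi a x y s : multilin n phi -> (size s <= n)%N ->
  wderiv phi (a *: x + y) s = a * wderiv phi x s + wderiv phi y s.
Proof.
elim: s n phi => [|z s IH] n phi H /=; first by rewrite mulr0 addr0.
case: n H => // n H le; rewrite lieDl (H [::]) //= (IH n); first last.
- exact: le.
- exact: multilin_cons.
by rewrite mulrDr addrACA.
Qed.

Lemma lieword_wderiv n phi x : lieword n phi -> lieword n (wderiv phi x).
Proof.
case=> H1 H2; split=> [s t a y z lt|s t y z lt].
  rewrite !wderiv_cat /=.
  rewrite (@eq_wderiv _ (fun s' => a * phi (s' ++ y :: t) + phi (s' ++ z :: t)) x s);
    last by move=> s' e; rewrite H1 ?e.
  rewrite wderiv_lin (lieDr a x y z) H1 //.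
  rewrite (@eq_wderiv _ (fun t' => a * phi (s ++ y :: t') + phi (s ++ z :: t')) x t);
    last by move=> s' e; rewrite H1 ?e.
  by rewrite wderiv_lin; ring.
rewrite !wderiv_cat /=.
rewrite (@eq_wderiv _ (fun s' => phi (s' ++ z :: y :: t) + phi (s' ++ [lie y, z] :: t)) x s);
    last by move=> s' e; rewrite H2 ?e.
rewrite (@eq_wderiv (fun t' => phi (s ++ y :: z :: t'))
  (fun t' => phi (s ++ z :: y :: t') + phi (s ++ [lie y, z] :: t')) x t);
    last by move=> s' e; rewrite H2 ?e.
rewrite !wderivD (H2 s t [lie x, y]) // (H2 s t y [lie x, z]) //.
have -> : [lie x, [lie y, z]] = 1 *: [lie [lie x, y], z] + [lie y, [lie x, z]].
  by rewrite scale1r lie_derl.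
rewrite (H1 s t) ; last by apply: leq_trans lt; rewrite ltnS.
by ring.
Qed.

Lemma wderiv_comm n phi x y s : lieword n phi -> (size s <= n)%N ->
  wderiv (wderiv phi x) y s = wderiv (wderiv phi y) x s + wderiv phi [lie x, y] s.
Proof.
elim: s n phi => [|z s IH] n phi H /=; first by rewrite addr0.
case: n H => // n H le.
rewrite !wderivD (IH n) //; last exact: lieword_cons.
have -> : [lie x, [lie y, z]] = 1 *: [lie [lie x, y], z] + [lie y, [lie x, z]].
  by rewrite scale1r lie_derl.
rewrite (H.1 [::]) //=; by ring.
Qed.

Variables (pr : L -> L) (xi : L -> K).
Hypothesis pr_lin : forall a x y, pr (a *: x + y) = a *: pr x + pr y.
Hypothesis pr_sub : forall x y, pr [lie pr x, pr y] = [lie pr x, pr y].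
Hypothesis pr_ker : forall x y, pr [lie x - pr x, y - pr y] = 0.
Hypothesis xi_lin : forall a x y, xi (a *: x + y) = a * xi x + xi y.
Hypothesis xi_pr : forall x y, xi [lie pr x, pr y] = 0.
Hypothesis xi_ker : forall x y, xi [lie x - pr x, y - pr y] = 0.

Let prD x y : pr (x + y) = pr x + pr y.
Proof. by have := pr_lin 1 x y; rewrite !scale1r. Qed.
Let prN x : pr (- x) = - pr x.
Proof.
have pr0 : pr 0 = 0 by apply: (addIr (pr 0)); rewrite -prD !add0r.
by have := pr_lin (-1) x 0; rewrite pr0 !addr0 !scaleN1r.
Qed.
Let xiD x y : xi (x + y) = xi x + xi y.
Proof. by have := xi_lin 1 x y; rewrite !scale1r mul1r. Qed.
Let xiN x : xi (- x) = - xi x.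
Proof.
have pr0 : xi 0 = 0 by apply: (addIr (xi 0)); rewrite -xiD !add0r.
by have := xi_lin (-1) x 0; rewrite pr0 !addr0 scaleN1r mulN1r.
Qed.

(** Here [pr] is the projection onto a subalgebra [p] along a complementary
    subalgebra [m], and [xi] is a linear form that is a character on both.
    The first letter [z] of a word is split accordingly: its component in
    [m] comes out on the left as the scalar given by [xi]; its component [pr
    z] in [p] is commuted to the right end of the word, where it comes out
    in the same way. *)
Fixpoint wfun_rec n s : K :=
  if n is n'.+1 then
    if s is z :: s' then xi z * wfun_rec n' s' + wderiv (wfun_rec n') (pr z) s'
    else 1
  else 1.
Definition wfun s := wfun_rec (size s) s.

Lemma wfun_cons z s : wfun (z :: s) = xi z * wfun s + wderiv wfun (pr z) s.
Proof.
rewrite /wfun /=; congr (_ + _); apply: eq_wderiv => t e.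
by rewrite /wfun e.
Qed.

(** Behind the first letter the exchange rule is inherited from shorter
    words. For the first two letters, split [[x, y]] along [m] and [p]: both
    [xi] and [pr] vanish on the bracket of the [m]-components, [xi] vanishes
    on the bracket of the [p]-components, and the rest is what the
    derivations produce, by [wderiv_comm]. *)
Lemma wfun_lieword n : lieword n wfun.
Proof.
elim: n => [|n IH]; first by split.
split=> [[|c s] t a x y lt|[|c s] t x y lt]; last first.
- rewrite !cat_cons !wfun_cons.
  have [_ H] := lieword_wderiv (pr c) IH.
  by rewrite H // (IH.2 s t) // mulrDr addrACA.
- rewrite (wfun_cons x (y :: t)) (wfun_cons y (x :: t)) /=.
  have E c d : wderiv (fun t => wfun (d :: t)) c t =
      xi d * wderiv wfun c t + wderiv (wderiv wfun (pr d)) c t.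
    by rewrite -wderivZ -wderivD; apply: eq_wderiv => u _; apply: wfun_cons.
  rewrite !E (@wderiv_comm n _ (pr y)) //; last by apply: ltnW.
  rewrite !wfun_cons (lieC (pr y) x) (lieC (pr y) (pr x)).
  have e : [lie x, y] = [lie x - pr x, y - pr y] + [lie pr x, y] + [lie x, pr y]
      - [lie pr x, pr y].
    rewrite lieDlE !lieDrE !lieNl !lieNr opprK.
    have Z (a b c d : L) : a = a - b + (- c + d) + c + b - d.
      by rewrite [- c + d]addrC addrA subrK [_ + b]addrAC subrK addrK.
    exact: Z.
  rewrite e !(xiD, xiN, prD, prN) pr_ker xi_ker xi_pr pr_sub.
  have W : forall a u v, wderiv wfun (a *: u + v) t = a * wderiv wfun u t + wderiv wfun v t.
    by move=> a u v; apply: (wderiv_linx (n := n)); [exact: IH.1 | exact: ltnW].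
  have WD : forall u v, wderiv wfun (u + v) t = wderiv wfun u t + wderiv wfun v t.
    by move=> u v; have := W 1 u v; rewrite scale1r mul1r.
  have W0 : wderiv wfun 0 t = 0.
    by apply: (addIr (wderiv wfun 0 t)); rewrite -WD !add0r.
  have WN : forall u, wderiv wfun (- u) t = - wderiv wfun u t.
    by move=> u; have := W (-1) u 0; rewrite W0 !addr0 scaleN1r mulN1r.
  rewrite !(WD, WN, W0); by ring.
- rewrite !cat_cons !wfun_cons.
  have [H _] := lieword_wderiv (pr c) IH.
  by rewrite H // (IH.1 s t) //; ring.
- rewrite !cat0s !wfun_cons xi_lin pr_lin (wderiv_linx (n := n) _ _ _ IH.1) //.
  by ring.
Qed.

Lemma wfun_left y s : pr y = 0 -> wfun (y :: s) = xi y * wfun s.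
Proof.
move=> e; rewrite wfun_cons e.
have := @wderiv_linx (size s) wfun 1 0 0 s (wfun_lieword (size s)).1 (leqnn _).
rewrite scaler0 addr0 mul1r => /eqP.
by rewrite -subr_eq subrr eq_sym => /eqP ->; rewrite addr0.
Qed.

Lemma wfun_right p s : pr p = p -> wfun (s ++ [:: p]) = xi p * wfun s.
Proof.
move: {2}(size s) (leqnn (size s)) => n.
elim: n s p => [|n IH] [|z s] p //= le pp.
- by rewrite wfun_cons /= addr0.
- by rewrite wfun_cons /= addr0.
rewrite !wfun_cons IH // wderiv_cat /=.
rewrite (@eq_wderiv _ (fun s' => xi p * wfun s')); last first.
  by move=> t e; rewrite IH // e.
rewrite wderivZ IH //; last by rewrite -pp pr_sub.
by rewrite -pp xi_pr pp mul0r addr0 addr0; ring.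
Qed.

Local Notation U := (envel L).

(** The functional [t |-> phi (s t)], for [s] a formal expression and [t] a
    word. *)
Fixpoint wact (s : uterm L) phi : seq L -> K :=
  match s with
  | UGen x => fun t => phi (x :: t)
  | UConst a => fun t => a * phi t
  | UAdd s1 s2 => fun t => wact s1 phi t + wact s2 phi t
  | UMul s1 s2 => wact s2 (wact s1 phi)
  end.

Definition liewords phi := forall n, lieword n phi.

Lemma liewords_wact (s : uterm L) phi : liewords phi -> liewords (wact s phi).
Proof.
elim: s phi => [x|a|s1 IH1 s2 IH2|s1 IH1 s2 IH2] phi H n /=.
- exact: lieword_cons.
- have [H1 H2] := H n; split=> [s t b x y lt|s t x y lt].
    by rewrite H1 //; ring.
  by rewrite H2 // mulrDr.
- have [H1 H2] := IH1 _ H n; have [H3 H4] := IH2 _ H n.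
  split=> [s t b x y lt|s t x y lt].
    by rewrite H1 // H3 //; ring.
  by rewrite H2 // H4 // addrACA.
- by apply: IH2; apply: IH1.
Qed.

Lemma wactD (s : uterm L) phi psi : wact s (fun t => phi t + psi t) =
  (fun t => wact s phi t + wact s psi t).
Proof.
elim: s phi psi => //= [a|s1 IH1 s2 IH2|s1 IH1 s2 IH2] phi psi.
- by apply: funext => t; rewrite mulrDr.
- by apply: funext => t; rewrite IH1 IH2 addrACA.
- by rewrite IH1 IH2.
Qed.
Lemma wactZ (s : uterm L) a phi : wact s (fun t => a * phi t) = (fun t => a * wact s phi t).
Proof.
elim: s phi => //= [b|s1 IH1 s2 IH2|s1 IH1 s2 IH2] phi.
- by apply: funext => t; ring.
- by apply: funext => t; rewrite IH1 IH2 mulrDr.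
- by rewrite IH1 IH2.
Qed.

(** It suffices to check the defining relations of the enveloping algebra;
    apart from linearity and the bracket relation they are identities
    between functions. *)
Lemma wact_ueq (s t : uterm L) : ueq s t -> forall phi, liewords phi -> wact s phi = wact t phi.
Proof.
elim=> {s t} //=.
- by move=> s t _ e phi H; rewrite e.
- by move=> s t u _ e1 _ e2 phi H; rewrite e1 ?e2.
- by move=> s s' t t' _ e1 _ e2 phi H; rewrite e1 ?e2.
- by move=> s s' t t' _ e1 _ e2 phi H; rewrite e1 ?e2 //; apply: liewords_wact.
- by move=> *; apply: funext => ?; rewrite addrA.
- by move=> *; apply: funext => ?; rewrite addrC.
- by move=> *; apply: funext => ?; rewrite mul0r add0r.
- by move=> s phi H; apply: funext => ?; rewrite wactZ mul0r mulN1r addNr.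
- by move=> s phi H; rewrite wactZ; apply: funext => ?; rewrite mul1r.
- by move=> s t u phi H; rewrite wactD.
- by move=> *; apply: funext => ?; rewrite mulrDl.
- by move=> *; apply: funext => ?; ring.
- by move=> a s phi H; rewrite wactZ.
- move=> x y phi H; apply: funext => t.
  by have := (H (size t).+1).1 [::] t 1 x y (ltnSn _); rewrite scale1r mul1r.
- move=> a x phi H; apply: funext => t.
  have HL := (H (size t).+1).1 [::] t.
  have H0 : phi (0 :: t) = 0.
    apply: (addIr (phi (0 :: t))).
    by have /= := HL 1 0 0 (ltnSn _); rewrite scaler0 add0r mul1r => <-; rewrite add0r.
  by have /= := HL a x 0 (ltnSn _); rewrite H0 !addr0.
- move=> x y phi H; apply: funext => t.
  have /= -> := (H (size t).+2).2 [::] t x y (ltnSn _).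
  by rewrite mulN1r addrAC subrr add0r.
Qed.

(** A form of Whittaker functional: it is normalized, and it turns left
    multiplication by the kernel of [pr] and right multiplication by its
    image into scalars (lemmas [whitl] and [whitr]). *)
Definition whit (p : U) : K := wact (repr p) wfun [::].

Let lw : liewords wfun. Proof. by move=> n; apply: wfun_lieword. Qed.

Lemma whit_ucls (s : uterm L) : whit (ucls s) = wact s wfun [::].
Proof. by rewrite /whit; congr (_ _); apply: wact_ueq => //; apply: repr_ucls. Qed.

Lemma whitD p q : whit (p + q) = whit p + whit q.
Proof. by rewrite [p + q]/(uadd p q) /uadd whit_ucls. Qed.
Lemma whitZ a p : whit (a *: p) = a * whit p.
Proof.
rewrite [a *: p]/(uscale a p) /uscale /umul whit_ucls /=.
by rewrite (wact_ueq (repr_ucls _) lw) /= wactZ.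
Qed.
Lemma whit1 : whit 1 = 1.
Proof. by rewrite [1]/(ucls (UConst L 1)) whit_ucls /= mul1r. Qed.
Lemma whitl y p : pr y = 0 -> whit (uin y * p) = xi y * whit p.
Proof.
move=> e; rewrite [uin y * p]/(umul _ _) /umul whit_ucls /=.
rewrite (wact_ueq (repr_ucls _) lw) /=.
rewrite (_ : (fun t => wfun (y :: t)) = fun t => xi y * wfun t) ?wactZ //.
by apply: funext => t; rewrite wfun_left.
Qed.
Lemma whitr p q : pr q = q -> whit (p * uin q) = xi q * whit p.
Proof.
move=> e; rewrite [p * uin q]/(umul _ _) /umul whit_ucls /=.
rewrite (wact_ueq (repr_ucls _) _) /=; last exact: liewords_wact.
suff H phi : (forall t, phi (t ++ [:: q]) = xi q * phi t) ->
    forall t, wact (repr p) phi (t ++ [:: q]) = xi q * wact (repr p) phi t.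
  by apply: (H _ _ [::]) => t; apply: wfun_right.
elim: (repr p) phi => //= [x|a|s1 IH1 s2 IH2|s1 IH1 s2 IH2] phi H t.
- by rewrite -cat_cons H.
- by rewrite H; ring.
- by rewrite IH1 // IH2 // mulrDr.
- by apply: IH2 => u; apply: IH1.
Qed.

End Whittaker.

(** * Functionals on the vacuum module *)

Section AffineFun.
Variables (K : fieldType) (L : lieAlgType K) (B : invForm L).
Local Notation U := (envel (affine B)).
Local Notation "x @ r" := (loop B x r) (at level 30).
Implicit Types (x y : L) (r s : int) (f g : laurent L).

Lemma uin0 : uin (0 : affine B) = 0.
Proof. by have := uin_lin (-1) (0 : affine B) 0; rewrite scaler0 add0r scaleN1r addNr. Qed.
Lemma uinD (p q : affine B) : uin (p + q) = uin p + uin q.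
Proof. by have := uin_lin 1 p q; rewrite !scale1r. Qed.

Lemma loop_lin a x y r : (a *: x + y) @ r = a *: (x @ r) + y @ r.
Proof.
rewrite /loop -uin_lin; congr uin.
rewrite [RHS]/GRing.add /= /add_pair /= [a *: 0]scaler0 addr0.
by rewrite mono_lin.
Qed.
Lemma loopD x y r : (x + y) @ r = x @ r + y @ r.
Proof. by have := loop_lin 1 x y r; rewrite !scale1r. Qed.
Lemma loop0 r : (0 : L) @ r = 0.
Proof. by apply: (addIr ((0 : L) @ r)); rewrite -loopD !add0r. Qed.
Lemma loopZ a x r : (a *: x) @ r = a *: (x @ r).
Proof. by have := loop_lin a x 0 r; rewrite loop0 !addr0. Qed.
Lemma loopN x r : (- x) @ r = - (x @ r).
Proof. by rewrite -scaleN1r loopZ scaleN1r. Qed.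

Definition cent (c : K) : U := uin ((0, c) : affine B).

Lemma cent0 : cent 0 = 0.
Proof. exact: uin0. Qed.

Lemma loop_comm x r y s : x @ r * y @ s =
  y @ s * x @ r + [lie x, y] @ (r + s) + cent (if r + s == 0 then r%:~R * B x y else 0).
Proof.
rewrite /loop /cent -addrA -uinD.
have -> : (mono [lie x, y] (r + s), 0) + (0, if r + s == 0 then r%:~R * B x y else 0)
    = [lie (mono x r, 0) : affine B, (mono y s, 0) : affine B] :> affine B.
  transitivity (affine_lie ((mono x r, 0) : affine B) ((mono y s, 0) : affine B)) => //.
  rewrite /affine_lie /= loop_lie_mono cocycle_mono.
  by rewrite [LHS]/GRing.add /= /add_pair /= addr0 add0r.
by rewrite uin_lie addrC subrK.
Qed.

Lemma loop_comm0 x y s : x @ 0 * y @ s = y @ s * x @ 0 + [lie x, y] @ s.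
Proof. by rewrite loop_comm add0r mul0r if_same cent0 addr0. Qed.

Lemma loop_commn x r y s : r + s != 0 ->
  x @ r * y @ s = y @ s * x @ r + [lie x, y] @ (r + s).
Proof. by move=> ne; rewrite loop_comm (negPf ne) cent0 addr0. Qed.

Lemma cent_comm c p : cent c * p = p * cent c.
Proof.
have gen (z : affine B) : cent c * uin z = uin z * cent c.
  apply/eqP; rewrite -subr_eq0 /cent -uin_lie.
  rewrite -uin0; apply/eqP; congr uin.
  transitivity (affine_lie ((0, c) : affine B) z) => //.
  by rewrite /affine_lie /loop_lie /cocycle /lext /= msupp0 !big_seq_fset0.
elim/ucls_ind: p => s; elim: s => [z|a|s IHs t IHt|s IHs t IHt].
- exact: gen.
- exact: esym (umulC _ _).
- rewrite -uaddE [uadd _ _]/(ucls s + ucls t : U).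
  by rewrite mulrDr mulrDl IHs IHt.
- rewrite -umulE [umul (ucls s) (ucls t)]/(ucls s * ucls t : U).
  by rewrite mulrA IHs -mulrA IHt mulrA.
Qed.

Definition trunc f : laurent L := lext (fun r x => if 0 <= r then mono x r else 0) f.

Lemma trunc_lin a f g : trunc (a *: f + g) = a *: trunc f + trunc g.
Proof.
apply: lext_lin => r b x y; case: ifP => _; first exact: mono_lin.
by rewrite scaler0 addr0.
Qed.

Lemma trunc_coef f r : mcoeff r (trunc f) = if 0 <= r then mcoeff r f else 0.
Proof.
rewrite /trunc /lext raddf_sum /= [in RHS](monalgE f) raddf_sum /=.
case: ifP => r0.
  apply: eq_bigr => s _; rewrite mcoeffU; case: ifP => s0; first by rewrite mcoeffU.
  rewrite mcoeff0; case: eqP => [e|]; last by rewrite mulr0n.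
  by rewrite e r0 in s0.
rewrite big1 // => s _; case: ifP => s0; rewrite ?mcoeff0 // mcoeffU.
case: eqP => [e|]; last by rewrite mulr0n.
by rewrite e r0 in s0.
Qed.

Lemma mcoeff_loop_lie f g t (P : int -> bool) (Q : int -> bool) :
  (forall r, ~~ P r -> mcoeff r f = 0) -> (forall r, ~~ Q r -> mcoeff r g = 0) ->
  (forall r s, P r -> Q s -> r + s != t) ->
  mcoeff t (loop_lie f g) = 0.
Proof.
move=> Hf Hg H; rewrite /loop_lie /lext raddf_sum big1 //= => r _.
rewrite raddf_sum big1 //= => s _; rewrite mcoeffU.
case Pr: (P r); last by rewrite Hf ?Pr // lie0l mul0rn.
case Qs: (Q s); last by rewrite (Hg s) ?Qs // lie0r mul0rn.
by rewrite (negPf (H r s Pr Qs)).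
Qed.

Lemma cocycle_eq0 f g (P : int -> bool) (Q : int -> bool) :
  (forall r, ~~ P r -> mcoeff r f = 0) -> (forall r, ~~ Q r -> mcoeff r g = 0) ->
  (forall r s, P r -> Q s -> r + s = 0 -> r = 0) ->
  cocycle B f g = 0.
Proof.
move=> Hf Hg H; rewrite /cocycle /lext big1 //= => r _.
rewrite big1 //= => s _; case: eqP => // e.
have B0 x : B 0 x = 0 by have := formDl B (-1) 0 0 x; rewrite scaleN1r addNr mulN1r addNr.
case Pr: (P r); last by rewrite Hf ?Pr // B0 mulr0.
case Qs: (Q s); last by rewrite (Hg s) ?Qs // formC B0 mulr0.
by rewrite (H r s Pr Qs e) mul0r.
Qed.

Variables (k : K) (pi : L -> K).
Hypothesis pi_lin : forall a x y, pi (a *: x + y) = a * pi x + pi y.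

Let pi0 : pi 0 = 0.
Proof. by have := pi_lin (-1) 0 0; rewrite scaleN1r addNr mulN1r addNr. Qed.

(** The projection of the affine algebra onto the nonnegative modes and the
    center, along the negative modes. *)
Definition prge0 (p : affine B) : affine B := (trunc p.1, p.2).
(** The form [X(-1) |-> pi X], [K |-> k], zero on all other modes, is a
    character on both halves: a bracket of negative modes has degree at most
    [-2], and a bracket of nonnegative modes has neither a component of
    degree [-1] nor a central component. Hence [pi] is arbitrary. *)
Definition whitxi (p : affine B) : K := pi (mcoeff (-1) p.1) + k * p.2.

Lemma prge0_lin (a : K) (x y : affine B) : prge0 (a *: x + y) = a *: prge0 x + prge0 y.
Proof. by rewrite /prge0 /= trunc_lin. Qed.

Lemma whitxi_lin a (x y : affine B) : whitxi (a *: x + y) = a * whitxi x + whitxi y.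
Proof.
rewrite /whitxi mcoeffD coefZ pi_lin /= [a *: x.2]/(a * x.2).
rewrite mulrDr (mulrCA k) mulrDr; exact: addrACA.
Qed.

Lemma trunc_id f : (forall r : int, r < 0 -> mcoeff r f = 0) -> trunc f = f.
Proof.
move=> H; apply/malgP => r; rewrite trunc_coef; case: ifP => // /negbT.
by rewrite -ltNge => /H ->.
Qed.

Lemma trunc_lt0 f r : r < 0 -> mcoeff r (trunc f) = 0.
Proof. by rewrite trunc_coef ltNge => /negPf ->. Qed.
Lemma trunc_compl f r : 0 <= r -> mcoeff r (f - trunc f) = 0.
Proof. by move=> r0; rewrite mcoeffB trunc_coef r0 subrr. Qed.

Lemma prge0_sub (x y : affine B) : prge0 [lie prge0 x, prge0 y] = [lie prge0 x, prge0 y].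
Proof.
congr pair; apply: trunc_id => r r0 /=.
apply: (mcoeff_loop_lie (P := fun r => 0 <= r) (Q := fun r => 0 <= r)).
- by move=> s; rewrite -ltNge => /trunc_lt0 ->.
- by move=> s; rewrite -ltNge => /trunc_lt0 ->.
- by move=> s t; lia.
Qed.

Lemma prge0_ker (x y : affine B) : prge0 [lie x - prge0 x, y - prge0 y] = 0.
Proof.
congr pair => /=.
  apply/malgP => r; rewrite mcoeff0 trunc_coef; case: ifP => // r0.
  apply: (mcoeff_loop_lie (P := fun r => r < 0) (Q := fun r => r < 0)).
  - by move=> s; rewrite -leNgt => /trunc_compl ->.
  - by move=> s; rewrite -leNgt => /trunc_compl ->.
  - by move=> s t; lia.
apply: (cocycle_eq0 (P := fun r => r < 0) (Q := fun r => r < 0)).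
- by move=> s; rewrite -leNgt => /trunc_compl ->.
- by move=> s; rewrite -leNgt => /trunc_compl ->.
- by move=> s t; lia.
Qed.

Lemma whitxi_pr (x y : affine B) : whitxi [lie prge0 x, prge0 y] = 0.
Proof.
rewrite /whitxi /= (mcoeff_loop_lie (P := fun r => 0 <= r) (Q := fun r => 0 <= r)).
- rewrite pi0 add0r (cocycle_eq0 (P := fun r => 0 <= r) (Q := fun r => 0 <= r)).
  + by rewrite mulr0.
  + by move=> s; rewrite -ltNge => /trunc_lt0 ->.
  + by move=> s; rewrite -ltNge => /trunc_lt0 ->.
  + by move=> s t; lia.
- by move=> s; rewrite -ltNge => /trunc_lt0 ->.
- by move=> s; rewrite -ltNge => /trunc_lt0 ->.
- by move=> s t; lia.
Qed.

Lemma whitxi_ker (x y : affine B) : whitxi [lie x - prge0 x, y - prge0 y] = 0.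
Proof.
rewrite /whitxi /= (mcoeff_loop_lie (P := fun r => r < 0) (Q := fun r => r < 0)).
- rewrite pi0 add0r (cocycle_eq0 (P := fun r => r < 0) (Q := fun r => r < 0)).
  + by rewrite mulr0.
  + by move=> s; rewrite -leNgt => /trunc_compl ->.
  + by move=> s; rewrite -leNgt => /trunc_compl ->.
  + by move=> s t; lia.
- by move=> s; rewrite -leNgt => /trunc_compl ->.
- by move=> s; rewrite -leNgt => /trunc_compl ->.
- by move=> s t; lia.
Qed.

Definition vacfun : U -> K := whit prge0 whitxi.

Lemma vacfunD p q : vacfun (p + q) = vacfun p + vacfun q.
Proof. exact: (whitD prge0_lin prge0_sub prge0_ker whitxi_lin whitxi_pr whitxi_ker). Qed.
Lemma vacfunZ a p : vacfun (a *: p) = a * vacfun p.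
Proof. exact: (whitZ prge0_lin prge0_sub prge0_ker whitxi_lin whitxi_pr whitxi_ker). Qed.
Lemma vacfun1 : vacfun 1 = 1.
Proof. exact: (whit1 prge0_lin prge0_sub prge0_ker whitxi_lin whitxi_pr whitxi_ker). Qed.
Lemma vacfunN p : vacfun (- p) = - vacfun p.
Proof. by rewrite -scaleN1r vacfunZ mulN1r. Qed.
Lemma vacfunB p q : vacfun (p - q) = vacfun p - vacfun q.
Proof. by rewrite vacfunD vacfunN. Qed.
Lemma vacfun0 : vacfun 0 = 0.
Proof. by rewrite -(subrr (1 : U)) vacfunB subrr. Qed.

Lemma vacfun_sum (I : Type) (r : seq I) P (F : I -> U) :
  vacfun (\sum_(i <- r | P i) F i) = \sum_(i <- r | P i) vacfun (F i).
Proof. by rewrite (big_morph vacfun vacfunD vacfun0). Qed.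

Lemma vacfun_lt0 (y : affine B) p : affine_lt0 y -> vacfun (uin y * p) = pi (mcoeff (-1) y.1) *
  vacfun p.
Proof.
case=> y2 H; rewrite /vacfun (whitl prge0_lin prge0_sub prge0_ker whitxi_lin whitxi_pr
  whitxi_ker).
  by rewrite /whitxi y2 mulr0 addr0.
rewrite /prge0 y2; congr pair.
by apply/malgP => r; rewrite trunc_coef mcoeff0; case: ifP => // /H.
Qed.

Lemma vacfun_ge0 (q : affine B) p : affine_ge0 q -> vacfun (p * uin q) = k * q.2 * vacfun p.
Proof.
move=> H; rewrite /vacfun (whitr prge0_lin prge0_sub prge0_ker whitxi_lin whitxi_pr whitxi_ker).
  by rewrite /whitxi H // pi0 add0r.
by rewrite /prge0 trunc_id //; case: q H.
Qed.

Lemma affine_lt0_loop y r : r < 0 -> affine_lt0 ((mono y r, 0) : affine B).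
Proof.
move=> r0; split=> // s s0 /=; rewrite mcoeffU.
by case: eqP => // e; move: r0; rewrite e ltNge s0.
Qed.

Lemma vacfun_loop y r p : r < 0 -> vacfun (y @ r * p) = (if r == -1 then pi y else 0) * vacfun p.
Proof.
move=> r0; rewrite vacfun_lt0; last exact: affine_lt0_loop.
by rewrite mcoeffU; case: eqP => e; rewrite ?mulr1n ?mulr0n ?pi0.
Qed.
Lemma vacfun_loop1 y p : vacfun (y @ (-1) * p) = pi y * vacfun p.
Proof. by rewrite vacfun_loop. Qed.
Lemma vacfun_loop2 y r p : r < -1 -> vacfun (y @ r * p) = 0.
Proof. by move=> lt; rewrite vacfun_loop ?lt_eqF ?mul0r //; lia. Qed.

Lemma vacfun_loop_ge0 x r p : 0 <= r -> vacfun (p * x @ r) = 0.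
Proof.
move=> r0; rewrite vacfun_ge0 /= ?mulr0 ?mul0r // => s s0 /=; rewrite mcoeffU.
by case: eqP => // e; move: s0; rewrite -e ltNge r0.
Qed.

Lemma vacfun_cent c p : vacfun (cent c * p) = k * c * vacfun p.
Proof. by rewrite cent_comm vacfun_ge0 //= => s s0; rewrite mcoeff0. Qed.

(** On [U_minus] the functional is the character [X(-1) |-> pi X], [X(-r)
    |-> 0] for [r > 1]. *)
Lemma vacfun_U_minus p q : U_minus B p -> vacfun (p * q) = vacfun p * vacfun q.
Proof.
move=> Hp; move: q; apply: (Hp [set p | forall q, vacfun (p * q) = vacfun p * vacfun q]%classic).
split; first split; last 1 first.
- by move=> p1 [z [z0 zz] <-] q /=; rewrite vacfun_lt0 // -[in RHS](mulr1 (uin z)) vacfun_lt0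
    // vacfun1 mulr1.
- split=> [q|a x y Hx Hy q]; first by rewrite mul0r vacfun0 mul0r.
  by rewrite mulrDl -scalerAl !(vacfunD, vacfunZ) Hx Hy mulrDl mulrA.
- by move=> q; rewrite mul1r vacfun1 mul1r.
- by move=> x y Hx Hy q; rewrite -mulrA !Hx Hy mulrA.
Qed.

Lemma vac_actE p : p *: vac B k = lcls (vacuum_rel B k) p.
Proof. by rewrite [LHS]lscaleE mulr1. Qed.

Lemma lcls0 : lcls (vacuum_rel B k) 0 = 0.
Proof. by rewrite -vac_actE scale0r. Qed.

(** The annihilator of the vacuum is the left ideal generated by the
    differences [p - chi p], where [chi] is the character inducing the
    module; the functional sends every multiple [q (p - chi p)] to zero. *)
Lemma vacfun_vac0 p : p *: vac B k = 0 -> vacfun p = 0.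
Proof.
rewrite vac_actE -lcls0 => /lclsP; rewrite subr0 => H.
rewrite -[p]mul1r.
move: (1 : U); apply: (H [set p | forall q, vacfun (q * p) = 0]%classic); split.
  split=> [q|x y Hx Hy q|a x Hx q] /=.
  - by rewrite mulr0 vacfun0.
  - by rewrite mulrDr vacfunD Hx Hy addr0.
  - by rewrite mulrA Hx.
move=> _ [z z0 <-] q /=.
by rewrite mulrBr vacfunB vacfun_ge0 // -scalerAr mulr1 vacfunZ subrr.
Qed.

Lemma vac_ge0 x r : 0 <= r -> x @ r *: vac B k = 0.
Proof.
move=> r0; rewrite vac_actE -lcls0; apply/lclsP; rewrite subr0 => J [_ H]; apply: H.
exists ((mono x r, 0) : affine B) => /= [s s0|].
  by rewrite mcoeffU; case: eqP => // e; move: s0; rewrite -e ltNge r0.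
by rewrite mulr0 scale0r subr0.
Qed.

End AffineFun.

(** * The subalgebra of negative modes *)

Section UMinus.
Variables (K : fieldType) (L : lieAlgType K) (B : invForm L).
Local Notation U := (envel (affine B)).
Local Notation "x @ r" := (loop B x r) (at level 30).

Lemma U_minus_subalgebra : subalgebra (U_minus B).
Proof.
split; first split.
- by move=> S [[[S0 _] _ _] _].
- move=> a x y Hx Hy S HS; have [[_ Sl] _ _] := HS.1.
  by apply: Sl; [apply: Hx | apply: Hy].
- by move=> S [[_ S1 _] _].
- move=> x y Hx Hy S HS; have [_ _ SM] := HS.1.
  by apply: SM; [apply: Hx | apply: Hy].
Qed.
Lemma U_minusM p q : U_minus B p -> U_minus B q -> U_minus B (p * q).
Proof. by case: U_minus_subalgebra => _ _; apply. Qed.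
Lemma U_minus1 : U_minus B 1.
Proof. by case: U_minus_subalgebra. Qed.
Lemma U_minusX p n : U_minus B p -> U_minus B (p ^+ n).
Proof.
move=> H; elim: n => [|n IH]; first by rewrite expr0; apply: U_minus1.
by rewrite exprS; apply: U_minusM.
Qed.
Lemma U_minusZ a p : U_minus B p -> U_minus B (a *: p).
Proof. by move=> H; case: U_minus_subalgebra => S _ _; apply: (subspaceZ _ S). Qed.
Lemma U_minusD p q : U_minus B p -> U_minus B q -> U_minus B (p + q).
Proof. by move=> H1 H2; case: U_minus_subalgebra => S _ _; apply: (subspaceD S). Qed.
Lemma U_minusB p q : U_minus B p -> U_minus B q -> U_minus B (p - q).
Proof. by move=> H1 H2; case: U_minus_subalgebra => S _ _; apply: (subspaceB S). Qed.
Lemma U_minus0 : U_minus B 0.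
Proof. by case: U_minus_subalgebra => -[]. Qed.
Lemma U_minus_loop x r : r < 0 -> U_minus B (x @ r).
Proof.
move=> r0 S [_ HS]; apply: HS; exists ((mono x r, 0) : affine B) => //.
exact: affine_lt0_loop.
Qed.
Lemma U_minus_sum n (F : 'I_n -> U) : (forall i, U_minus B (F i)) ->
  U_minus B (\sum_(i < n) F i).
Proof.
by move=> H; elim/big_ind: _ => //; [apply: U_minus0 | apply: U_minusD].
Qed.

End UMinus.

(** * Root vectors and brackets in [G_2] *)

Definition g_weights : seq (int * int) :=
  [:: (0, 0); (1, 0); (0, 1); (1, 1); (2, 1); (3, 1); (3, 2);
      (-1, 0); (0, -1); (-1, -1); (-2, -1); (-3, -1); (-3, -2)].

Section G2.
Variables (K : numFieldType) (g : finLieAlgType K) (D : G2_data g).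
Local Notation hh := (cartan D).
Local Notation B := (bform D).
Local Notation U := (envel (affine B)).
Local Notation "x @ r" := (loop B x r) (at level 30).
Implicit Types (w : int * int) (x y : g) (p q : U).
Local Notation E10 := (E D (1, 0)).
Local Notation E01 := (E D (0, 1)).
Local Notation E11 := (E D (1, 1)).
Local Notation E21 := (E D (2, 1)).
Local Notation E31 := (E D (3, 1)).
Local Notation E32 := (E D (3, 2)).
Local Notation F10 := (F D (1, 0)).
Local Notation F01 := (F D (0, 1)).
Local Notation F21 := (F D (2, 1)).
Local Notation F32 := (F D (3, 2)).
Local Notation H10 := (H D (1, 0)).
Local Notation H01 := (H D (0, 1)).

Definition wt w x : Prop := weight_space hh (rootfun D w) x.

Lemma rootfunE w y : rootfun D w y = w.1%:~R * alpha D y + w.2%:~R * beta D y.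
Proof. by []. Qed.

Lemma rootfunD w w' y : rootfun D (w + w') y = rootfun D w y + rootfun D w' y.
Proof. rewrite !rootfunE !rmorphD /=; ring. Qed.
Lemma rootfunN w y : rootfun D (- w) y = - rootfun D w y.
Proof. rewrite !rootfunE !rmorphN /=; ring. Qed.

Lemma rootfun_lin w a x y :
  rootfun D w (a *: x + y) = a * rootfun D w x + rootfun D w y.
Proof. rewrite !rootfunE !linearP /=; ring. Qed.

Lemma rootfun_scalar w : exists f : {scalar g}, forall y, f y = rootfun D w y.
Proof.
have H : linear_for *%R (rootfun D w) by move=> a x y; exact: rootfun_lin.
pose m := GRing.isLinear.Build K g K^o *%R (rootfun D w) H.
pose f : {scalar g} := HB.pack (rootfun D w) m.
by exists f.
Qed.

Lemma rootfun_eq0 w : {in hh, forall y, rootfun D w y = 0} -> w = 0.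
Proof.
move=> H; have [/eqP + /eqP] := G2_free H; rewrite !intr_eq0.
by case: w {H} => i j /= /eqP -> /eqP ->.
Qed.

Lemma wt_lie w w' x x' : wt w x -> wt w' x' -> wt (w + w') [lie x, x'].
Proof.
move=> Hx Hx' z hz; rewrite lie_derl (Hx z hz) (Hx' z hz) lieZl lieZr.
by rewrite rootfunD [in RHS]scalerDl.
Qed.

Lemma wt0_cartan x : wt 0 x -> x \in hh.
Proof.
move=> Hx; have [_ _ H] := G2_cartan D; apply: H => y hy.
by rewrite lieC (Hx y hy) rootfunE /= !mul0r addr0 scale0r oppr0 mem0v.
Qed.

(** A nonzero vector of weight [w] different from 0 makes [w] a root, and
    all the roots are listed in [g_weights]. *)
Lemma wt_nonroot w x : wt w x -> w \notin g_weights -> x = 0.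
Proof.
move=> Hx nw; apply/eqP/negP => /negP x0; move/negP: nw; apply.
have [->//|w0] := eqVneq w 0.
have [f fE] := rootfun_scalar w.
have : is_root hh f.
  split; last first.
    by exists x => // y hy; rewrite (Hx y hy) fE.
  apply: contrapT => Hn; move/eqP: w0; apply; apply: rootfun_eq0 => y hy.
  apply: contrapT => /eqP ne; apply: Hn; exists y => //; by rewrite fE.
move/G2_roots => [w' w'r e].
have {}e : w = w' \/ w = - w'.
  case: e => e; [left|right]; apply/eqP; rewrite -subr_eq0; apply/eqP;
    apply: rootfun_eq0 => y hy; rewrite rootfunD -fE e // !rootfunN ?opprK ?addrN ?addNr //.
move: w'r; rewrite !inE.
by case: e => ->; repeat (case/orP); move=> /eqP ->.
Qed.

Lemma wtE w : w \in posroots -> wt w (E D w).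
Proof. exact: G2_E. Qed.
Lemma wtF w : w \in posroots -> wt (- w) (F D w).
Proof. exact: G2_F. Qed.

Lemma EFE w : w \in posroots -> [lie E D w, F D w] = H D w.
Proof. exact: G2_EF. Qed.

Lemma H_cartan w : w \in posroots -> H D w \in hh.
Proof. by move=> wr; have [t [ht _] [_ ->]] := G2_H D wr; rewrite memvZ. Qed.

Lemma wtH w : w \in posroots -> wt 0 (H D w).
Proof. by move=> wr; rewrite -EFE // -(subrr w); apply: wt_lie; [apply: wtE|apply: wtF]. Qed.

Lemma lieHE w w' x : w \in posroots -> wt w' x ->
  [lie H D w, x] = rootfun D w' (H D w) *: x.
Proof. by move=> wr Hx; apply: (Hx _ (H_cartan wr)). Qed.

Lemma rootfun_H_self w : w \in posroots -> rootfun D w (H D w) = 2.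
Proof.
move=> wr; have [t [ht e] [t0 ->]] := G2_H D wr.
have -> : rootfun D w ((2 / B t t) *: t) = 2 / B t t * rootfun D w t.
  by rewrite !rootfunE !linearZ /=; ring.
by rewrite -e // divfK.
Qed.

(** Twice a root is not a root, so [[E, x] = 0] and [2 x = [H, x] = [E, [F,
    x]]], where [[F, x]] lies in the Cartan subalgebra. *)
Lemma wt_pos_dim1 w x : w \in posroots -> wt w x -> exists a, x = a *: E D w.
Proof.
move=> wr Hx; pose z := [lie F D w, x].
have hz : z \in hh.
  apply: wt0_cartan; rewrite -(addNr w); apply: wt_lie => //; exact: wtF.
have EX : [lie E D w, x] = 0.
  apply: (wt_nonroot (w := w + w)); first by apply: wt_lie => //; exact: wtE.
  by move: wr; rewrite !inE; repeat (case/orP); move=> /eqP ->.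
have e : 2 *: x = - (rootfun D w z) *: E D w.
  rewrite -(rootfun_H_self wr) -(lieHE wr Hx) -EFE // lie_derr EX lie0l add0r.
  by rewrite -/z lieC (wtE wr) // scaleNr.
exists (2^-1 * - rootfun D w z); rewrite -scalerA -e scalerA mulVf ?scale1r //.
by rewrite pnatr_eq0.
Qed.

Lemma wt_neg_dim1 w x : w \in posroots -> wt (- w) x -> exists a, x = a *: F D w.
Proof.
move=> wr Hx; pose z := [lie E D w, x].
have hz : z \in hh.
  apply: wt0_cartan; rewrite -(addrN w); apply: wt_lie => //; exact: wtE.
have EX : [lie F D w, x] = 0.
  apply: (wt_nonroot (w := - w - w)); first by apply: wt_lie => //; exact: wtF.
  by move: wr; rewrite !inE; repeat (case/orP); move=> /eqP ->.
have e : - 2 *: x = - rootfun D w z *: F D w.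
  have -> : - 2 = rootfun D (- w) (H D w) by rewrite rootfunN rootfun_H_self.
  rewrite -(lieHE wr Hx) -EFE // lie_derr EX lie0r addr0.
  by rewrite -/z (wtF wr) // rootfunN.
have e' : 2 *: x = rootfun D w z *: F D w.
  by apply: oppr_inj; rewrite -!scaleNr.
exists (2^-1 * rootfun D w z); rewrite -scalerA -e' scalerA mulVf ?scale1r //.
by rewrite pnatr_eq0.
Qed.

(** The square lengths of the long roots [beta], [3 alpha + beta] and [3
    alpha + 2 beta] are three linear equations for the three entries of the
    Gram matrix of [alpha] and [beta]. *)
Lemma dual_gram : exists ta tb, [/\ dual_elt B hh (rootfun D (1, 0)) ta,
  dual_elt B hh (rootfun D (0, 1)) tb, B ta ta = 2 / 3, B ta tb = -1 & B tb tb = 2].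
Proof.
have [ta Da [Ba _]] := G2_H D (isT : ((1, 0) : int * int) \in posroots).
have [tb Db [Bb _]] := G2_H D (isT : ((0, 1) : int * int) \in posroots).
have lincombB : forall i j : int, forall t, dual_elt B hh (rootfun D (i, j)) t ->
   B t t = i%:~R ^+ 2 * B ta ta + 2 * i%:~R * j%:~R * B ta tb + j%:~R ^+ 2 * B tb tb.
  move=> i j t [ht Ht].
  have A y : y \in hh -> alpha D y = B ta y.
    by move=> hy; rewrite Da.2 // rootfunE /= mul1r mul0r addr0.
  have A' y : y \in hh -> beta D y = B tb y.
    by move=> hy; rewrite Db.2 // rootfunE /= mul1r mul0r add0r.
  rewrite Ht // rootfunE A // A' // ![B _ t]formC /= !Ht ?Da.1 ?Db.1 // !rootfunE /=.
  rewrite !A ?Da.1 ?Db.1 // !A' ?Da.1 ?Db.1 // (formC B tb ta); ring.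
have [t1 D1 e1] := G2_long D (isT : ((0, 1) : int * int) \in long_posroots).
have [t2 D2 e2] := G2_long D (isT : ((3, 1) : int * int) \in long_posroots).
have [t3 D3 e3] := G2_long D (isT : ((3, 2) : int * int) \in long_posroots).
move: (lincombB _ _ _ D1) (lincombB _ _ _ D2) (lincombB _ _ _ D3).
rewrite e1 e2 e3 /= => f1 f2 f3.
have n3 : (3 : K) != 0 by rewrite pnatr_eq0.
have b2 : B tb tb = 2 by rewrite f1; ring.
move: f2 f3; rewrite b2 => f2 f3.
have c1 : B ta tb = -1.
  have : (6 : K) * (B ta tb + 1) = 0.
    transitivity ((3%:~R ^+ 2 * B ta ta + 2 * 3%:~R * 2%:~R * B ta tb + 2%:~R ^+ 2 * 2)
     - (3%:~R ^+ 2 * B ta ta + 2 * 3%:~R * 1%:~R * B ta tb + 1%:~R ^+ 2 * 2)); first by ring.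
    by rewrite -f2 -f3 subrr.
  by move/eqP; rewrite mulf_eq0 pnatr_eq0 /= addr_eq0 => /eqP.
exists ta, tb; split=> //.
move: f2; rewrite c1 => f2.
apply: (mulfI (mulf_neq0 n3 n3)); have -> : 3 * 3 * (2 / 3) = 6 :> K by field.
have -> : 3 * 3 * B ta ta = (3%:~R ^+ 2 * B ta ta + 2 * 3%:~R * 1%:~R * -1 + 1%:~R ^+ 2 * 2) + 4.
  by ring.
by rewrite -f2; ring.
Qed.

Lemma coroot_vals : [/\ alpha D (H D (1, 0)) = 2, beta D (H D (1, 0)) = - 3,
  alpha D (H D (0, 1)) = - 1 & beta D (H D (0, 1)) = 2].
Proof.
have [ta [tb [Da Db Baa Bab Bbb]]] := dual_gram.
have a_ y : y \in hh -> alpha D y = B ta y.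
  by move=> hy; rewrite Da.2 // rootfunE /= mul1r mul0r addr0.
have b_ y : y \in hh -> beta D y = B tb y.
  by move=> hy; rewrite Db.2 // rootfunE /= mul1r mul0r add0r.
have n3 : (3 : K) != 0 by rewrite pnatr_eq0.
have n2 : (2 : K) != 0 by rewrite pnatr_eq0.
have uniq w t t' : dual_elt B hh (rootfun D w) t -> dual_elt B hh (rootfun D w) t' ->
    B t t = B t' t' /\ forall s, s \in hh -> B t s = B t' s.
  case=> ht Ht [ht' Ht']; have E y : y \in hh -> B t y = B t' y.
    by move=> hy; rewrite Ht // Ht'.
  by split=> //; rewrite E // formC E.
have BZ (a : K) x y : B x (a *: y) = a * B x y.
  have := formDr B a x y 0; rewrite addr0.
  have -> : B x 0 = 0 by have := formDr B (-1) x 0 0; rewrite scaleN1r addNr mulN1r addNr.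
  by rewrite addr0.
have [t1 D1 [B1 e1]] := G2_H D (isT : ((1, 0) : int * int) \in posroots).
have [t2 D2 [B2 e2]] := G2_H D (isT : ((0, 1) : int * int) \in posroots).
have [U1 V1] := uniq _ _ _ Da D1; have [U2 V2] := uniq _ _ _ Db D2.
rewrite !a_ ?b_ ?H_cartan // e1 e2 !BZ -U1 -U2 Baa Bbb.
rewrite ![B _ t1]formC ![B _ t2]formC -!V1 ?Da.1 ?Db.1 // -!V2 ?Da.1 ?Db.1 //.
rewrite (formC B tb ta) Baa Bbb Bab.
by split; field; rewrite ?n2 ?n3.
Qed.

Lemma form_wt0 w w' x x' : wt w x -> wt w' x' -> w + w' != 0 -> B x x' = 0.
Proof.
move=> Hx Hx' ne; apply: contrapT => /eqP nz.
case/eqP: ne; apply: rootfun_eq0 => y hy.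
have BZl (a : K) u v : B (a *: u) v = a * B u v.
  have := formDl B a u 0 v; rewrite addr0.
  have -> : B 0 v = 0 by have := formDl B (-1) 0 0 v; rewrite scaleN1r addNr mulN1r addNr.
  by rewrite addr0.
have := form_inv B x y x'; rewrite lieC (Hx y hy) (Hx' y hy) -scaleNr BZl formC.
rewrite (formC B x) BZl (formC B x') => /eqP; rewrite -subr_eq0 -mulrBl mulf_eq0 (negPf nz) orbF.
by rewrite -opprD oppr_eq0 rootfunD => /eqP.
Qed.

(** By invariance the form of [[E, F]] with [y] in the Cartan subalgebra is
    [w y] times the form of [E] and [F], while [[E, F]] is the coroot. *)
Lemma form_EF w t : w \in posroots -> dual_elt B hh (rootfun D w) t ->
  B (E D w) (F D w) = 2 / B t t.
Proof.
move=> wr [ht Ht].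
have BZl (a : K) u v : B (a *: u) v = a * B u v.
  have := formDl B a u 0 v; rewrite addr0.
  have -> : B 0 v = 0 by have := formDl B (-1) 0 0 v; rewrite scaleN1r addNr mulN1r addNr.
  by rewrite addr0.
have H1 y : y \in hh -> B (H D w) y = rootfun D w y * B (E D w) (F D w).
  move=> hy; rewrite -EFE // form_inv lieC (wtF wr) // rootfunN -scaleNr opprK.
  by rewrite formC BZl (formC B (F D w)).
have [t' [ht' Ht'] [B0 e]] := G2_H D wr.
have R : rootfun D w t' != 0 by rewrite -Ht'.
have := H1 t' ht'; rewrite e BZl Ht' // => {}H1.
have -> : B t t = B t' t' by rewrite Ht // -Ht' // formC Ht // -Ht'.
apply: (mulfI R); rewrite -H1 Ht'; by rewrite // mulrC.
Qed.

Let wE10 : wt (1, 0) E10. Proof. exact: wtE. Qed.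
Let wE01 : wt (0, 1) E01. Proof. exact: wtE. Qed.
Let wE11 : wt (1, 1) E11. Proof. exact: wtE. Qed.
Let wE21 : wt (2, 1) E21. Proof. exact: wtE. Qed.
Let wE31 : wt (3, 1) E31. Proof. exact: wtE. Qed.
Let wE32 : wt (3, 2) E32. Proof. exact: wtE. Qed.
Let wF10 : wt (-1, 0) F10.
Proof. by have := @wtF _ (isT : ((1, 0) : int * int) \in posroots). Qed.
Let wF01 : wt (0, -1) F01.
Proof. by have := @wtF _ (isT : ((0, 1) : int * int) \in posroots). Qed.
Let wF21 : wt (-2, -1) F21.
Proof. by have := @wtF _ (isT : ((2, 1) : int * int) \in posroots). Qed.
Let wF32 : wt (-3, -2) F32.
Proof. by have := @wtF _ (isT : ((3, 2) : int * int) \in posroots). Qed.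
Let wH01 : wt (0, 0) H01. Proof. exact: wtH. Qed.

Lemma lie_wt0 w w' x x' : wt w x -> wt w' x' -> w + w' \notin g_weights -> [lie x, x'] = 0.
Proof. by move=> Hx Hx'; apply: wt_nonroot; apply: wt_lie. Qed.

Lemma lieH10 w x : wt w x -> [lie H10, x] = (2 * w.1 - 3 * w.2)%:~R *: x.
Proof.
move=> Hx; rewrite (lieHE _ Hx) // rootfunE; have [-> -> _ _] := coroot_vals.
by congr (_ *: _); rewrite rmorphB !rmorphM /=; ring.
Qed.
Lemma lieH01 w x : wt w x -> [lie H01, x] = (2 * w.2 - w.1)%:~R *: x.
Proof.
move=> Hx; rewrite (lieHE _ Hx) // rootfunE; have [_ _ -> ->] := coroot_vals.
by congr (_ *: _); rewrite rmorphB !rmorphM /=; ring.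
Qed.

Ltac lw := solve [eapply lie_wt0; eauto].

Lemma lie_F01_E31 : [lie F01, E31] = 0. Proof. lw. Qed.
Lemma lie_F01_E21 : [lie F01, E21] = 0. Proof. lw. Qed.
Lemma lie_F01_E10 : [lie F01, E10] = 0. Proof. lw. Qed.
Lemma lie_F01_E01 : [lie F01, E01] = - H01.
Proof. by rewrite lieC EFE. Qed.
Lemma lie_F01_H01 : [lie F01, H01] = 2 *: F01.
Proof. by rewrite lieC (lieH01 wF01) /= -scaleNr -rmorphN. Qed.
Lemma lie_F01_E32 : [lie F01, E32] = - E31.
Proof.
rewrite (G2_E32 D) lie_derl lie_F01_E31 lie0l add0r lie_F01_E01 lieNr -lieNl lieC.
by rewrite lieNr opprK (lieH01 wE31) /= scaleN1r.
Qed.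
Lemma lie_F01_E11 : [lie F01, E11] = - E10.
Proof.
rewrite (G2_E11 D) lie_derl lie_F01_E10 lie0l add0r lie_F01_E01 lieNr -lieNl lieC.
by rewrite lieNr opprK (lieH01 wE10) /= scaleN1r.
Qed.

Lemma lie_E01_E31 : [lie E01, E31] = - E32.
Proof. by rewrite lieC -G2_E32. Qed.
Lemma lie_E01_E32 : [lie E01, E32] = 0. Proof. lw. Qed.
Lemma lie_E01_E21 : [lie E01, E21] = 0. Proof. lw. Qed.
Lemma lie_E01_E11 : [lie E01, E11] = 0. Proof. lw. Qed.
Lemma lie_E01_E10 : [lie E01, E10] = - E11.
Proof. by rewrite lieC -G2_E11. Qed.
Lemma lie_E01_H01 : [lie E01, H01] = - 2 *: E01.
Proof. by rewrite lieC (lieH01 wE01) /= -scaleNr. Qed.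
Lemma lie_E01_F01 : [lie E01, F01] = H01. Proof. exact: EFE. Qed.

Lemma lie_E11_E31 : [lie E11, E31] = 0. Proof. lw. Qed.
Lemma lie_E11_E32 : [lie E11, E32] = 0. Proof. lw. Qed.
Lemma lie_E10_E31 : [lie E10, E31] = 0. Proof. lw. Qed.
Lemma lie_E10_E32 : [lie E10, E32] = 0. Proof. lw. Qed.
Lemma lie_E21_E31 : [lie E21, E31] = 0. Proof. lw. Qed.
Lemma lie_E21_E32 : [lie E21, E32] = 0. Proof. lw. Qed.
Lemma lie_E31_E32 : [lie E31, E32] = 0. Proof. lw. Qed.
Lemma lie_E32_E31 : [lie E32, E31] = 0. Proof. lw. Qed.
Lemma lie_E21_H01 : [lie E21, H01] = 0.
Proof. by rewrite lieC (lieH01 wE21) /= scale0r oppr0. Qed.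

Let nz2 : (2 : K) != 0. Proof. by rewrite pnatr_eq0. Qed.
Let nz3 : (3 : K) != 0. Proof. by rewrite pnatr_eq0. Qed.

Lemma lie_E11_E10 : [lie E11, E10] = 2 *: E21.
Proof. by rewrite (G2_E21 D) scalerA divff // scale1r. Qed.
Lemma lie_E21_E10 : [lie E21, E10] = 3 *: E31.
Proof. by rewrite (G2_E31 D) scalerA divff // scale1r. Qed.
Lemma lie_E21_E11 : [lie E21, E11] = 3 *: E32.
Proof.
rewrite (G2_E32 D) -lieZl -lie_E21_E10 lie_derr (lieC E21 E01) lie_E01_E21 oppr0 lie0l.
by rewrite add0r -G2_E11.
Qed.
Lemma lie_E11_E21 : [lie E11, E21] = - 3 *: E32.
Proof. by rewrite lieC lie_E21_E11 scaleNr. Qed.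
Lemma lie_E11_F01 : [lie E11, F01] = E10.
Proof. by rewrite lieC lie_F01_E11 opprK. Qed.

Lemma lie_F10_E10 : [lie F10, E10] = - H10.
Proof. by rewrite lieC EFE. Qed.
Lemma lie_F10_E01 : [lie F10, E01] = 0. Proof. lw. Qed.
Lemma lie_F10_E11 : [lie F10, E11] = 3 *: E01.
Proof.
rewrite (G2_E11 D) lie_derl lie_F10_E01 lie0r addr0 lie_F10_E10 lieNl (lieH10 wE01) /=.
by rewrite -scaleNr -rmorphN.
Qed.
Lemma lie_F10_E21 : [lie F10, E21] = - 2 *: E11.
Proof.
rewrite (G2_E21 D) lieZr lie_derl lie_F10_E11 lie_F10_E10 lieNr (lieC E11) opprK.
rewrite (lieH10 wE11) lieZl lie_E01_E10 -(scaleN1r E11) scalerA -scalerDl.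
rewrite scalerA; congr (_ *: _); by rewrite /=; field.
Qed.
Lemma lie_F10_E31 : [lie F10, E31] = - E21.
Proof.
rewrite (G2_E31 D) lieZr lie_derl lie_F10_E21 lie_F10_E10 lieNr (lieC E21) opprK.
rewrite (lieH10 wE21) lieZl lie_E11_E10 scalerA -scalerDl scalerA -(scaleN1r E21).
by congr (_ *: _); rewrite /=; field.
Qed.
Lemma lie_F10_E32 : [lie F10, E32] = 0.
Proof.
rewrite (G2_E32 D) lie_derl lie_F10_E31 lie_F10_E01 lie0r addr0 lieNl lieC.
by rewrite lie_E01_E21 !oppr0.
Qed.

Definition F' : g := [lie F10, F01].
Lemma wtF' : wt (-1, -1) F'. Proof. exact: (wt_lie wF10 wF01). Qed.
Lemma lie_F'_E10 : [lie F', E10] = - 3 *: F01.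
Proof.
rewrite /F' lie_derr lie_F01_E10 lie0r addr0 lie_F10_E10 lieNl (lieH10 wF01) /=.
by rewrite scaleNr.
Qed.
Lemma lie_F'_E21 : [lie F', E21] = - 2 *: E10.
Proof.
by rewrite /F' lie_derr lie_F01_E21 lie0r addr0 lie_F10_E21 lieZl lie_E11_F01.
Qed.
Lemma lie_F'_F01 : [lie F', F01] = 0.
Proof. by apply: (lie_wt0 wtF' wF01). Qed.
Lemma lie_H10_E21 : [lie H10, E21] = E21.
Proof. by rewrite (lieH10 wE21) /= scale1r. Qed.
Lemma lie_H10_E10 : [lie H10, E10] = 2 *: E10.
Proof. by rewrite (lieH10 wE10). Qed.
Lemma lie_H10_E32 : [lie H10, E32] = 0.
Proof. by rewrite (lieH10 wE32) /= scale0r. Qed.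
Lemma lie_H10_F01 : [lie H10, F01] = 3 *: F01.
Proof. by rewrite (lieH10 wF01). Qed.

(** * Monomials in negative modes, filtered by length *)

Lemma comm_loop x y r s : comm (x @ (- r%:Z)) (y @ (- s%:Z)) = [lie x, y] @ (- (r + s)%N%:Z) :> U.
Proof.
rewrite /comm loop_comm PoszD opprD addrAC [y @ _ * _ + _]addrC addrK.
case: eqP => [/eqP e|]; last by rewrite cent0 addr0.
have -> : r = 0%N by lia.
by rewrite mul0r cent0 addr0.
Qed.

Lemma comm_loop0 x y s : comm (x @ 0) (y @ s) = [lie x, y] @ s :> U.
Proof. by rewrite /comm loop_comm0 addrAC subrr add0r. Qed.

(** The indices record the weight [i alpha + j beta - m delta] and the
    number [l] of factors. *)
Inductive mon : int -> int -> nat -> nat -> U -> Prop :=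
  | mon1 : mon 0 0 0 0 1
  | monM i0 j0 x r i j m l p : (i0, j0) \in g_weights -> wt (i0, j0) x -> (0 < r)%N ->
      mon i j m l p -> mon (i0 + i) (j0 + j) (r + m) l.+1 (x @ (- r%:Z) * p).

Lemma mon_cast i j m l i' j' m' l' p : mon i j m l p ->
  i = i' -> j = j' -> m = m' -> l = l' -> mon i' j' m' l' p.
Proof. by move=> H <- <- <- <-. Qed.

Lemma mon_mul i j m l i' j' m' l' p q : mon i j m l p -> mon i' j' m' l' q ->
  mon (i + i') (j + j') (m + m') (l + l') (p * q).
Proof.
move=> Hp Hq; elim: Hp => {i j m l p}[|i0 j0 x r i j m l p w wx r0 Hp IH].
  by rewrite !add0r mul1r.
rewrite -mulrA; apply: mon_cast (monM w wx r0 IH) _ _ _ _; lia.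
Qed.

Lemma mon_letter i j x r : (i, j) \in g_weights -> wt (i, j) x -> (0 < r)%N ->
  mon i j r 1 (x @ (- r%:Z)).
Proof.
move=> w wx r0; rewrite -[_ @ _]mulr1.
by apply: mon_cast (monM w wx r0 mon1) _ _ _ _; rewrite ?addr0 ?addn0.
Qed.

Lemma mon_exp i j m l p n : mon i j m l p ->
  mon (n%:Z * i) (n%:Z * j) (n * m) (n * l) (p ^+ n).
Proof.
move=> Hp; elim: n => [|n IH]; first by rewrite !mul0r expr0; apply: mon1.
by rewrite exprS; apply: mon_cast (mon_mul Hp IH) _ _ _ _; lia.
Qed.

(** The condition [P] bears on the number of factors. It gives the whole
    weight space ([Sall]), the part of length [l] ([Slen l]) and the part of
    length less than [l] ([Slt l]), so that working modulo shorter monomials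
    means membership in the latter. *)
Definition monspan P i j m : set U :=
  span (fun p => exists2 l, P l & mon i j m l p).

Lemma monspan_subspace P i j m : subspace (monspan P i j m). Proof. exact: span_subspace. Qed.
Lemma monspan0 P i j m : monspan P i j m 0. Proof. by case: (monspan_subspace P i j m). Qed.
Lemma monspan_mon P i j m l p : mon i j m l p -> P l -> monspan P i j m p.
Proof. by move=> Hp Pl; apply: span_sub; exists l. Qed.
Lemma monspanD P i j m p q : monspan P i j m p -> monspan P i j m q -> monspan P i j m (p + q).
Proof. exact: subspaceD (monspan_subspace _ _ _ _). Qed.
Lemma monspanZ P i j m a p : monspan P i j m p -> monspan P i j m (a *: p).
Proof. exact: subspaceZ (monspan_subspace _ _ _ _). Qed.
Lemma monspanB P i j m p q : monspan P i j m p -> monspan P i j m q -> monspan P i j m (p - q).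
Proof. exact: subspaceB (monspan_subspace _ _ _ _). Qed.
Lemma monspan_cast P Q i j m i' j' m' p : monspan P i j m p ->
  i = i' -> j = j' -> m = m' -> (forall l, P l -> Q l) -> monspan Q i' j' m' p.
Proof.
move=> H <- <- <- PQ; apply: span_min H; first exact: monspan_subspace.
by move=> q [l Pl Hq]; apply: monspan_mon Hq _; apply: PQ.
Qed.

Lemma monspan_mul P Q (R : nat -> Prop) i j m i' j' m' p q : monspan P i j m p -> monspan Q i'
  j' m' q ->
  (forall l l', P l -> Q l' -> R (l + l')%N) ->
  monspan R (i + i') (j + j') (m + m') (p * q).
Proof.
move=> Hp Hq H; move: Hp; apply: (span_min (T := fun p => monspan R _ _ _ (p * q))).
  split; first by rewrite mul0r; apply: monspan0.
  by move=> a x y Hx Hy; rewrite mulrDl -scalerAl; apply: monspanD => //; apply: monspanZ.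
move=> p1 [l Pl Hp1]; move: Hq; apply: (span_min (T := fun q => monspan R _ _ _ (p1 * q))).
  split; first by rewrite mulr0; apply: monspan0.
  by move=> a x y Hx Hy; rewrite mulrDr -scalerAr; apply: monspanD => //; apply: monspanZ.
by move=> q1 [l' Ql Hq1]; apply: monspan_mon (mon_mul Hp1 Hq1) _; apply: H.
Qed.

Lemma monspan_mulc P Q (R : nat -> Prop) i j m i' j' m' i2 j2 m2 p q :
  monspan P i j m p -> monspan Q i' j' m' q ->
  (forall l l', P l -> Q l' -> R (l + l')%N) ->
  i2 = i + i' -> j2 = j + j' -> m2 = (m + m')%N -> monspan R i2 j2 m2 (p * q).
Proof. by move=> Hp Hq H -> -> ->; apply: monspan_mul Hp Hq H. Qed.

Lemma monspan_letter P i j x r : wt (i, j) x -> (0 < r)%N -> P 1%N ->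
  monspan P i j r (x @ (- r%:Z)).
Proof.
move=> wx r0 P1; have [w|nw] := boolP ((i, j) \in g_weights).
  by apply: monspan_mon P1; apply: mon_letter.
by rewrite (wt_nonroot wx nw) loop0; apply: monspan0.
Qed.

Local Notation Slt l := (monspan (fun l' => (l' < l)%N)).
Local Notation Sall := (monspan (fun=> True)).
Local Notation Slen l := (monspan (fun l' => l' = l)).

(** The bracket of two negative modes is a single negative mode, without
    central term, so reordering costs only shorter monomials. *)
Lemma comm_mon i j m l i' j' m' l' p q : mon i j m l p -> mon i' j' m' l' q ->
  Slt (l + l') (i + i') (j + j') (m + m') (comm p q).
Proof.
move=> Hp; elim: Hp q i' j' m' l' => {i j m l p} [|i0 j0 x r i j m l p w wx r0 Hp IH].
  by move=> *; rewrite comm1l; apply: monspan0.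
move=> q i' j' m' l' Hq.
have Hx : Slt l'.+1 (i0 + i') (j0 + j') (r + m') (comm (x @ (- r%:Z)) q).
  elim: Hq => {i' j' m' l' q} [|i1 j1 y s i' j' m' l' q w1 wy s0 Hq IHq].
    by rewrite comm1r; apply: monspan0.
  rewrite commMr comm_loop; apply: monspanD.
    have H1 : Slen 1%N (i0 + i1) (j0 + j1) (r + s) ([lie x, y] @ (- (r + s)%N%:Z)).
      apply: monspan_letter => //; last by lia.
      exact: (wt_lie wx wy).
    have H2 : Slen l' i' j' m' q by apply: monspan_mon Hq _.
    by apply: (monspan_mulc H1 H2); lia.
  have H1 : Slen 1%N i1 j1 s (y @ (- s%:Z)) by apply: monspan_letter.
  by apply: (monspan_mulc H1 IHq); lia.
rewrite commMl; apply: monspanD.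
  have H1 : Slen 1%N i0 j0 r (x @ (- r%:Z)) by apply: monspan_letter.
  by apply: (monspan_mulc H1 (IH _ _ _ _ _ Hq)); lia.
have H2 : Slen l i j m p by apply: monspan_mon Hp _.
by apply: (monspan_mulc Hx H2); lia.
Qed.

(** The monomials without the modes of degree [-1] of [E31] and [E32]. These
    two form the doublet of the [sl_2] of [beta] that enters the elements
    [b], [c] and [w]. *)
Inductive tailmon : int -> int -> nat -> nat -> U -> Prop :=
  | tailmon1 : tailmon 0 0 0 0 1
  | tailmonM i0 j0 x r i j m l p : (i0, j0) \in g_weights -> wt (i0, j0) x -> (0 < r)%N ->
      ~~ ((i0 == 3) && (r == 1%N)) ->
      tailmon i j m l p -> tailmon (i0 + i) (j0 + j) (r + m) l.+1 (x @ (- r%:Z) * p).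

Lemma tailmon_mon i j m l p : tailmon i j m l p -> mon i j m l p.
Proof. by elim=> *; [apply: mon1 | apply: monM]. Qed.

Definition tailspan i j m l : set U := span (tailmon i j m l).

(** A zero mode of weight a multiple of [beta] changes neither the
    coefficient of [alpha] nor the degree of a factor, so no mode of the
    doublet can arise. *)
Lemma comm0_tailmon i1 j1 z i j m l p : wt (i1, j1) z -> i1 = 0 -> tailmon i j m l p ->
  tailspan (i1 + i) (j1 + j) m l (comm (z @ 0) p).
Proof.
move=> wz i10; elim=> {i j m l p} [|i0 j0 x r i j m l p w wx r0 nx Hp IH].
  by rewrite comm1r; case: (span_subspace (tailmon (i1 + 0) (j1 + 0) 0 0)) => H _; exact: H.
have S := span_subspace (tailmon (i1 + (i0 + i)) (j1 + (j0 + j)) (r + m) l.+1).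
rewrite commMr comm_loop0; apply: (subspaceD S).
  have wzx := wt_lie wz wx.
  have [w'|nw] := boolP (((i1, j1) : int * int) + (i0, j0) \in g_weights); last first.
    by rewrite (wt_nonroot wzx nw) loop0 mul0r; case: S => H _; exact: H.
  apply: span_sub; rewrite !addrA.
  by apply: tailmonM => //; rewrite i10 add0r.
apply: (span_min (T := fun q => span _ (x @ (- r%:Z) * q))) IH.
  split; first by rewrite mulr0; case: S => H _; exact: H.
  by move=> a u v Hu Hv; rewrite mulrDr -scalerAr; case: S => _; apply.
move=> q Hq; apply: span_sub.
have -> : i1 + (i0 + i) = i0 + (i1 + i) by lia.
have -> : j1 + (j0 + j) = j0 + (j1 + j) by lia.
exact: tailmonM.
Qed.

Lemma comm0_mon i1 j1 z i j m l p : wt (i1, j1) z -> mon i j m l p ->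
  Slen l (i1 + i) (j1 + j) m (comm (z @ 0) p).
Proof.
move=> wz; elim=> {i j m l p} [|i0 j0 x r i j m l p w wx r0 Hp IH].
  by rewrite comm1r; apply: monspan0.
rewrite commMr comm_loop0; apply: monspanD.
  have H1 : Slen 1%N (i1 + i0) (j1 + j0) r ([lie z, x] @ (- r%:Z)).
    by apply: monspan_letter => //; apply: (wt_lie wz wx).
  have H2 : Slen l i j m p by apply: monspan_mon Hp _.
  by apply: (monspan_mulc H1 H2); lia.
have H1 : Slen 1%N i0 j0 r (x @ (- r%:Z)) by apply: monspan_letter.
by apply: (monspan_mulc H1 IH); lia.
Qed.

Lemma comm0_monspan P i1 j1 z i j m p : wt (i1, j1) z -> monspan P i j m p ->
  monspan P (i1 + i) (j1 + j) m (comm (z @ 0) p).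
Proof.
move=> wz; apply: (span_min (T := fun p => monspan P _ _ _ (comm _ p))).
  split; first by rewrite comm0r; apply: monspan0.
  by move=> a u v Hu Hv; rewrite comm_linr; apply: monspanD => //; apply: monspanZ.
move=> q [l Pl Hq]; have H := comm0_mon wz Hq.
by apply: (monspan_cast H) => // _ ->.
Qed.

(** * Reduction modulo the image of [F01(0)] *)

Local Notation X := (E31 @ (-1) : U).
Local Notation Y := (E32 @ (-1) : U).
Local Notation A := (E21 @ (-1) : U).
Local Notation Bl := (E10 @ (-1) : U).
Local Notation Cl := (F01 @ (-1) : U).
Local Notation Dl := (E31 @ (-2) : U).
Local Notation e := (E01 @ 0 : U).
Local Notation f := (F01 @ 0 : U).
Local Notation hc := (H01 @ 0 : U).

Lemma monX : mon 3 1 1 1 X. Proof. exact: (mon_letter (r := 1)). Qed.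
Lemma monY : mon 3 2 1 1 Y. Proof. exact: (mon_letter (r := 1)). Qed.
Lemma monA : mon 2 1 1 1 A. Proof. exact: (mon_letter (r := 1)). Qed.
Lemma monBl : mon 1 0 1 1 Bl. Proof. exact: (mon_letter (r := 1)). Qed.
Lemma monCl : mon 0 (-1) 1 1 Cl. Proof. exact: (mon_letter (r := 1)). Qed.
Lemma monDl : mon 3 1 2 1 Dl. Proof. exact: (mon_letter (r := 2)). Qed.

Lemma commloop x y (r s : nat) : [lie x, y] = 0 ->
  comm (x @ (- r%:Z)) (y @ (- s%:Z)) = 0 :> U.
Proof. by move=> e; rewrite comm_loop e loop0. Qed.

Lemma XY_comm : X * Y = Y * X.
Proof. by apply: comm_eq0; apply: (@commloop _ _ 1 1); apply: lie_E31_E32. Qed.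

Lemma f_X : comm f X = 0.
Proof. by rewrite comm_loop0 lie_F01_E31 loop0. Qed.
Lemma f_Y : comm f Y = - X.
Proof. by rewrite comm_loop0 lie_F01_E32 loopN. Qed.

Lemma f_Yexp s : comm f (Y ^+ s.+1) = - (s.+1%:R *: (X * Y ^+ s)).
Proof.
elim: s => [|s IH]; first by rewrite expr1 expr0 mulr1 scale1r f_Y.
rewrite exprS commMr IH f_Y mulNr mulrN -scalerAr mulrA -XY_comm -mulrA -exprS.
by rewrite -opprD -[in RHS]natr1 scalerDl scale1r addrC.
Qed.

Lemma f_Xexp n : comm f (X ^+ n) = 0.
Proof. exact: commX0 f_X. Qed.

(** Up to shorter monomials the factors may be reordered, and the weight
    spaces of [E31] and [E32] are lines. *)
Lemma mon_normal i j m l p : mon i j m l p ->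
  exists a (q s : nat) o i' j' m' l',
  [/\ tailmon i' j' m' l' o, (i = (q + s)%N%:Z * 3 + i') /\ j = q%:Z + s%:Z * 2 + j',
      m = (q + s + m')%N /\ l = (q + s + l')%N
    & Slt l i j m (p - a *: (X ^+ q * Y ^+ s * o))].
Proof.
elim=> {i j m l p} [|i0 j0 x r i j m l p w wx r0 Hp].
  exists 1, 0%N, 0%N, 1, 0, 0, 0%N, 0%N; split=> //; first exact: tailmon1.
  by rewrite !expr0 !mulr1 scale1r subrr; apply: monspan0.
case=> a [q [s [o [i' [j' [m' [l' [Ho [-> ->] [-> ->] Hd]]]]]]]].
have Hx : Slen 1%N i0 j0 r (x @ (- r%:Z)) by apply: monspan_letter.
have Hxd := monspan_mulc (R := fun k => (k < (q + s + l').+1)%N) Hx Hd.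
have [/andP[/eqP i3 /eqP r1]|nx] := boolP ((i0 == 3) && (r == 1%N)); last first.
  exists a, q, s, (x @ (- r%:Z) * o), (i0 + i'), (j0 + j'), (r + m')%N, l'.+1; split.
  - exact: tailmonM.
  - by split; lia.
  - by split; lia.
  have mXY : mon ((q + s)%N%:Z * 3) (q%:Z + s%:Z * 2) (q + s) (q + s) (X ^+ q * Y ^+ s).
    apply: mon_cast (mon_mul (mon_exp q monX) (mon_exp s monY)) _ _ _ _; lia.
  have Hc := comm_mon (mon_letter w wx r0) mXY.
  have Ho' : Slen l' i' j' m' o by apply: monspan_mon (tailmon_mon Ho) _.
  have -> : x @ (- r%:Z) * p - a *: (X ^+ q * Y ^+ s * (x @ (- r%:Z) * o)) =
     x @ (- r%:Z) * (p - a *: (X ^+ q * Y ^+ s * o))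
     + a *: (comm (x @ (- r%:Z)) (X ^+ q * Y ^+ s) * o).
    rewrite mulrBr -addrA; congr (_ + _).
    by rewrite -scalerAr /comm mulrBl scalerBr !mulrA addKr.
  apply: monspanD; first by apply: Hxd; lia.
  by apply: monspanZ; apply: (monspan_mulc Hc Ho'); lia.
subst i0 r.
have [b Hb] : exists b, (j0 = 1 /\ x = b *: E31) \/ (j0 = 2 /\ x = b *: E32).
  move: w; rewrite !inE !xpair_eqE /= orbF => /orP[] /eqP ej; subst j0.
    by have [//|b ->] := wt_pos_dim1 _ wx; exists b; left.
  by have [//|b ->] := wt_pos_dim1 _ wx; exists b; right.
case: Hb => -[ej ex]; subst j0 x.
  exists (b * a), q.+1, s, o, i', j', m', l'; split=> //.
  - by split; lia.
  have -> : (b *: E31) @ (-1) * p - (b * a) *: (X ^+ q.+1 * Y ^+ s * o)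
     = (b *: E31) @ (-1) * (p - a *: (X ^+ q * Y ^+ s * o)).
    rewrite mulrBr loopZ -scalerA -!scalerAl -!scalerAr; congr (_ - _ *: (_ *: _)).
    by rewrite exprS !mulrA.
  by apply: Hxd; lia.
exists (b * a), q, s.+1, o, i', j', m', l'; split=> //.
- by split; lia.
- by split; lia.
have -> : (b *: E32) @ (-1) * p - (b * a) *: (X ^+ q * Y ^+ s.+1 * o)
   = (b *: E32) @ (-1) * (p - a *: (X ^+ q * Y ^+ s * o)).
  rewrite mulrBr loopZ -scalerA -!scalerAl -!scalerAr; congr (_ - _ *: (_ *: _)).
  rewrite exprS !mulrA; congr (_ * _ * _).
  by apply: commr_sym; apply: commrX; apply: esym; exact: XY_comm.
by apply: Hxd; lia.
Qed.

Lemma comm_A_Y : comm A Y = 0.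
Proof. by apply: (@commloop _ _ 1 1); apply: lie_E21_E32. Qed.
Lemma comm_Bl_Y : comm Bl Y = 0.
Proof. by apply: (@commloop _ _ 1 1); apply: lie_E10_E32. Qed.
Lemma comm_Bl_X : comm Bl X = 0.
Proof. by apply: (@commloop _ _ 1 1); apply: lie_E10_E31. Qed.
Lemma comm_E11_X : comm (E11 @ (-1)) X = 0.
Proof. by apply: (@commloop _ _ 1 1); apply: lie_E11_E31. Qed.
Lemma comm_Dl_Y : comm Dl Y = 0.
Proof. by apply: (@commloop _ _ 2 1); apply: lie_E31_E32. Qed.
Lemma comm_Dl_X : comm Dl X = 0.
Proof. by apply: (@commloop _ _ 2 1); apply: liexx. Qed.
Lemma comm_E32_2_Y : comm (E32 @ (-2)) Y = 0.
Proof. by apply: (@commloop _ _ 2 1); apply: liexx. Qed.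
Lemma comm_E32_2_X : comm (E32 @ (-2)) X = 0.
Proof. by apply: (@commloop _ _ 2 1); apply: lie_E32_E31. Qed.

Lemma f_A : comm f A = 0. Proof. by rewrite comm_loop0 lie_F01_E21 loop0. Qed.
Lemma f_Bl : comm f Bl = 0. Proof. by rewrite comm_loop0 lie_F01_E10 loop0. Qed.
Lemma f_Cl : comm f Cl = 0. Proof. by rewrite comm_loop0 liexx loop0. Qed.
Lemma f_Dl : comm f Dl = 0. Proof. by rewrite comm_loop0 lie_F01_E31 loop0. Qed.
Lemma f_E11 : comm f (E11 @ (-1)) = - Bl.
Proof. by rewrite comm_loop0 lie_F01_E11 loopN. Qed.
Lemma f_E32_2 : comm f (E32 @ (-2)) = - Dl.
Proof. by rewrite comm_loop0 lie_F01_E32 loopN. Qed.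
Lemma f_E01 : comm f (E01 @ (-1)) = - H01 @ (-1).
Proof. by rewrite comm_loop0 lie_F01_E01 loopN. Qed.
Lemma f_H01 : comm f (H01 @ (-1)) = 2 *: Cl.
Proof. by rewrite comm_loop0 lie_F01_H01 loopZ. Qed.

Lemma f_doublet hi lo : comm f hi = - lo -> comm f lo = 0 ->
  comm hi X = 0 -> comm lo X = 0 -> comm f (X * hi - Y * lo) = 0.
Proof.
move=> fh fl hX lX; rewrite commBr !commMr fh fl f_X f_Y.
by rewrite mul0r mulr0 addr0 add0r mulrN mulNr opprK addNr.
Qed.

Lemma f_a : comm f (elt_a D) = 0. Proof. exact: f_A. Qed.
Lemma f_c : comm f (elt_c D) = 0.
Proof. exact: (comm_triplet XY_comm f_X f_Y f_E01 f_H01 f_Cl). Qed.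

Lemma peel hi lo s Z : comm f hi = - lo -> comm f Z = 0 ->
  comm hi X = 0 -> comm lo Y = 0 ->
  s.+2%:R *: (lo * (Y ^+ s.+1 * Z)) =
  - (s.+1%:R *: ((X * hi - Y * lo) * (Y ^+ s * Z)) + comm f (hi * (Y ^+ s.+1 * Z))).
Proof. exact: (peel_doublet (f_Yexp s)). Qed.

(** The congruence of [p] with a multiple of [o], in weight [n (2 alpha +
    beta) - n delta], modulo the image of [F01(0)] and monomials of length
    less than [l]. *)
Definition lead n l (o p : U) : Prop := exists k z d,
  [/\ Sall (2 * n)%N%:Z n.+1%:Z n z, Slt l (2 * n)%N%:Z n%:Z n d
    & p = k *: o + comm f z + d].

Lemma lead_mul u d lu n l o p : comm f u = 0 -> Slen lu (2 * d)%N%:Z d%:Z d u ->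
  lead n l o p -> lead (d + n) (lu + l) (u * o) (u * p).
Proof.
move=> fu Hu [k [z [q [Hz Hq ->]]]]; exists k, (u * z), (u * q); split.
- by apply: (monspan_mulc Hu Hz) => //; lia.
- by apply: (monspan_mulc Hu Hq); lia.
- by rewrite commMr fu mul0r add0r mulrDr (mulrDr u) -(scalerAr k u o).
Qed.

Lemma lead_lin n l o a p z d : lead n l o p ->
  Sall (2 * n)%N%:Z n.+1%:Z n z -> Slt l (2 * n)%N%:Z n%:Z n d ->
  lead n l o (a *: p + comm f z + d).
Proof.
move=> [k [z' [q [Hz' Hq ->]]]] Hz Hd; exists (a * k), (a *: z' + z), (a *: q + d); split.
- by apply: monspanD => //; apply: monspanZ.
- by apply: monspanD => //; apply: monspanZ.
- by rewrite (comm_linr a f z' z); lmod K; ring.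
Qed.

Lemma Slen_mon i j m l p : mon i j m l p -> Slen l i j m p.
Proof. by move=> H; apply: monspan_mon H _. Qed.
Lemma Slt_mul i j m l i' j' m' l' p q : Slt l i j m p -> Slen l' i' j' m' q ->
  Slt (l + l')%N (i + i') (j + j') (m + m')%N (p * q).
Proof. by move=> Hp Hq; apply: monspan_mul Hp Hq _; lia. Qed.
Lemma Slen_a : Slen 1%N 2 1 1 (elt_a D).
Proof. by apply: monspan_mon monA _. Qed.
Lemma Slen_b : Slen 2%N 4 2 2 (elt_b D).
Proof.
apply: monspanB.
  by apply: monspan_mon (mon_mul monX (mon_letter (r := 1) _ wE11 _)) _.
by apply: monspan_mon (mon_mul monY monBl) _.
Qed.
Lemma Slen_w : Slen 2%N 6 3 3 (elt_w D).
Proof.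
apply: monspanB.
  by apply: monspan_mon (mon_mul monX (mon_letter (r := 2) _ wE32 _)) _.
by apply: monspan_mon (mon_mul monY monDl) _.
Qed.
Lemma Slen_c : Slen 3%N 6 3 3 (elt_c D).
Proof.
apply: monspanB; first apply: monspanB.
- by apply: monspan_mon (mon_mul (mon_exp 2 monX) (mon_letter (r := 1) _ wE01 _)) _.
- by apply: monspan_mon (mon_mul (mon_mul monY monX) (mon_letter (r := 1) _ wH01 _)) _.
- by apply: monspan_mon (mon_mul (mon_exp 2 monY) monCl) _.
Qed.

Definition ordmon (a b c d : nat) : U :=
  elt_a D ^+ a * (elt_b D ^+ b * (elt_c D ^+ c * elt_w D ^+ d)).
(** [A], [Bl], [Cl], [Dl] are the lowest vectors, for the [sl_2] of [beta],
    of the singlet, the two doublets and the triplet that are contracted in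
    [a], [b], [w] and [c]. *)
Definition lowmon (a b c d : nat) : U := A ^+ a * (Bl ^+ b * (Cl ^+ c * Dl ^+ d)).

Lemma nz (n : nat) : n.+1%:R != 0 :> K. Proof. by rewrite pnatr_eq0. Qed.

Lemma commute_exp (p q : U) (n : nat) : comm p q = 0 -> q ^+ n * p = p * q ^+ n.
Proof. by move=> e0; apply: commr_sym; apply: commrX; apply: comm_eq0. Qed.

(** By [peel_doublet], the lowest vector [lo] of a doublet and a factor [Y]
    become a factor [X hi - Y lo]. *)
Lemma lead_peel n l o hi lo s Z d lu : comm f hi = - lo -> comm f Z = 0 ->
  comm hi X = 0 -> comm lo Y = 0 -> comm f lo = 0 -> comm lo X = 0 ->
  Slen lu (2 * d)%N%:Z d%:Z d (X * hi - Y * lo) ->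
  Sall (2 * (d + n))%N%:Z (d + n).+1%:Z (d + n) (hi * (Y ^+ s.+1 * Z)) ->
  lead n l o (Y ^+ s * Z) ->
  lead (d + n) (lu + l) ((X * hi - Y * lo) * o) (Y ^+ s.+1 * (lo * Z)).
Proof.
move=> fh fZ hX lY fl lX Hu Hz Ho.
have -> : Y ^+ s.+1 * (lo * Z) =
  (- (s.+2%:R^-1 * s.+1%:R)) *: ((X * hi - Y * lo) * (Y ^+ s * Z)) +
   comm f (- s.+2%:R^-1 *: (hi * (Y ^+ s.+1 * Z))) + 0.
  rewrite (mulrA _ lo Z) (commute_exp s.+1 lY) -(mulrA lo) addr0 commZr.
  exact: scale_solve (nz s.+1) (peel s fh fZ hX lY).
apply: lead_lin; last exact: monspan0; last exact: monspanZ.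
exact: lead_mul (f_doublet fh fl hX lX) Hu Ho.
Qed.

Lemma lead_w d : lead (3 * d) (d + d) (elt_w D ^+ d) (Y ^+ d * Dl ^+ d).
Proof.
elim: d => [|d IH].
  exists 1, 0, 0; split; try exact: monspan0.
  by rewrite comm0r !addr0 scale1r !expr0 mulr1.
have H1 := mon_mul (mon_letter (r := 2) (isT : (3, 2) \in g_weights) wE32 isT)
  (mon_mul (mon_exp d.+1 monY) (mon_exp d monDl)).
have SW : Slen 2%N (2 * 3)%N%:Z 3%N%:Z 3%N (X * E32 @ (-2) - Y * Dl) := Slen_w.
have := lead_peel f_E32_2 (commX0 d f_Dl) comm_E32_2_X comm_Dl_Y f_Dl comm_Dl_X SW _ IH.
rewrite -!exprS mulnS addSn addnS; apply.
by apply: (monspan_cast (P := fun=> True) (monspan_mon (P := fun=> True) H1 _)) => //; lia.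
Qed.

(** By [peel_triplet], each [F01(-1)] takes two factors [Y] and becomes a
    factor [c]; the commutators of the triplet with powers of [Y] only
    produce shorter monomials. *)
Lemma lead_c c d : lead (3 * c + 3 * d) (c + c + c + d + d) (elt_c D ^+ c * elt_w D ^+ d)
  (Y ^+ (c + c + d) * (Cl ^+ c * Dl ^+ d)).
Proof.
elim: c => [|c IH]; first by rewrite !mul1r; apply: lead_w.
set s := (c + c + d)%N in IH *; set Z := Cl ^+ c * Dl ^+ d in IH *.
have fZ : comm f Z = 0 by apply: commM0r; apply: commX0; [exact: f_Cl|exact: f_Dl].
have mZ := mon_mul (mon_exp c monCl) (mon_exp d monDl).
have mE := mon_letter (r := 1) (isT : (0, 1) \in g_weights) wE01 isT.
have mH := mon_letter (r := 1) (isT : (0, 0) \in g_weights) wH01 isT.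
pose al := X ^+ 2 * Y ^+ s * (E01 @ (-1)) * Z.
pose be := X * Y ^+ s.+1 * (H01 @ (-1)) * Z.
pose ga := Y ^+ s.+2 * Cl * Z.
pose corr := (X ^+ 2 * comm (E01 @ (-1)) (Y ^+ s) - Y * X * comm (H01 @ (-1)) (Y ^+ s)
   - Y ^+ 2 * comm Cl (Y ^+ s)) * Z.
have Hcorr : Slt ((3 + (c + c + c + d + d)))%N (2 * (3 + (3 * c + 3 * d)))%N%:Z
  (3 + (3 * c + 3 * d))%N%:Z (3 + (3 * c + 3 * d))%N corr.
  have mYs := mon_exp s monY.
  have SZ := Slen_mon mZ.
  have S1 := Slen_mon (mon_exp 2 monX).
  have S2 := Slen_mon (mon_mul monY monX).
  have S3 := Slen_mon (mon_exp 2 monY).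
  rewrite /corr !mulrBl -(mulrA (X ^+ 2)) -(mulrA (Y * X)) -(mulrA (Y ^+ 2)).
  apply: monspanB; first apply: monspanB.
  - have T := Slt_mul (comm_mon mE mYs) SZ.
    by apply: (monspan_mulc S1 T); rewrite /s; lia.
  - have T := Slt_mul (comm_mon mH mYs) SZ.
    by apply: (monspan_mulc S2 T); rewrite /s; lia.
  - have T := Slt_mul (comm_mon monCl mYs) SZ.
    by apply: (monspan_mulc S3 T); rewrite /s; lia.
have -> : Y ^+ (c.+1 + c.+1 + d) * (Cl ^+ c.+1 * Dl ^+ d) = Y ^+ s.+2 * Cl * Z.
  have -> : (c.+1 + c.+1 + d = s.+2)%N by rewrite /s; lia.
  by rewrite [Cl ^+ c.+1]exprS /Z !mulrA.
rewrite (peel_triplet XY_comm f_X f_E01 f_H01 fZ (f_Yexp s) (f_Yexp s.+1)).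
rewrite -/corr; set q := s.+3%:R^-1 : K.
rewrite exprS -mulrA.
have -> : (3 * c.+1 + 3 * d = 3 + (3 * c + 3 * d))%N by lia.
have -> : (c.+1 + c.+1 + c.+1 + d + d = 3 + (c + c + c + d + d))%N by lia.
apply: lead_lin; last by apply: monspanZ.
  have Sc : Slen 3%N (2 * 3)%N%:Z 3%N%:Z 3%N (elt_c D) := Slen_c.
  exact: lead_mul f_c Sc IH.
apply: monspanB; apply: monspanZ.
  apply: (monspan_cast (P := fun=> True) (monspan_mon (P := fun=> True)
    (mon_mul (mon_mul (mon_exp s.+2 monY) mH) mZ) _)) => //; rewrite /s; lia.
apply: (monspan_cast (P := fun=> True) (monspan_mon (P := fun=> True)
  (mon_mul (mon_mul (mon_mul monX (mon_exp s.+1 monY)) mE) mZ) _)) => //; rewrite /s; lia.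
Qed.

Lemma lead_b b c d : lead (2 * b + (3 * c + 3 * d)) (b + b + (c + c + c + d + d))
  (elt_b D ^+ b * (elt_c D ^+ c * elt_w D ^+ d))
  (Y ^+ (b + (c + c + d)) * (Bl ^+ b * (Cl ^+ c * Dl ^+ d))).
Proof.
elim: b => [|b IH]; first by rewrite !expr0 !mul1r; apply: lead_c.
set s := (b + (c + c + d))%N in IH *; set Z := Bl ^+ b * _ in IH *.
have fZ : comm f Z = 0.
  by do !apply: commM0r; apply: commX0; rewrite ?f_Bl ?f_Cl ?f_Dl.
have H1 := mon_mul (mon_letter (r := 1) (isT : (1, 1) \in g_weights) wE11 isT)
  (mon_mul (mon_exp s.+1 monY) (mon_mul (mon_exp b monBl)
  (mon_mul (mon_exp c monCl) (mon_exp d monDl)))).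
have Sb : Slen 2%N (2 * 2)%N%:Z 2%N%:Z 2%N (X * E11 @ (-1) - Y * Bl) := Slen_b.
have := lead_peel f_E11 fZ comm_E11_X comm_Bl_Y f_Bl comm_Bl_X Sb _ IH.
rewrite (exprS Bl) (exprS (elt_b D)) -!mulrA addSn -/s.
have -> : (2 * b.+1 + (3 * c + 3 * d) = 2 + (2 * b + (3 * c + 3 * d)))%N by lia.
have -> : (b.+1 + b.+1 + (c + c + c + d + d) = 2 + (b + b + (c + c + c + d + d)))%N by lia.
apply.
by apply: (monspan_cast (P := fun=> True) (monspan_mon (P := fun=> True) H1 _)) => //; rewrite
  /s; lia.
Qed.

Lemma lead_lowmon a b c d : lead (a + (2 * b + (3 * c + 3 * d)))
  (a + (b + b + (c + c + c + d + d))) (ordmon a b c d)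
  (Y ^+ (b + (c + c + d)) * lowmon a b c d).
Proof.
elim: a => [|a IH]; first by rewrite /ordmon /lowmon !expr0 !mul1r; apply: lead_b.
have Sa : Slen 1%N (2 * 1)%N%:Z 1%N%:Z 1%N (elt_a D) := Slen_a.
have := lead_mul f_a Sa IH; rewrite !addSn; congr lead.
  by rewrite /ordmon [in RHS]exprS -mulrA.
rewrite /lowmon (exprS A) (mulrA A (Y ^+ _)).
by rewrite -(commute_exp _ comm_A_Y) -!mulrA.
Qed.

Lemma insert_letter i1 j1 m1 v i2 j2 m2 l2 p i3 j3 m3 l3 q :
  mon i1 j1 m1 1 v -> mon i2 j2 m2 l2 p -> mon i3 j3 m3 l3 q ->
  Slt (l2 + l3).+1 (i1 + (i2 + i3)) (j1 + (j2 + j3)) (m1 + (m2 + m3))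
    (v * (p * q) - p * (v * q)).
Proof.
move=> Hv Hp Hq; have -> : v * (p * q) - p * (v * q) = comm v p * q.
  by rewrite /comm mulrBl !mulrA.
by apply: (monspan_mulc (comm_mon Hv Hp) (Slen_mon Hq)); lia.
Qed.

Lemma insert_low i1 j1 m1 v a b c d :
  [\/ [/\ v = A, i1 = 2, j1 = 1 & m1 = 1%N],
      [/\ v = Bl, i1 = 1, j1 = 0 & m1 = 1%N],
      [/\ v = Cl, i1 = 0, j1 = -1 & m1 = 1%N] |
      [/\ v = Dl, i1 = 3, j1 = 1 & m1 = 2%N]] ->
  exists a' b' c' d',
   [/\ (i1 + (2 * a + b + 3 * d)%N%:Z = (2 * a' + b' + 3 * d')%N%:Z) /\
       j1 + (a%:Z - c%:Z + d%:Z) = (a'%:Z - c'%:Z + d'%:Z),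
       (m1 + (a + b + c + 2 * d) = (a' + b' + c' + 2 * d'))%N,
       ((a + b + c + d).+1 = (a' + b' + c' + d'))%N &
       Slt (a' + b' + c' + d')%N (2 * a' + b' + 3 * d')%N%:Z (a'%:Z - c'%:Z + d'%:Z)
         (a' + b' + c' + 2 * d') (v * lowmon a b c d - lowmon a' b' c' d')].
Proof.
have mA k := mon_exp k monA; have mB k := mon_exp k monBl.
have mC k := mon_exp k monCl; have mD k := mon_exp k monDl.
case=> -[-> -> -> ->].
- exists a.+1, b, c, d; split; try lia.
  by rewrite /lowmon exprS !mulrA subrr; apply: monspan0.
- exists a, b.+1, c, d; split; try lia.
  have H := insert_letter monBl (mA a) (mon_mul (mB b) (mon_mul (mC c) (mD d))).
  rewrite /lowmon [Bl ^+ b.+1]exprS -(mulrA Bl).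
  by apply: (monspan_cast H); lia.
- exists a, b, c.+1, d; split; try lia.
  have H := insert_letter monCl (mon_mul (mA a) (mB b)) (mon_mul (mC c) (mD d)).
  rewrite -!mulrA in H; rewrite /lowmon [Cl ^+ c.+1]exprS -?mulrA.
  by apply: (monspan_cast H); lia.
- exists a, b, c, d.+1; split; try lia.
  have H := insert_letter monDl (mon_mul (mA a) (mon_mul (mB b) (mC c))) (mD d).
  rewrite -!mulrA in H; rewrite /lowmon [Dl ^+ d.+1]exprS -?mulrA.
  by apply: (monspan_cast H); lia.
Qed.

(** The depth [j - i + m] is additive. On a single mode outside the doublet
    it is nonnegative, and it vanishes only for the lowest vectors [A],
    [Bl], [Cl], [Dl]. *)
Lemma tailmon_low i j m l p : tailmon i j m l p -> 0 <= j - i + m%:Z /\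
  (j - i + m%:Z = 0 -> exists k a b c d,
   [/\ i = (2 * a + b + 3 * d)%N%:Z /\ j = a%:Z - c%:Z + d%:Z,
      (m = a + b + c + 2 * d)%N, (l = a + b + c + d)%N
    & Slt l i j m (p - k *: lowmon a b c d)]).
Proof.
elim=> {i j m l p} [|i0 j0 x r i j m l p w wx r0 nx Hp [IH0 IH]].
  split=> // _; exists 1, 0%N, 0%N, 0%N, 0%N; split=> //.
  by rewrite /lowmon !expr0 !mulr1 scale1r subrr; apply: monspan0.
have wl : 0 <= j0 - i0 + r%:Z /\ (j0 - i0 + r%:Z = 0 ->
    exists k v, x @ (- r%:Z) = k *: v /\
  [\/ [/\ v = A, i0 = 2, j0 = 1 & r = 1%N],
      [/\ v = Bl, i0 = 1, j0 = 0 & r = 1%N],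
      [/\ v = Cl, i0 = 0, j0 = -1 & r = 1%N] |
      [/\ v = Dl, i0 = 3, j0 = 1 & r = 2%N]]).
  move: w nx wx; rewrite /g_weights !inE !xpair_eqE.
  repeat (case/orP); move=> /andP[/eqP -> /eqP ->] nx wx; (split; first lia); move=> tr; try lia.
  - have -> : r = 1%N by lia.
    have [//|k ->] := wt_pos_dim1 _ wx; exists k, Bl.
    by split; [rewrite loopZ | apply: Or42].
  - have -> : r = 1%N by lia.
    have [//|k ->] := wt_pos_dim1 _ wx; exists k, A.
    by split; [rewrite loopZ | apply: Or41].
  - have -> : r = 2%N by lia.
    have [//|k ->] := wt_pos_dim1 _ wx; exists k, Dl.
    by split; [rewrite loopZ | apply: Or44].
  - have -> : r = 1%N by lia.
    have [k ->] := @wt_neg_dim1 (0, 1) x isT wx; exists k, Cl.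
    by split; [rewrite loopZ | apply: Or43].
case: wl => t0 wl; split=> [|t1]; first by lia.
have [k [v [xv Hv]]] := wl (ltac:(lia)).
have [k' [a [b [c [d [[ei ej] em el Hd]]]]]] := IH (ltac:(lia)).
have [a' [b' [c' [d' [[ei' ej'] em' el' Hd']]]]] := insert_low a b c d Hv.
exists (k * k'), a', b', c', d'; subst i j m l; split=> //.
rewrite el' ei' ej' em' xv.
have -> : (k *: v) * p - (k * k') *: lowmon a' b' c' d' =
  (k *: v) * (p - k' *: lowmon a b c d) + (k * k') *: (v * lowmon a b c d - lowmon a' b' c' d').
  by rewrite mulrBr -scalerAl -(scalerAl k v (k' *: _)) -(scalerAr k' v); lmod K; ring.
apply: monspanD; last exact: monspanZ.
have Hx : Slen 1%N i0 j0 r (k *: v) by rewrite -xv; apply: monspan_letter.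
by apply: (monspan_mulc Hx Hd); lia.
Qed.

Definition ordspan n : set U :=
  span (fun p => exists a b c d, (a + (2 * b + (3 * c + 3 * d)) = n)%N /\
    p = ordmon a b c d).

Definition decomp n (p : U) : Prop := exists (r z : U),
  [/\ ordspan n r, Sall (2 * n)%N%:Z n.+1%:Z n z & p = r + comm f z].

Lemma decomp_subspace n : subspace (decomp n).
Proof.
have S := span_subspace (fun p => exists a b c d,
  (a + (2 * b + (3 * c + 3 * d)) = n)%N /\ p = ordmon a b c d).
split; first by exists 0, 0; split; [case: S | apply: monspan0 | rewrite comm0r addr0].
move=> k x y [r [z [Hr Hz ->]]] [r' [z' [Hr' Hz' ->]]].
exists (k *: r + r'), (k *: z + z'); split.
- by case: S => _; apply.
- by apply: monspanD => //; apply: monspanZ.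
- by rewrite (comm_linr k f z z'); lmod K; ring.
Qed.

Lemma monspan_decomp P n p : (forall l p, P l -> mon (2 * n)%N%:Z n%:Z n l p -> decomp n p) ->
  monspan P (2 * n)%N%:Z n%:Z n p -> decomp n p.
Proof.
move=> H; apply: span_min; first exact: decomp_subspace.
by move=> q [l Pl Hq]; apply: H Hq.
Qed.

(** Induction on the length and then on the number [q] of factors [E31(-1)].
    The depth [j - i + m] of the whole monomial is zero, it is [-1] on
    [E31(-1)] and [0] on [E32(-1)], so the tail has depth [q]. If [q = 0]
    the tail is a lowest monomial modulo shorter ones, and [lead_lowmon]
    applies. If [q > 0], a factor [E31(-1)] is up to sign the image of
    [E32(-1)] under [F01(0)]; modulo the image of [F01(0)] this operator may
    be moved over to the tail, which removes the factor. *)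
Lemma mon_decomp n l p : mon (2 * n)%N%:Z n%:Z n l p -> decomp n p.
Proof.
have [k lk] := ubnP l; elim: k l lk p => // k IHk l lk p Hp.
have IH : forall q, Slt l (2 * n)%N%:Z n%:Z n q -> decomp n q.
  move=> q; apply: monspan_decomp => l' q' l'l; apply: IHk; lia.
have TS := decomp_subspace n.
have [a [q [s [o [i' [j' [m' [l' [Ho [ei ej] [em el] Hd]]]]]]]]] := mon_normal Hp.
suff H : decomp n (X ^+ q * Y ^+ s * o).
  rewrite -[p](subrK (a *: (X ^+ q * Y ^+ s * o))); apply: (subspaceD TS); first exact: IH.
  exact: (subspaceZ _ TS H).
elim: q s o i' j' m' l' Ho ei ej em el {Hd} => [|q IHq] s o i' j' m' l' Ho ei ej em el.
  rewrite expr0 mul1r.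
  have [_ /(_ ltac:(lia)) [k' [a1 [b1 [c1 [d1 [[ei' ej'] em' el' Hd]]]]]]] := tailmon_low Ho.
  have es : s = (b1 + (c1 + c1 + d1))%N by lia.
  have -> : Y ^+ s * o = Y ^+ s * (o - k' *: lowmon a1 b1 c1 d1)
      + k' *: (Y ^+ s * lowmon a1 b1 c1 d1).
    by rewrite mulrBr -(scalerAr k' (Y ^+ s)) subrK.
  apply: (subspaceD TS).
    apply: IH.
    by apply: (monspan_mulc (Slen_mon (mon_exp s monY)) Hd); lia.
  apply: (subspaceZ _ TS).
  have := lead_lowmon a1 b1 c1 d1; rewrite -es.
  have -> : (a1 + (2 * b1 + (3 * c1 + 3 * d1)) = n)%N by lia.
  have -> : (a1 + (b1 + b1 + (c1 + c1 + c1 + d1 + d1)) = l)%N by lia.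
  case=> k2 [z [e' [Hz He ->]]]; apply: (subspaceD TS); last exact: IH.
  exists (k2 *: ordmon a1 b1 c1 d1), z; split=> //.
  apply: (subspaceZ _ (span_subspace _)); apply: span_sub.
  by exists a1, b1, c1, d1; split=> //; lia.
have fo := comm0_tailmon wF01 (erefl 0) Ho.
(* The commutator of f with Y^(s+1) is - (s + 1) X Y^s. *)
have E0 : X ^+ q.+1 * Y ^+ s * o = s.+1%:R^-1 *: (X ^+ q * Y ^+ s.+1 * comm f o)
   - s.+1%:R^-1 *: comm f (X ^+ q * Y ^+ s.+1 * o).
  rewrite !commMr f_Xexp f_Yexp mul0r add0r !(mulrN, mulNr) -scalerAr -scalerAl.
  rewrite mulrA -exprSr.
  lmod K; field; by rewrite nat1r nz.
rewrite E0; apply: (subspaceB TS); apply: (subspaceZ _ TS).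
  apply: (span_min (T := fun o' => decomp n (X ^+ q * Y ^+ s.+1 * o'))) fo.
    split; first by rewrite mulr0; case: TS.
    move=> k' x y Hx Hy; rewrite mulrDr -(scalerAr k' (X ^+ q * Y ^+ s.+1)).
    by case: TS => _; apply.
  move=> o' Ho'; apply: IHq Ho' _ _ _ _; lia.
exists 0, (X ^+ q * Y ^+ s.+1 * o); split; last by rewrite add0r.
  by case: (span_subspace (fun p => exists a b c d,
   (a + (2 * b + (3 * c + 3 * d)) = n)%N /\ p = ordmon a b c d)).
have H := mon_mul (mon_mul (mon_exp q monX) (mon_exp s.+1 monY)) (tailmon_mon Ho).
by apply: (monspan_cast (P := fun=> True) (monspan_mon (P := fun=> True) H _)) => //; lia.
Qed.

Lemma Sall_decomp n p : Sall (2 * n)%N%:Z n%:Z n p -> decomp n p.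
Proof. by apply: monspan_decomp => l q _; apply: mon_decomp. Qed.

(** * Invariants of the [sl_2] of the long simple root *)

Lemma e_X : comm e X = - Y.
Proof. by rewrite comm_loop0 lie_E01_E31 loopN. Qed.
Lemma e_Y : comm e Y = 0.
Proof. by rewrite comm_loop0 lie_E01_E32 loop0. Qed.

Lemma e_a : comm e (elt_a D) = 0.
Proof. by rewrite comm_loop0 lie_E01_E21 loop0. Qed.
Lemma e_b : comm e (elt_b D) = 0.
Proof.
apply: (comm_doublet_up e_X e_Y); rewrite comm_loop0.
  by rewrite lie_E01_E11 loop0.
by rewrite lie_E01_E10 loopN.
Qed.
Lemma e_w : comm e (elt_w D) = 0.
Proof.
apply: (comm_doublet_up e_X e_Y); rewrite comm_loop0.
  by rewrite lie_E01_E32 loop0.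
by rewrite lie_E01_E31 loopN.
Qed.
Lemma e_c : comm e (elt_c D) = 0.
Proof.
apply: (comm_triplet_up XY_comm e_X e_Y); rewrite comm_loop0.
- by rewrite liexx loop0.
- by rewrite lie_E01_H01 loopZ.
- by rewrite lie_E01_F01.
Qed.

Lemma comm_span_eq0 (S : set U) q p : (forall p, S p -> comm q p = 0) ->
  span S p -> comm q p = 0.
Proof.
move=> H; apply: (span_min (T := fun p => comm q p = 0)) => //.
split; first exact: comm0r.
by move=> a x y Hx Hy; rewrite comm_linr Hx Hy scaler0 addr0.
Qed.

Lemma e_ordspan n p : ordspan n p -> comm e p = 0.
Proof.
apply: comm_span_eq0 => _ [a [b [c [d [_ ->]]]]].
by do !apply: commM0r; apply: commX0; rewrite ?e_a ?e_b ?e_c ?e_w.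
Qed.

(** The coefficient of [beta] in the weight of a mode is at most twice its
    degree. Hence [E01(0)] acts nilpotently on each string. *)
Lemma Sall_high i j m p : 2 * m%:Z < j -> Sall i j m p -> p = 0.
Proof.
move=> lt; apply: (span_min (T := fun p => p = 0)).
  by split=> // a x y -> ->; rewrite scaler0 addr0.
move=> q [l _ Hq]; suff : j <= 2 * m%:Z by lia.
elim: Hq => // i0 j0 x r i' j' m' l' p' w _ r0 _ IH.
by move: w; rewrite !inE !xpair_eqE; repeat (case/orP); move=> /andP[/eqP ? /eqP ?]; lia.
Qed.

Lemma h_monspan P i j m p : monspan P i j m p -> comm hc p = (2 * j - i)%:~R *: p.
Proof.
apply: (span_min (T := fun p => comm hc p = (2 * j - i)%:~R *: p)).
  split; first by rewrite comm0r scaler0.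
  move=> a x y Hx Hy; rewrite comm_linr Hx Hy; by lmod K; ring.
move=> q [l _]; elim=> {i j m l q} [|i0 j0 x r i j m l q w wx r0 Hq IH].
  by rewrite comm1r scale0r.
rewrite commMr IH comm_loop0 (lieH01 wx) loopZ /= -scalerAl -(scalerAr _ (x @ _)) -scalerDl.
by congr (_ *: _); rewrite -rmorphD /=; congr (_%:~R); ring.
Qed.

Variable k : K.
Definition vacnull : set U := fun p => p *: vac B k = 0.

Lemma vacnull_subspace : subspace vacnull.
Proof.
split; first exact: scale0r.
move=> a x y Hx Hy; rewrite /vacnull scalerDl Hy addr0.
by rewrite -[x]mul1r scalerAl -scalerA Hx scaler0.
Qed.

Lemma vacnull_l q p : vacnull p -> vacnull (q * p).
Proof. by rewrite /vacnull -scalerA => ->; rewrite scaler0. Qed.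
Lemma vacnull_r x r p : vacnull (p * x @ r%:Z).
Proof. by rewrite /vacnull -scalerA vac_ge0 ?scaler0. Qed.
Lemma vacnull_comm x p : vacnull p -> vacnull (comm (x @ 0) p).
Proof.
move=> H; apply: (subspaceB vacnull_subspace); first exact: vacnull_l.
exact: (vacnull_r x 0).
Qed.

(** Write the vector as [r + f z] with [r] a combination of ordered
    monomials in [a], [b], [c], [w]. These are invariant, so [e f z]
    annihilates the vacuum, and [sl2_descent] applies to [z], whose
    [H01]-weight is 2. *)
Lemma invariant_ordspan n p : Sall (2 * n)%N%:Z n%:Z n p -> vacnull (comm e p) ->
  exists r : U, ordspan n r /\ vacnull (p - r).
Proof.
move=> /Sall_decomp [r [z [Hr Hz ->]]]; rewrite commDr (e_ordspan Hr) add0r => Hefz.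
exists r; split=> //; rewrite addrAC subrr add0r; apply: vacnull_comm.
have Hj (j : nat) : Sall (2 * n)%N%:Z (n.+1 + j)%N%:Z n (iter j (comm e) z).
  elim: j => [|j IH]; first by rewrite addn0.
  rewrite iterS; apply: (monspan_cast (comm0_monspan wE01 IH)) => //; lia.
apply: (sl2_descent vacnull_subspace _ _ _ _ _ Hefz).
- by move=> q; apply: vacnull_comm.
- by move=> q; apply: vacnull_comm.
- by rewrite comm_loop0 lie_E01_F01.
- move=> j; rewrite (h_monspan (Hj j)); congr (_ *: _).
  have -> : 2 * (n.+1 + j)%N%:Z - (2 * n)%N%:Z = (2 * j.+1)%N%:Z by lia.
  by rewrite -pmulrn natrM.
- exists n.+1; rewrite (Sall_high _ (Hj n.+1)); last by lia.
  by case: vacnull_subspace.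
Qed.

Lemma wt_monomial_monspan p w m : wt_monomial (D := D) p w m -> Sall w.1 w.2 m p.
Proof.
elim=> {p w m} [|x w r p w' m wx r0 Hp IH]; first exact: monspan_mon mon1 I.
have Hx : Sall w.1 w.2 r (x @ (- r%:Z)) by apply: monspan_letter => //; case: w wx.
exact: (monspan_mulc Hx IH).
Qed.

Lemma vac_weight_spaceE n (v : vacmod B k) : vac_weight_space D k ((2, 1) *+ n) n v ->
  exists2 p : U, Sall (2 * n)%N%:Z n%:Z n p & v = p *: vac B k.
Proof.
case=> p Hp <-; exists p => //.
apply: span_min Hp; first exact: monspan_subspace.
move=> q /wt_monomial_monspan; congr (Sall _ _ _ _).
  by elim: n => // n IH; rewrite mulrS [LHS]/= IH; lia.
by elim: n => // n IH; rewrite mulrS [LHS]/= IH; lia.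
Qed.

Definition ordsum n (be : nat -> nat -> nat -> nat -> K) : U :=
  \sum_(a < n.+1) \sum_(b < n.+1) \sum_(c < n.+1) \sum_(d < n.+1)
    be a b c d *: ordmon a b c d.
Definition ord_supp n (be : nat -> nat -> nat -> nat -> K) : Prop :=
  forall a b c d, be a b c d != 0 -> (a + (2 * b + (3 * c + 3 * d)) = n)%N.

Lemma ordspan_sum n (r0 : U) : ordspan n r0 -> exists2 be, ord_supp n be & r0 = ordsum n be.
Proof.
apply: (span_min (T := fun r0 : U => exists2 be, ord_supp n be & r0 = ordsum n be)).
  split.
    exists (fun _ _ _ _ => 0) => [a b c d|]; first by rewrite eqxx.
    by rewrite /ordsum !big1 // => i _; rewrite big1 // => ? _; rewrite big1 // => ? _;
      rewrite big1 // => ? _; rewrite scale0r.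
  move=> k0 x y [b1 s1 ->] [b2 s2 ->].
  exists (fun a b c d => k0 * b1 a b c d + b2 a b c d) => [a b c d|].
    have [e1|/s1 //] := eqVneq (b1 a b c d) 0; have [e2|/s2 //] := eqVneq (b2 a b c d) 0.
    by rewrite e1 e2 mulr0 addr0 eqxx.
  rewrite /ordsum scaler_sumr -big_split; apply: eq_bigr => a _ /=.
  rewrite scaler_sumr -big_split; apply: eq_bigr => b _ /=.
  rewrite scaler_sumr -big_split; apply: eq_bigr => c _ /=.
  rewrite scaler_sumr -big_split; apply: eq_bigr => d _ /=.
  by rewrite scalerDl scalerA.
move=> _ [a [b [c [d [en ->]]]]].
exists (fun a' b' c' d' => (a' == a)%:R * ((b' == b)%:R * ((c' == c)%:R * (d' == d)%:R))).
  move=> a' b' c' d'; rewrite !mulf_eq0 !negb_or !pnatr_eq0 !eqb0 !negbK.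
  by case/and4P=> /eqP -> /eqP -> /eqP -> /eqP ->.
rewrite /ordsum -(@sum_delta _ n a _ (fun a' => ordmon a' b c d)); last by lia.
apply: eq_bigr => a' _; rewrite -(@sum_delta _ n b _ (fun b' => ordmon a' b' c d)); last by lia.
rewrite scaler_sumr; apply: eq_bigr => b' _.
rewrite -(@sum_delta _ n c _ (fun c' => ordmon a' b' c' d)); last by lia.
rewrite !scaler_sumr; apply: eq_bigr => c' _.
rewrite -(@sum_delta _ n d _ (fun d' => ordmon a' b' c' d')); last by lia.
by rewrite !scaler_sumr; apply: eq_bigr => d' _; rewrite !scalerA !mulrA.
Qed.

Lemma invariant_ordsum n p : Sall (2 * n)%N%:Z n%:Z n p -> vacnull (comm e p) ->
  exists2 be, ord_supp n be & vacnull (p - ordsum n be).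
Proof.
move=> H1 H2; have [r [/ordspan_sum [be s ->] Hr]] := invariant_ordspan H1 H2.
by exists be.
Qed.

(** * Functionals with prescribed values on root vectors *)

Lemma form_FE_neq0 w : w \in posroots -> B (F D w) (E D w) != 0.
Proof.
move=> wr; have [t Dt [B0 _]] := G2_H D wr.
rewrite formC (form_EF wr Dt) mulf_neq0 ?invr_neq0 //; by rewrite pnatr_eq0.
Qed.

Lemma form_F10_E10 : B F10 E10 = 3.
Proof.
have [ta [tb [Da _ Baa _ _]]] := dual_gram.
by rewrite formC (form_EF _ Da) // Baa; field.
Qed.

Definition dualval (x0 y0 : g) (c : K) x : K := c / B x0 y0 * B x0 x.
(** The linear form with values [1], [e0], [f0], [a0] on [E32], [E10],
    [F01], [E21] and zero on the other root vectors and on the Cartan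
    subalgebra, as a combination of pairings with the opposite root vectors. *)
Definition rootval (a0 e0 f0 : K) x : K :=
  dualval F32 E32 1 x + dualval F10 E10 e0 x + dualval E01 F01 f0 x
  + dualval F21 E21 a0 x.

Lemma rootval_lin a0 e0 f0 a x y : rootval a0 e0 f0 (a *: x + y) = a * rootval a0 e0 f0 x +
  rootval a0 e0 f0 y.
Proof. by rewrite /rootval /dualval !formDr; ring. Qed.

Lemma dualval_id x0 y0 c : B x0 y0 != 0 -> dualval x0 y0 c y0 = c.
Proof. by move=> n0; rewrite /dualval divfK. Qed.
Lemma dualval_wt w0 w x0 y0 c x : wt w0 x0 -> wt w x -> w0 + w != 0 ->
  dualval x0 y0 c x = 0.
Proof. by move=> Hx0 Hx ne; rewrite /dualval (form_wt0 Hx0 Hx ne) mulr0. Qed.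

Section Values.
Variables a0 e0 f0 : K.
Local Notation pi := (rootval a0 e0 f0).

Lemma piD x y : pi (x + y) = pi x + pi y.
Proof. by have := rootval_lin a0 e0 f0 1 x y; rewrite scale1r mul1r. Qed.
Lemma pi0 : pi 0 = 0.
Proof. by apply: (addIr (pi 0)); rewrite -piD !add0r. Qed.
Lemma piZ a x : pi (a *: x) = a * pi x.
Proof. by have := rootval_lin a0 e0 f0 a x 0; rewrite pi0 !addr0. Qed.
Lemma piN x : pi (- x) = - pi x.
Proof. by rewrite -scaleN1r piZ mulN1r. Qed.

Lemma pi_wt0 w x : wt w x -> w \notin [:: (3, 2); (1, 0); (0, -1); (2, 1)] -> pi x = 0.
Proof.
move=> Hx; rewrite !inE !negb_or; case: w Hx => i j Hx /and4P[n1 n2 n3 n4].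
rewrite /rootval (dualval_wt _ _ wF32 Hx) ?(dualval_wt _ _ wF10 Hx)
  ?(dualval_wt _ _ wE01 Hx) ?(dualval_wt _ _ wF21 Hx) ?addr0 //.
- by move: n4; rewrite !xpair_eqE /=; lia.
- by move: n3; rewrite !xpair_eqE /=; lia.
- by move: n2; rewrite !xpair_eqE /=; lia.
- by move: n1; rewrite !xpair_eqE /=; lia.
Qed.

Lemma pi_E32 : pi E32 = 1.
Proof.
rewrite /rootval dualval_id ?form_FE_neq0 // (dualval_wt _ _ wF10 wE32) //.
by rewrite (dualval_wt _ _ wE01 wE32) // (dualval_wt _ _ wF21 wE32) // !addr0.
Qed.
Lemma pi_E10 : pi E10 = e0.
Proof.
rewrite /rootval dualval_id ?form_FE_neq0 // (dualval_wt _ _ wF32 wE10) // add0r.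
by rewrite (dualval_wt _ _ wE01 wE10) // (dualval_wt _ _ wF21 wE10) // !addr0.
Qed.
Lemma pi_F01 : pi F01 = f0.
Proof.
rewrite /rootval dualval_id; last by rewrite formC form_FE_neq0.
rewrite (dualval_wt _ _ wF32 wF01) // (dualval_wt _ _ wF10 wF01) // !add0r.
by rewrite (dualval_wt _ _ wF21 wF01) // !addr0.
Qed.
Lemma pi_E21 : pi E21 = a0.
Proof.
rewrite /rootval dualval_id ?form_FE_neq0 // (dualval_wt _ _ wF32 wE21) //.
by rewrite (dualval_wt _ _ wF10 wE21) // (dualval_wt _ _ wE01 wE21) // !add0r.
Qed.
Lemma pi_E31 : pi E31 = 0. Proof. exact: pi_wt0 wE31 _. Qed.
Lemma pi_E11 : pi E11 = 0. Proof. exact: pi_wt0 wE11 _. Qed.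
Lemma pi_E01 : pi E01 = 0. Proof. exact: pi_wt0 wE01 _. Qed.
Lemma pi_H01 : pi H01 = 0. Proof. exact: pi_wt0 wH01 _. Qed.

Definition wval : U -> K := vacfun k pi.
Let pl := rootval_lin a0 e0 f0.

Lemma wvalD p q : wval (p + q) = wval p + wval q. Proof. exact: vacfunD. Qed.
Lemma wvalZ a p : wval (a *: p) = a * wval p. Proof. exact: vacfunZ. Qed.
Lemma wvalB p q : wval (p - q) = wval p - wval q. Proof. exact: vacfunB. Qed.
Lemma wval1 : wval 1 = 1. Proof. exact: vacfun1. Qed.
Lemma wval0 : wval 0 = 0. Proof. exact: vacfun0. Qed.
Lemma wval_sum n (F : 'I_n -> U) : wval (\sum_(i < n) F i) = \sum_(i < n) wval (F i).
Proof. exact: vacfun_sum. Qed.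
Lemma wvalM p q : U_minus B p -> wval (p * q) = wval p * wval q.
Proof. exact: vacfun_U_minus. Qed.
Lemma wvalX p n : U_minus B p -> wval (p ^+ n) = wval p ^+ n.
Proof.
move=> H; elim: n => [|n IH]; first by rewrite !expr0 wval1.
by rewrite !exprS wvalM // IH.
Qed.
Lemma wval_l1 x p : wval (x @ (-1) * p) = pi x * wval p. Proof. exact: vacfun_loop1. Qed.
Lemma wval_l2 x p : wval (x @ (-2) * p) = 0. Proof. exact: vacfun_loop2. Qed.
Lemma wval_1 x : wval (x @ (-1)) = pi x.
Proof. by rewrite -[_ @ _]mulr1 wval_l1 wval1 mulr1. Qed.
Lemma wval_2 x : wval (x @ (-2)) = 0.
Proof. by rewrite -[_ @ _]mulr1 wval_l2. Qed.
Lemma wval_ge0 x (r : nat) p : wval (p * x @ r%:Z) = 0. Proof. exact: vacfun_loop_ge0. Qed.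
Lemma wval_cent c p : wval (cent B c * p) = k * c * wval p. Proof. exact: vacfun_cent. Qed.
Lemma wval_vacnull p : vacnull p -> wval p = 0. Proof. exact: vacfun_vac0. Qed.

Lemma Um1 x : U_minus B (x @ (-1)). Proof. exact: U_minus_loop. Qed.
Lemma Um2 x : U_minus B (x @ (-2)). Proof. exact: U_minus_loop. Qed.

Lemma Um_a : U_minus B (elt_a D). Proof. exact: Um1. Qed.
Lemma Um_b : U_minus B (elt_b D).
Proof. by apply: U_minusB; apply: U_minusM; apply: Um1. Qed.
Lemma Um_c : U_minus B (elt_c D).
Proof.
have XY2 x y z : U_minus B (x @ (-1) * y @ (-1) * z @ (-1)).
  by apply: U_minusM; [apply: U_minusM|]; apply: Um1.
by apply: U_minusB; first apply: U_minusB; rewrite ?expr2.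
Qed.
Lemma Um_w : U_minus B (elt_w D).
Proof. by apply: U_minusB; apply: U_minusM; (apply: Um1 || apply: Um2). Qed.
Lemma Um_ordmon a b c d : U_minus B (ordmon a b c d).
Proof.
have Ua := Um_a; have Ub := Um_b; have Uc := Um_c; have Uw := Um_w.
have Ucw : U_minus B (elt_c D ^+ c * elt_w D ^+ d) by apply: U_minusM; apply: U_minusX.
have Ubcw := U_minusM (U_minusX b Ub) Ucw.
exact: U_minusM (U_minusX a Ua) Ubcw.
Qed.
Lemma Um_u : U_minus B (elt_u D).
Proof. exact: U_minusB (U_minusZ _ (U_minusX 2 Um_a)) Um_b. Qed.
Lemma Um_v : U_minus B (elt_v D).
Proof.
exact: U_minusB (U_minusB (U_minusZ _ (U_minusX 3 Um_a)) (U_minusM Um_a Um_b))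
  (U_minusZ _ Um_c).
Qed.

Lemma wval_a : wval (elt_a D) = a0. Proof. by rewrite wval_1 pi_E21. Qed.
Lemma wval_b : wval (elt_b D) = - e0.
Proof. by rewrite wvalB !wval_l1 !wval_1 pi_E31 pi_E32 pi_E10 mul0r sub0r mul1r. Qed.
Lemma wval_c : wval (elt_c D) = - f0.
Proof.
rewrite !wvalB !expr2 -!mulrA !wval_l1 !wval_1 pi_E31 pi_E32 pi_F01; ring.
Qed.
Lemma wval_w : wval (elt_w D) = 0.
Proof. by rewrite wvalB !wval_l1 !wval_2 !mulr0 subrr. Qed.
Lemma wval_u : wval (elt_u D) = a0 ^+ 2 / 3 + e0.
Proof. rewrite wvalB wvalZ wvalX ?wval_a ?wval_b; [ring | exact: Um_a]. Qed.
Lemma wval_v : wval (elt_v D) = 2 / 9 * a0 ^+ 3 + a0 * e0 + 3 * f0.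
Proof.
rewrite !wvalB !wvalZ wvalX ?wvalM ?wval_a ?wval_b ?wval_c; [ring | exact: Um_a | exact: Um_a].
Qed.

(** The values [a0], [- e0], [- f0] of [a], [b], [c] are arbitrary, whereas
    [w] has value zero, each of its two terms containing a mode of degree
    [-2]. *)
Lemma wval_ordmon a b c d : wval (ordmon a b c d) =
  a0 ^+ a * (- e0) ^+ b * (- f0) ^+ c * (d == 0%N)%:R.
Proof.
have Ua := Um_a; have Ub := Um_b; have Uc := Um_c; have Uw := Um_w.
rewrite /ordmon wvalM ?wvalX ?wval_a; try by [|apply: U_minusX].
rewrite wvalM ?wvalX ?wval_b; try by [|apply: U_minusX].
rewrite wvalM ?wvalX ?wval_c ?wval_w; try by [|apply: U_minusX].
by rewrite expr0n !mulrA.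
Qed.

(** Since [x(0)] annihilates the vacuum, this is the derivation of [U_minus]
    given by [x], followed by the character [wval]. *)
Definition zmode x p : K := wval (x @ 0 * p).

Lemma U_minus_comm0 x p : U_minus B p -> U_minus B (comm (x @ 0) p).
Proof.
have [S1 S2 S3] := U_minus_subalgebra B.
move=> Hp; suff [] : U_minus B p /\ U_minus B (comm (x @ 0) p) by [].
apply: (Hp [set p | U_minus B p /\ U_minus B (comm (x @ 0) p)]%classic).
split; first split; first split.
- by split; [apply: U_minus0 | rewrite comm0r; apply: U_minus0].
- move=> a p1 p2 [H1 H2] [H3 H4]; split; first by apply: S1.2.
  by rewrite comm_linr; apply: S1.2.
- by split; [apply: U_minus1 | rewrite comm1r; apply: U_minus0].
- move=> p1 p2 [H1 H2] [H3 H4]; split; first exact: U_minusM.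
  by rewrite commMr; apply: U_minusD; apply: U_minusM.
move=> _ [[q c] [/= c0 Hq] <-]; split.
  by move=> S [_ HS]; apply: HS; exists ((q, c) : affine B).
have -> : uin ((q, c) : affine B) = \sum_(r <- msupp q) (mcoeff r q) @ r.
  rewrite c0 [in LHS](monalgE q).
  elim/big_rec2: _ => [|r p1 p2 _ <-]; first exact: uin0.
  by rewrite /loop -uinD; congr uin; rewrite [RHS]/GRing.add /= /add_pair /= addr0.
rewrite (big_morph (comm (x @ 0)) (commDr _) (comm0r _)).
elim/big_ind: _ => [||r _]; [exact: U_minus0 | exact: U_minusD |].
rewrite comm_loop0; case: (ltP r 0) => r0; first exact: U_minus_loop.
by rewrite Hq // lie0r loop0; apply: U_minus0.
Qed.

Lemma zmode_commE x p : zmode x p = wval (comm (x @ 0) p).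
Proof. by rewrite /comm wvalB (wval_ge0 x 0) subr0. Qed.
Lemma zmodeM x p q : U_minus B p -> zmode x (p * q) = zmode x p * wval q + wval p * zmode x q.
Proof.
move=> Hp; rewrite [LHS]/zmode mulrA (comm_mulE (x @ 0) p) mulrDl wvalD -mulrA (wvalM _ Hp).
by rewrite (wvalM _ (U_minus_comm0 x Hp)) -zmode_commE addrC.
Qed.
Lemma zmodeD x p q : zmode x (p + q) = zmode x p + zmode x q.
Proof. by rewrite /zmode mulrDr wvalD. Qed.
Lemma zmodeZ x a p : zmode x (a *: p) = a * zmode x p.
Proof. by rewrite /zmode -(scalerAr a (x @ 0)) wvalZ. Qed.
Lemma zmodeB x p q : zmode x (p - q) = zmode x p - zmode x q.
Proof. by rewrite /zmode mulrBr wvalB. Qed.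
Lemma zmode1 x : zmode x 1 = 0. Proof. by rewrite zmode_commE comm1r wval0. Qed.
Lemma zmode_0 x : zmode x 0 = 0. Proof. by rewrite /zmode mulr0 wval0. Qed.
Lemma zmode_1 x y : zmode x (y @ (-1)) = pi [lie x, y].
Proof. by rewrite zmode_commE comm_loop0 wval_1. Qed.
Lemma zmode_2 x y : zmode x (y @ (-2)) = 0.
Proof. by rewrite zmode_commE comm_loop0 wval_2. Qed.
Lemma zmode_scale a x p : zmode (a *: x) p = a * zmode x p.
Proof. by rewrite /zmode loopZ -scalerAl wvalZ. Qed.
Lemma zmode_opp x p : zmode (- x) p = - zmode x p.
Proof. by rewrite -scaleN1r zmode_scale mulN1r. Qed.
Lemma zmodeX x p n : U_minus B p -> zmode x (p ^+ n) = n%:R * wval p ^+ n.-1 * zmode x p.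
Proof.
move=> Hp; elim: n => [|n IH]; first by rewrite expr0 zmode1 !mul0r.
rewrite exprS zmodeM // IH wvalX // -[n.+1%:R]natr1 /=.
case: n {IH} => [|n]; first by rewrite expr0; ring.
by rewrite exprS /=; ring.
Qed.

End Values.
(** * The flow of [E11] *)

Lemma zmode_E11_a a0 e0 f0 : zmode a0 e0 f0 E11 (elt_a D) = - 3.
Proof. by rewrite zmode_1 lie_E11_E21 piZ pi_E32 mulr1. Qed.
Lemma zmode_E11_b a0 e0 f0 : zmode a0 e0 f0 E11 (elt_b D) = - 2 * a0.
Proof.
rewrite zmodeB !zmodeM; try exact: Um1.
rewrite !zmode_1 !wval_1 lie_E11_E31 lie_E11_E32 lie_E11_E10 pi0 pi_E31 pi_E32 piZ pi_E21.
ring.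
Qed.
Lemma zmode_E11_c a0 e0 f0 : zmode a0 e0 f0 E11 (elt_c D) = - e0.
Proof.
rewrite !zmodeB !expr2 -!mulrA !zmodeM; try exact: Um1.
rewrite !(@wvalM a0 e0 f0 (_ @ (-1))); try exact: Um1.
rewrite !zmode_1 !wval_1 lie_E11_E31 lie_E11_E32 lie_E11_F01 pi0 pi_E31 pi_E32 pi_E10.
ring.
Qed.
Lemma zmode_w a0 e0 f0 x : zmode a0 e0 f0 x (elt_w D) = 0.
Proof.
rewrite zmodeB !zmodeM; try exact: Um1.
rewrite !zmode_2 !wval_2; ring.
Qed.

Definition curveb u : {poly K} := 3^-1 *: 'X^2 - u%:P.
Definition curvec u v : {poly K} :=
  3^-1 *: ((2 / 9) *: 'X^3 - 'X * curveb u - v%:P).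
(** On the curve [s |-> (s, curveb, curvec)] in the space of the values of
    [a], [b], [c], the values of the elements [u] and [v] are constant, and
    [E11(0)] acts as [- 3 d/ds]. *)
Definition along u v (p : U) (P : {poly K}) : Prop :=
  U_minus B p /\ forall s, wval s (- (curveb u).[s]) (- (curvec u v).[s]) p = P.[s] /\
    zmode s (- (curveb u).[s]) (- (curvec u v).[s]) E11 p = - 3 * P^`().[s].

Lemma alongM u v p q P Q : along u v p P -> along u v q Q -> along u v (p * q) (P * Q).
Proof.
move=> [Up Hp] [Uq Hq]; split=> [|s]; first exact: U_minusM.
have [p1 p2] := Hp s; have [q1 q2] := Hq s.
rewrite wvalM // zmodeM // p1 p2 q1 q2 derivM hornerD !hornerM; split=> //; ring.
Qed.
Lemma alongX u v p P n : along u v p P -> along u v (p ^+ n) (P ^+ n).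
Proof.
move=> H; elim: n => [|n IH]; last by rewrite !exprS; apply: alongM.
rewrite !expr0; split=> [|s]; first exact: U_minus1.
by rewrite wval1 zmode1 derivC horner0 hornerC mulr0.
Qed.
Lemma alongZ u v a p P : along u v p P -> along u v (a *: p) (a *: P).
Proof.
move=> [Up Hp]; split=> [|s]; first exact: U_minusZ.
have [p1 p2] := Hp s.
by rewrite wvalZ zmodeZ p1 p2 derivZ !hornerZ; split=> //; ring.
Qed.
Lemma along_sum u v n (p : 'I_n -> U) (P : 'I_n -> {poly K}) :
  (forall i, along u v (p i) (P i)) -> along u v (\sum_i p i) (\sum_i P i).
Proof.
move=> H; elim/big_rec2: _ => [|i Q q _ [Uq Hq]].
  split=> [|s]; first exact: U_minus0.
  by rewrite wval0 zmode_0 derivC !horner0 mulr0.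
have [Up Hp] := H i; split=> [|s]; first exact: U_minusD.
have [p1 p2] := Hp s; have [q1 q2] := Hq s.
by rewrite wvalD zmodeD p1 p2 q1 q2 derivD !hornerD; split=> //; ring.
Qed.

Lemma along_a u v : along u v (elt_a D) 'X.
Proof.
split=> [|s]; first exact: Um_a.
by rewrite wval_a zmode_E11_a derivX hornerX hornerC mulr1.
Qed.
Lemma along_b u v : along u v (elt_b D) (curveb u).
Proof.
split=> [|s]; first exact: Um_b.
rewrite wval_b zmode_E11_b opprK; split=> //.
by rewrite /curveb !derivE !hornerE; field.
Qed.
Lemma along_c u v : along u v (elt_c D) (curvec u v).
Proof.
split=> [|s]; first exact: Um_c.
rewrite wval_c zmode_E11_c !opprK; split=> //.
rewrite /curvec /curveb !(derivZ, derivB, derivM, derivXn, derivX, derivC).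
rewrite !(hornerZ, hornerD, hornerN, hornerMn, hornerM, hornerXn, hornerX, hornerC) /=.
by field.
Qed.
Lemma along_w u v : along u v (elt_w D) 0.
Proof.
split=> [|s]; first exact: Um_w.
by rewrite wval_w zmode_w derivC horner0 mulr0.
Qed.

Lemma along_ordsum u v n be : exists P, along u v (ordsum n be) P.
Proof.
exists (\sum_(a < n.+1) \sum_(b < n.+1) \sum_(c < n.+1) \sum_(d < n.+1) be a b c d *:
  ('X ^+ a * (curveb u ^+ b * (curvec u v ^+ c * 0 ^+ d)))).
do 4!(apply: along_sum => ?); apply: alongZ.
apply: alongM; first exact/alongX/along_a.
apply: alongM; first exact/alongX/along_b.
by apply: alongM; apply: alongX; [apply: along_c | apply: along_w].
Qed.

(** The value is constant on each curve, hence equal to the value at the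
    point with [a = 0], where the values of [u] and [v] are coordinates. *)
Lemma wval_flow n be : (forall a0 e0 f0, zmode a0 e0 f0 E11 (ordsum n be) = 0) ->
  forall a0 e0 f0, wval a0 e0 f0 (ordsum n be) =
    wval 0 (a0 ^+ 2 / 3 + e0) ((2 / 9 * a0 ^+ 3 + a0 * e0 + 3 * f0) / 3) (ordsum n be).
Proof.
move=> H a0 e0 f0.
set u := a0 ^+ 2 / 3 + e0; set v := 2 / 9 * a0 ^+ 3 + a0 * e0 + 3 * f0.
have [P [_ HP]] := along_ordsum u v n be.
have [H1 _] := HP a0; have [H2 _] := HP 0.
have n3 : (3 : K) != 0 by rewrite pnatr_eq0.
have HD s : P^`().[s] = 0.
  have [_ /esym/eqP] := HP s; rewrite H mulf_eq0 oppr_eq0 (negPf n3) /=.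
  by move/eqP.
have := deriv_eq0_const a0 0 HD; rewrite -H1 -H2.
rewrite /curvec /curveb.
rewrite !(hornerZ, hornerD, hornerN, hornerM, hornerXn, hornerX, hornerC) => E0.
rewrite [LHS](_ : _ = wval a0 (- (3^-1 * a0 ^+ 2 - u)) (- (3^-1 * (2 / 9 * a0 ^+ 3
  - a0 * (3^-1 * a0 ^+ 2 - u) - v))) (ordsum n be)); last first.
  by congr wval; rewrite /u /v; field.
rewrite E0; congr wval; by field.
Qed.

(** * Independence of the ordered monomials *)

Section Words.
Variables a0 e0 f0 : K.
Local Notation L := (wval a0 e0 f0).
Local Notation T := (E01 @ 1 : U).

Definition word := seq (g * bool).
(** Words in the modes [x(0)] and [x(1)], applied to a vector; the boolean
    is the degree. *)
Definition wapply (s : word) (q : U) : U :=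
  foldr (fun t r => t.1 @ (nat_of_bool t.2)%:Z * r) q s.
(** The functional vanishes at [q] even after fewer than [m] modes of degree
    1 and arbitrarily many zero modes. In this filtration a factor [x(-1)]
    does not lower the level and a factor [x(-2)] raises it by one, so [w^d]
    has level [d]. *)
Definition vanish (m : nat) (q : U) : Prop :=
  forall s : word, (count snd s < m)%N -> L (wapply s q) = 0.

Lemma wapplyD s p q : wapply s (p + q) = wapply s p + wapply s q.
Proof. by elim: s => //= t s ->; rewrite mulrDr. Qed.
Lemma wapplyZ s a p : wapply s (a *: p) = a *: wapply s p.
Proof. by elim: s => //= t s ->; rewrite -(scalerAr a (t.1 @ _)). Qed.
Lemma wapply_cent s c p : wapply s (cent B c * p) = cent B c * wapply s p.
Proof. by elim: s => //= t s ->; rewrite mulrA -cent_comm mulrA. Qed.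
Lemma wapply_rcons s t q : wapply (rcons s t) q = wapply s (t.1 @ (nat_of_bool t.2)%:Z * q).
Proof. by rewrite /wapply foldr_rcons. Qed.
Lemma wapply0 s : wapply s 0 = 0.
Proof. by elim: s => //= t s ->; rewrite mulr0. Qed.
Lemma wapply_nseq d q : wapply (nseq d (E01, true)) q = T ^+ d * q.
Proof. by elim: d => [|d IH]; rewrite ?expr0 ?mul1r //= IH exprS mulrA. Qed.

Lemma vanishD m p q : vanish m p -> vanish m q -> vanish m (p + q).
Proof. by move=> Hp Hq s lt; rewrite wapplyD wvalD Hp // Hq // addr0. Qed.
Lemma vanishZ m a p : vanish m p -> vanish m (a *: p).
Proof. by move=> Hp s lt; rewrite wapplyZ wvalZ Hp // mulr0. Qed.
Lemma vanishB m p q : vanish m p -> vanish m q -> vanish m (p - q).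
Proof. by move=> Hp Hq; rewrite -scaleN1r; apply: vanishD => //; apply: vanishZ. Qed.
Lemma vanish0 m : vanish m 0.
Proof. by move=> s _; rewrite wapply0 wval0. Qed.
Lemma vanish_cent m c p : vanish m p -> vanish m (cent B c * p).
Proof. by move=> Hp s lt; rewrite wapply_cent wval_cent Hp // mulr0. Qed.

Lemma vanish_pos m x (b : bool) q : vanish m q -> vanish (m - b) (x @ (b : nat)%:Z * q).
Proof.
move=> Hq s lt; have := Hq (rcons s (x, b)); rewrite wapply_rcons; apply.
by rewrite -cats1 count_cat /= addn0; lia.
Qed.
Lemma vanish_zero m x q : vanish m q -> vanish m (x @ 0 * q).
Proof. by move=> H; have := @vanish_pos m x false q H; rewrite subn0. Qed.

(** Move the mode to the left end of the word, where a mode of degree less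
    than [-1] has value zero. To become a mode of degree [-1] it must absorb
    [r] letters of degree 1. *)
Lemma vanish_neg m x r q : vanish m q -> vanish (m + r) (x @ (- (r.+1)%:Z) * q).
Proof.
move=> Hq s; elim/last_ind: s m r x q Hq => [|s [y b] IH] m r x q Hq lt.
  rewrite /= /wval (vacfun_loop k (rootval_lin a0 e0 f0)); last by lia.
  case: r lt => [|r] lt; last by case: eqP => [|_]; [lia | rewrite mul0r].
  have H0 := Hq [::]; rewrite /= /wval in H0; rewrite H0 ?mulr0 //; by move: lt; rewrite addn0.
move: lt; rewrite -cats1 count_cat /= addn0 cats1 => lt.
rewrite wapply_rcons /= mulrA loop_comm !mulrDl !wapplyD !wvalD -!mulrA.
rewrite (IH (m - b)%N r x _ (vanish_pos (b := b) y Hq)); last by case: b lt => /= lt; lia.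
rewrite add0r wapply_cent wval_cent.
case: (leqP b r) => br.
  have -> : b%:Z + (- r.+1%:Z) = - (r - b).+1%:Z by case: b br {lt} => /= br; lia.
  rewrite (IH m (r - b)%N _ _ Hq) ?add0r; last by case: b lt br => /= lt br; lia.
  case: eqP => [|_]; first by lia.
  by rewrite mulr0 mul0r.
have -> : r = 0%N by case: b br {lt} => /= br; lia.
have b1 : b = true by case: b br {lt}.
rewrite b1 /= in lt *.
rewrite -[X in L X + _]/(wapply s ([lie y, x] @ 0 * q)).
rewrite (vanish_zero [lie y, x] Hq) ?add0r; last by lia.
by rewrite (Hq s) ?mulr0 //; lia.
Qed.

Lemma vanish_neg1 m x q : vanish m q -> vanish m (x @ (-1) * q).
Proof. by move=> H; have := @vanish_neg m x 0 q H; rewrite addn0. Qed.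
Lemma vanish_neg2 m x q : vanish m q -> vanish m.+1 (x @ (-2) * q).
Proof. by move=> H; have := @vanish_neg m x 1 q H; rewrite addn1. Qed.

(** The commutator of [E01(1)] with a mode of degree [-1] consists of a zero
    mode and a central term, neither of which lowers the level. *)
Definition vanish_stable (p : U) : Prop := forall m q, vanish m q ->
  vanish m (p * q) /\ vanish m (T * (p * q) - p * (T * q)).

Lemma vanish_stable_loop x : vanish_stable (x @ (-1)).
Proof.
move=> m q Hq; split; first exact: vanish_neg1.
rewrite mulrA loop_comm !mulrDl -!mulrA.
have Z (V : zmodType) (a b c : V) : a + b + c - a = c + b.
  by rewrite addrC !addrA addNr add0r addrC.
rewrite Z.
by apply: vanishD; [apply: vanish_cent | apply: vanish_zero].
Qed.
Lemma vanish_stable_1 : vanish_stable 1.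
Proof. by move=> m q Hq; rewrite !mul1r subrr; split=> //; apply: vanish0. Qed.
Lemma vanish_stableM p p' : vanish_stable p -> vanish_stable p' -> vanish_stable (p * p').
Proof.
move=> H H' m q Hq; have [h1 h2] := H' m q Hq; have [h3 h4] := H m _ h1.
rewrite -!mulrA; split=> //.
have -> : T * (p * (p' * q)) - p * (p' * (T * q)) =
  (T * (p * (p' * q)) - p * (T * (p' * q))) + p * (T * (p' * q) - p' * (T * q)).
  by rewrite mulrBr addrA subrK.
by apply: vanishD => //; case: (H m _ h2).
Qed.
Lemma vanish_stableX p n : vanish_stable p -> vanish_stable (p ^+ n).
Proof.
move=> H; elim: n => [|n IH]; first exact: vanish_stable_1.
by rewrite exprS; apply: vanish_stableM.
Qed.
Lemma vanish_stableB p p' : vanish_stable p -> vanish_stable p' -> vanish_stable (p - p').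
Proof.
move=> H H' m q Hq; have [h1 h2] := H' m q Hq; have [h3 h4] := H m _ Hq.
rewrite !mulrBl mulrBr; split; first exact: vanishB.
have -> : T * (p * q) - T * (p' * q) - (p * (T * q) - p' * (T * q)) =
  (T * (p * q) - p * (T * q)) - (T * (p' * q) - p' * (T * q)) by lmod K; ring.
exact: vanishB.
Qed.

Lemma vanish_stable_a : vanish_stable (elt_a D). Proof. exact: vanish_stable_loop. Qed.
Lemma vanish_stable_b : vanish_stable (elt_b D).
Proof. by apply: vanish_stableB; apply: vanish_stableM; apply: vanish_stable_loop. Qed.
Lemma vanish_stable_c : vanish_stable (elt_c D).
Proof.
have G x y z : vanish_stable (x @ (-1) * y @ (-1) * z @ (-1)).
  by apply: vanish_stableM; [apply: vanish_stableM|]; apply: vanish_stable_loop.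
by apply: vanish_stableB; first apply: vanish_stableB; rewrite ?expr2; apply: G.
Qed.

Lemma vanish_w m q : vanish m q -> vanish m.+1 (elt_w D * q).
Proof.
move=> Hq; rewrite mulrBl -!mulrA; apply: vanishB; apply: vanish_neg1; exact: vanish_neg2.
Qed.

(** Modulo the filtration [E01(1)] is a derivation on [w]: it annihilates
    [E32(-2)] and takes [E31(-2)] to [- E32(-1)]. *)
Lemma T_w m q : vanish m q ->
  vanish m.+1 (T * (elt_w D * q) - elt_w D * (T * q) - Y * (Y * q)).
Proof.
move=> Hq.
have H1 := vanish_neg2 E32 Hq; have H2 := vanish_neg2 E31 Hq.
have [_ G1] := vanish_stable_loop E31 H1; have [_ G2] := vanish_stable_loop E32 H2.
have c1 : T * (E32 @ (-2) * q) = E32 @ (-2) * (T * q).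
  by rewrite mulrA loop_commn // lie_E01_E32 loop0 addr0 mulrA.
have c2 : T * (Dl * q) = Dl * (T * q) - Y * q.
  by rewrite mulrA loop_commn // lie_E01_E31 loopN mulrDl mulNr mulrA.
have -> : T * (elt_w D * q) - elt_w D * (T * q) - Y * (Y * q) =
  (T * (X * (E32 @ (-2) * q)) - X * (T * (E32 @ (-2) * q)))
  - (T * (Y * (Dl * q)) - Y * (T * (Dl * q))).
  rewrite c1 c2 /elt_w !mulrBl !mulrBr -!mulrA.
  by lmod K; ring.
exact: vanishB.
Qed.

Lemma Y_w_comm : elt_w D * Y = Y * elt_w D.
Proof.
have c := comm_E32_2_Y; have c' := comm_Dl_Y.
apply/esym; apply: comm_eq0; rewrite /elt_w commBr.
rewrite !commM0r ?subrr //.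
- by rewrite /comm subrr.
- exact: comm_sym0.
- by rewrite /comm -(XY_comm) subrr.
- exact: comm_sym0.
Qed.

Lemma vanish_wX d : vanish d (elt_w D ^+ d).
Proof.
elim: d => [|d IH]; first by [].
by rewrite exprS; apply: vanish_w.
Qed.

Lemma vanish_T m : vanish m T.
Proof.
move=> s _; rewrite -[T]mul1r.
have -> : wapply s (1 * T) = wapply s 1 * T.
  by elim: s => //= t s ->; rewrite mulrA.
exact: (wval_ge0 a0 e0 f0 E01 1).
Qed.

Lemma T_wX d : vanish d.+1 (T * elt_w D ^+ d.+1 - d.+1%:R *: (Y * Y * elt_w D ^+ d)).
Proof.
elim: d => [|d IH].
  rewrite expr0 expr1 mulr1 scale1r.
  have H1 : vanish 0 (1 : U) by [].
  have := T_w H1; rewrite !mulr1 => H2.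
  have -> : T * elt_w D - Y * Y = (T * elt_w D - elt_w D * T - Y * Y) + elt_w D * T.
    by lmod K; ring.
  by apply: vanishD => //; apply: vanish_w; apply: vanish_T.
have H1 := T_w (@vanish_wX d.+1).
have H2 := vanish_w IH.
have E1 : elt_w D * (T * elt_w D ^+ d.+1 - d.+1%:R *: (Y * Y * elt_w D ^+ d)) =
  elt_w D * (T * elt_w D ^+ d.+1) - d.+1%:R *: (Y * (Y * elt_w D ^+ d.+1)).
  rewrite mulrBr -(scalerAr _ (elt_w D)); congr (_ - _ *: _).
  by rewrite exprS !mulrA Y_w_comm -(mulrA Y (elt_w D) Y) Y_w_comm !mulrA.
have -> : T * elt_w D ^+ d.+2 - d.+2%:R *: (Y * Y * elt_w D ^+ d.+1) =
  (T * (elt_w D * elt_w D ^+ d.+1) - elt_w D * (T * elt_w D ^+ d.+1)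
    - Y * (Y * elt_w D ^+ d.+1))
  + elt_w D * (T * elt_w D ^+ d.+1 - d.+1%:R *: (Y * Y * elt_w D ^+ d)).
  rewrite E1 -exprS -[d.+2%:R]natr1 -(mulrA Y Y).
  by lmod K; ring.
exact: vanishD.
Qed.

Lemma wval_vanish_T d m q : vanish m q -> (d < m)%N -> L (T ^+ d * q) = 0.
Proof.
move=> H lt; rewrite -wapply_nseq; apply: H.
by rewrite count_nseq /= mul1n.
Qed.

(** Each of the [d] operators [E01(1)] turns a factor [w] into [E32(-1)^2],
    which has value 1, and there are [d!] ways of pairing them. All other
    terms retain a level higher than the number of operators left. *)
Lemma wval_T_w d p : vanish_stable p -> U_minus B p -> L (T ^+ d * (p * elt_w D ^+ d)) = d`!%:R
  * L p.
Proof.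
elim: d p => [|d IH] p Gp Up; first by rewrite !expr0 mul1r mulr1 mul1r.
have [h1 h2] := Gp _ _ (@vanish_wX d.+1); have [h3 _] := Gp _ _ (@T_wX d).
have GYY : vanish_stable (p * (Y * Y)).
  by apply: vanish_stableM => //; apply: vanish_stableM; apply: vanish_stable_loop.
have UYY : U_minus B (p * (Y * Y)).
  by apply: U_minusM => //; apply: U_minusM; apply: Um1.
(* The first two terms have level d + 1 and vanish under the d remaining
   operators. *)
have E1 : T * (p * elt_w D ^+ d.+1) =
    (T * (p * elt_w D ^+ d.+1) - p * (T * elt_w D ^+ d.+1))
    + p * (T * elt_w D ^+ d.+1 - d.+1%:R *: (Y * Y * elt_w D ^+ d))
    + d.+1%:R *: (p * (Y * Y) * elt_w D ^+ d).
  rewrite mulrBr -(scalerAr _ p) !(mulrA p (Y * Y)).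
  by lmod K; ring.
move: h2 h3 E1; move: (_ - p * _) (p * (_ - _)) => q1 q2 h2 h3 E1.
rewrite exprSr -mulrA E1 !mulrDr !wvalD (wval_vanish_T h2 (ltnSn d)) (wval_vanish_T h3 (ltnSn
  d)) !add0r.
rewrite -(scalerAr _ (T ^+ d)) wvalZ IH // wvalM // wval_l1 wval_1 pi_E32.
by rewrite !mulr1 factS natrM mulrA.
Qed.

Lemma wval_T_ordmon (q a b c d : nat) : (q <= d)%N -> L (T ^+ q * ordmon a b c d) =
  (q == d)%:R * (q`!%:R * (a0 ^+ a * (- e0) ^+ b * (- f0) ^+ c)).
Proof.
have G : vanish_stable (elt_a D ^+ a * (elt_b D ^+ b * elt_c D ^+ c)).
  by apply: vanish_stableM; [|apply: vanish_stableM]; apply: vanish_stableX; [apply: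
    vanish_stable_a|apply: vanish_stable_b|apply: vanish_stable_c].
have -> : ordmon a b c d = elt_a D ^+ a * (elt_b D ^+ b * elt_c D ^+ c) * elt_w D ^+ d.
  by rewrite /ordmon !mulrA.
have Up : U_minus B (elt_a D ^+ a * (elt_b D ^+ b * elt_c D ^+ c)).
  apply: U_minusM; first by apply: U_minusX; apply: Um_a.
  by apply: U_minusM; apply: U_minusX; [apply: Um_b|apply: Um_c].
case: eqP => [->|ne] le.
  rewrite wval_T_w // mul1r; congr (_ * _).
  have := wval_ordmon a0 e0 f0 a b c 0; rewrite /ordmon expr0 mulr1 => ->.
  by rewrite mulr1.
have [h _] := G _ _ (@vanish_wX d).
by rewrite mul0r (wval_vanish_T h) //; lia.
Qed.

End Words.

(** After [E01(1)^q] the terms with more than [q] factors [w] have value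
    zero; those with exactly [q] give [q!] times a polynomial in the free
    values of [a], [b], [c] whose coefficients are the [be a b c q]. *)
Lemma ordsum_coef0 n be (q : nat) : (q <= n)%N ->
  (forall a b c d, (d < q)%N -> be a b c d = 0) ->
  (forall a0 e0 f0, wval a0 e0 f0 ((E01 @ 1) ^+ q * ordsum n be) = 0) ->
  ord_supp n be -> forall a b c, be a b c q = 0.
Proof.
move=> qn H0 H S a b c.
have [//|nz] := eqVneq (be a b c q) 0; have e1 := S _ _ _ _ nz.
apply: (@poly3_coef K n.+1 (fun a b c => be a b c q)); try lia.
move=> x y z; have := H x (- y) (- z).
have q0 : (q`!%:R : K) != 0 by rewrite pnatr_eq0 -lt0n fact_gt0.
rewrite /ordsum mulr_sumr wval_sum => E1; apply: (mulfI q0); rewrite mulr0 -[RHS]E1 mulr_sumr.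
apply: eq_bigr => i _; rewrite mulr_sumr [in RHS]mulr_sumr wval_sum; apply: eq_bigr => j _.
rewrite mulr_sumr [in RHS]mulr_sumr wval_sum; apply: eq_bigr => l _.
rewrite mulr_sumr wval_sum (bigD1 (Ordinal (qn : q < n.+1)%N)) //= big1 ?addr0.
  by rewrite -(scalerAr _ (_ ^+ q)) wvalZ wval_T_ordmon // eqxx !opprK mul1r; ring.
move=> t ne; rewrite -(scalerAr _ (_ ^+ q)) wvalZ.
case: (ltnP t q) => tq; first by rewrite H0 // mul0r.
rewrite wval_T_ordmon //; case: eqP => [et|]; last by rewrite mul0r mulr0.
by case/eqP: ne; apply: val_inj.
Qed.

(** * The action of [F10(1)] *)

Section Lowering.

Variables e0 f0 : K.
Local Notation L := (wval 0 e0 f0).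
Local Notation zmode := (zmode 0 e0 f0).
Local Notation pi := (rootval 0 e0 f0).
Local Notation T := (F10 @ 1 : U).
Local Notation F' := F'.

Definition fmode (p : U) : K := L (T * p).

Lemma fmodeD p q : fmode (p + q) = fmode p + fmode q. Proof. by rewrite /fmode mulrDr wvalD. Qed.
Lemma fmodeB p q : fmode (p - q) = fmode p - fmode q. Proof. by rewrite /fmode mulrBr wvalB. Qed.
Lemma fmodeZ a p : fmode (a *: p) = a * fmode p.
Proof. by rewrite /fmode -(scalerAr a T) wvalZ. Qed.
Lemma fmode1 : fmode 1 = 0.
Proof. by rewrite /fmode -[T]mul1r -mulrA mulr1 (wval_ge0 _ _ _ _ _ 1). Qed.

(** The commutator of [F10(1)] with [x(-1)] is a zero mode plus the central
    term given by the form. *)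
Lemma fmode_1 x q : fmode (x @ (-1) * q) =
  pi x * fmode q + zmode [lie F10, x] q + k * B F10 x * L q.
Proof.
rewrite /fmode mulrA loop_comm 2![in LHS]mulrDl 2!wvalD -mulrA wval_l1 wval_cent.
by rewrite (_ : 1 + -1 = 0 :> int) // mul1r.
Qed.
Lemma fmode_2 x q : fmode (x @ (-2) * q) = pi [lie F10, x] * L q.
Proof.
rewrite /fmode mulrA loop_commn // mulrDl wvalD -mulrA wval_l2 add0r.
by rewrite (_ : 1 + -2 = -1 :> int) // wval_l1.
Qed.

Lemma B_F10 w x : wt w x -> w != (1, 0) -> B F10 x = 0.
Proof.
move=> Hx ne; apply: (form_wt0 wF10 Hx); case: w ne {Hx} => i j.
by rewrite !xpair_eqE /=; lia.
Qed.

Lemma fmode_a q : fmode (elt_a D * q) = - 2 * zmode E11 q.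
Proof.
by rewrite fmode_1 pi_E21 lie_F10_E21 (B_F10 wE21) // mulr0 !mul0r addr0 add0r zmode_scale.
Qed.

Lemma zmode_0l p : zmode 0 p = 0.
Proof. by rewrite -(scale0r (0 : g)) zmode_scale mul0r. Qed.

Lemma zmode_E11_a0 : zmode E11 (elt_a D) = -3. Proof. exact: zmode_E11_a. Qed.
Lemma zmode_E11_b0 : zmode E11 (elt_b D) = 0.
Proof. by rewrite zmode_E11_b mulr0. Qed.

Lemma fmode_b q : fmode (elt_b D * q) = - e0 * fmode q + zmode H10 q - (3 + 3 * k) * L q.
Proof.
rewrite mulrBl fmodeB -!mulrA !fmode_1 pi_E31 pi_E32 pi_E10.
rewrite lie_F10_E31 lie_F10_E32 lie_F10_E10 !zmode_opp zmodeM; last exact: Um1.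
rewrite zmode_1 wval_1 !wval_l1 pi_E11 pi_E10 lie_E21_E11 piZ pi_E32.
rewrite (B_F10 wE31) // (B_F10 wE32) // form_F10_E10 zmode_0l.
ring.
Qed.

Lemma fmode_c q : fmode (elt_c D * q) = - (f0 * fmode q + zmode F' q).
Proof.
rewrite !mulrBl !fmodeB !expr2 -!mulrA !fmode_1 pi_E31 pi_E32 pi_F01.
rewrite lie_F10_E31 lie_F10_E32 !zmode_opp !zmodeM; try exact: Um1.
rewrite !zmode_1 !wval_1 !wval_l1 pi_E31 pi_E32 pi_E01 pi_H01 lie_E21_E31 lie_E21_H01 !pi0.
rewrite (B_F10 wE31) // (B_F10 wE32) // (B_F10 wF01) //.
rewrite !zmode_0l -/F' !lie0l !pi0; ring.
Qed.

Lemma fmode_u q : fmode (elt_u D * q) = e0 * fmode q + (3 * k + 5) * L q - zmode H10 q.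
Proof.
rewrite mulrBl fmodeB fmode_b -scalerAl fmodeZ expr2 -mulrA fmode_a zmodeM; last exact: Um_a.
by rewrite wval_a zmode_E11_a0; field.
Qed.

Lemma fmode_v q : fmode (elt_v D * q) = 3 * f0 * fmode q - 2 * e0 * zmode E11 q + 3 * zmode F' q.
Proof.
rewrite !mulrBl !fmodeB -!scalerAl !fmodeZ fmode_c -mulrA !exprS expr0 mulr1 -!mulrA !fmode_a.
rewrite !zmodeM; try exact: Um_a; try exact: Um_b.
rewrite !wval_a wval_b zmode_E11_b0 wvalM ?wval_a; try exact: Um_a.
ring.
Qed.

Lemma zmode_a x : zmode x (elt_a D) = pi [lie x, E21]. Proof. exact: zmode_1. Qed.
Lemma zmode_b x : pi [lie x, E31] = 0 -> zmode x (elt_b D) =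
  - (pi [lie x, E32] * e0 + pi [lie x, E10]).
Proof.
move=> h; rewrite zmodeB !zmodeM; try exact: Um1.
rewrite !zmode_1 h !wval_1 pi_E31 pi_E32 pi_E10; ring.
Qed.
Lemma zmode_c x : pi [lie x, E31] = 0 -> zmode x (elt_c D) =
  - (2 * pi [lie x, E32] * f0 + pi [lie x, F01]).
Proof.
move=> h; rewrite !zmodeB !expr2 -!mulrA !zmodeM; try exact: Um1.
rewrite !zmode_1 h !wval_l1 !wval_1 pi_E31 pi_E32 pi_F01; ring.
Qed.
Lemma zmode_u x : pi [lie x, E31] = 0 -> zmode x (elt_u D) =
  pi [lie x, E32] * e0 + pi [lie x, E10].
Proof.
move=> h; rewrite zmodeB zmodeZ expr2 zmodeM ?wval_a ?zmode_b //; last exact: Um_a.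
ring.
Qed.
Lemma zmode_v x : pi [lie x, E31] = 0 -> zmode x (elt_v D) =
  pi [lie x, E21] * e0 + 3 * (2 * pi [lie x, E32] * f0 + pi [lie x, F01]).
Proof.
move=> h; rewrite !zmodeB !zmodeZ zmodeX ?zmodeM ?zmode_c ?wval_a ?wval_b ?zmode_a //; try
  exact: Um_a.
rewrite /= expr0n /=; ring.
Qed.

Lemma zmode_uv x (i j : nat) : zmode x (elt_u D ^+ i * elt_v D ^+ j) =
  i%:R * e0 ^+ i.-1 * (3 * f0) ^+ j * zmode x (elt_u D)
  + j%:R * e0 ^+ i * (3 * f0) ^+ j.-1 * zmode x (elt_v D).
Proof.
have Uu : U_minus B (elt_u D) by exact: Um_u.
have Uv : U_minus B (elt_v D) by exact: Um_v.
have lu : L (elt_u D) = e0 by rewrite wval_u; ring.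
have lv : L (elt_v D) = 3 * f0 by rewrite wval_v; ring.
rewrite zmodeM ?zmodeX ?wvalX ?lu ?lv //; last exact: U_minusX.
ring.
Qed.

Lemma L_uv (i j : nat) : L (elt_u D ^+ i * elt_v D ^+ j) = e0 ^+ i * (3 * f0) ^+ j.
Proof.
have Uu : U_minus B (elt_u D) by exact: Um_u.
have Uv : U_minus B (elt_v D) by exact: Um_v.
rewrite wvalM ?wvalX ?wval_u ?wval_v //; last exact: U_minusX.
by congr (_ ^+ _ * _ ^+ _); ring.
Qed.

Lemma zmode_H10_uv (i j : nat) : zmode H10 (elt_u D ^+ i * elt_v D ^+ j) =
  (2 * i + 3 * j)%:R * (e0 ^+ i * (3 * f0) ^+ j).
Proof.
have h : pi [lie H10, E31] = 0 by rewrite (lieH10 wE31) piZ pi_E31 mulr0.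
rewrite zmode_uv zmode_u // zmode_v // lie_H10_E10 lie_H10_E32 lie_H10_F01 lie_H10_E21.
rewrite !piZ pi0 pi_E10 pi_F01 pi_E21 natrD !natrM.
case: i => [|i]; case: j => [|j]; rewrite /= ?exprS; ring.
Qed.
Lemma zmode_E11_uv (i j : nat) : zmode E11 (elt_u D ^+ i * elt_v D ^+ j) = 0.
Proof.
have h : pi [lie E11, E31] = 0 by rewrite lie_E11_E31 pi0.
rewrite zmode_uv zmode_u // zmode_v // lie_E11_E10 lie_E11_E32 lie_E11_F01 lie_E11_E21.
rewrite !piZ pi0 pi_E10 pi_E21 pi_E32; ring.
Qed.
Lemma zmode_F'_uv (i j : nat) : zmode F' (elt_u D ^+ i * elt_v D ^+ j) =
  - (i%:R * e0 ^+ i.-1 * (3 * f0) ^+ j.+1)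
  - 2 * j%:R * e0 ^+ i.+2 * (3 * f0) ^+ j.-1.
Proof.
have wF' : wt (-1, -1) F' by exact: wtF'.
have h : pi [lie F', E31] = 0.
  by rewrite (wt_nonroot (wt_lie wF' wE31)) // pi0.
have h2 : pi [lie F', E32] = 0.
  have [|k0 ->] := @wt_pos_dim1 (2, 1) [lie F', E32] isT.
    exact: (wt_lie wF' wE32).
  by rewrite piZ pi_E21 mulr0.
rewrite zmode_uv zmode_u // zmode_v // h2 lie_F'_E10 lie_F'_E21 lie_F'_F01.
rewrite !piZ pi0 pi_E10 pi_F01 !exprS; ring.
Qed.

Lemma fmode_vX j : fmode (elt_v D ^+ j) = - 6 * (j * j.-1)%:R * e0 ^+ 2 * (3 * f0) ^+ j.-2 / 2.
Proof.
elim: j => [|j IH]; first by rewrite expr0 fmode1 mul0n; ring.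
rewrite exprS fmode_v IH.
have := zmode_E11_uv 0 j; have := zmode_F'_uv 0 j; rewrite !expr0 !mul1r => -> ->.
case: j {IH} => [|[|j]] /=; rewrite ?exprS ?expr0.
- by rewrite !mul0n; field.
- by field.
- by rewrite !natrM -[j.+3%:R]natr1 -[j.+2%:R]natr1 -[j.+1%:R]natr1; field.
Qed.

(** When [3 k + 7 = 2 i + 3 j], the weight of a singular vector, the first
    coefficient is [i (i - 1)]. *)
Lemma fmode_uv (i j : nat) : fmode (elt_u D ^+ i * elt_v D ^+ j) =
  i%:R * (3 * k + 6 - 3 * j%:R - i%:R) * e0 ^+ i.-1 * (3 * f0) ^+ j
  - 3 * (j * j.-1)%:R * e0 ^+ i.+2 * (3 * f0) ^+ j.-2.
Proof.
elim: i => [|i IH].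
  by rewrite expr0 mul1r fmode_vX; field.
rewrite exprS -mulrA fmode_u IH L_uv zmode_H10_uv natrD !natrM -natr1 /=.
case: i {IH} => [|i] /=; rewrite ?exprS ?expr0; ring.
Qed.

(** A condition that holds for [w] and is stable under left multiplication
    by the modes of degree [-1] and [-2]; consequently the multiples of [w]
    do not contribute to the action of [F10(1)]. *)
Definition fmode_null (q : U) : Prop := [/\ L q = 0, forall x, zmode x q = 0 & fmode q = 0].

Lemma fmode_nullD p q : fmode_null p -> fmode_null q -> fmode_null (p + q).
Proof.
move=> [h1 h2 h3] [h4 h5 h6]; split=> [|x|].
- by rewrite wvalD h1 h4 addr0.
- by rewrite zmodeD h2 h5 addr0.
- by rewrite fmodeD h3 h6 addr0.
Qed.
Lemma fmode_nullZ a p : fmode_null p -> fmode_null (a *: p).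
Proof.
move=> [h1 h2 h3]; split=> [|x|].
- by rewrite wvalZ h1 mulr0.
- by rewrite zmodeZ h2 mulr0.
- by rewrite fmodeZ h3 mulr0.
Qed.
Lemma fmode_null_1 x q : fmode_null q -> fmode_null (x @ (-1) * q).
Proof.
move=> [h1 h2 h3]; split=> [|y|].
- by rewrite wval_l1 h1 mulr0.
- by rewrite zmodeM ?h1 ?h2 ?mulr0 ?addr0 //; apply: Um1.
- by rewrite fmode_1 h1 h2 h3 !mulr0 !addr0.
Qed.
Definition keeps_null (p : U) := forall q, fmode_null q -> fmode_null (p * q).
Lemma keeps_nullM p p' : keeps_null p -> keeps_null p' -> keeps_null (p * p').
Proof. by move=> H H' q Hq; rewrite -mulrA; apply/H/H'. Qed.
Lemma keeps_nullX p n : keeps_null p -> keeps_null (p ^+ n).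
Proof.
move=> H; elim: n => [|n IH]; first by move=> q; rewrite expr0 mul1r.
by rewrite exprS; apply: keeps_nullM.
Qed.
Lemma keeps_nullB p p' : keeps_null p -> keeps_null p' -> keeps_null (p - p').
Proof.
move=> H H' q Hq; rewrite mulrBl -scaleN1r.
by apply: fmode_nullD; [apply: H | apply/fmode_nullZ/H'].
Qed.
Lemma keeps_null_1 x : keeps_null (x @ (-1)). Proof. by move=> q; apply: fmode_null_1. Qed.
Lemma keeps_null_2 x : keeps_null (x @ (-2)).
Proof.
move=> q [h1 h2 h3]; split=> [|y|].
- exact: wval_l2.
- by rewrite zmodeM ?h1 ?h2 ?mulr0 ?addr0 //; apply: Um2.
- by rewrite fmode_2 h1 mulr0.
Qed.

Lemma fmode_null_w : fmode_null (elt_w D).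
Proof.
split=> [|x|]; [exact: wval_w | exact: zmode_w |].
rewrite fmodeB !fmode_1 pi_E31 pi_E32 lie_F10_E31 lie_F10_E32 zmode_opp !zmode_2 !wval_2.
rewrite -[Dl]mulr1 fmode_2 lie_F10_E31 piN pi_E21; ring.
Qed.

Lemma fmode_ordmon a b c d : fmode (ordmon a b c d.+1) = 0.
Proof.
rewrite /ordmon exprSr !mulrA.
have Ha : keeps_null (elt_a D) by apply: keeps_null_1.
have Hb : keeps_null (elt_b D).
  by apply: keeps_nullB; apply: keeps_nullM; apply: keeps_null_1.
have Hc : keeps_null (elt_c D).
  have H x y z : keeps_null (x @ (-1) * y @ (-1) * z @ (-1)).
    by apply: keeps_nullM; [apply: keeps_nullM|]; apply: keeps_null_1.
  by apply: keeps_nullB; first apply: keeps_nullB; rewrite ?expr2; apply: H.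
have Hw : keeps_null (elt_w D).
  by apply: keeps_nullB; apply: keeps_nullM; (apply: keeps_null_1 || apply: keeps_null_2).
have [] // : fmode_null (elt_a D ^+ a * elt_b D ^+ b * elt_c D ^+ c * elt_w D ^+ d * elt_w D).
have Hp : keeps_null (elt_a D ^+ a * elt_b D ^+ b * elt_c D ^+ c * elt_w D ^+ d).
  by apply: keeps_nullM; [apply: keeps_nullM; [apply: keeps_nullM|]|]; apply: keeps_nullX.
exact: Hp fmode_null_w.
Qed.

End Lowering.

(** * Singular vectors *)

Lemma Sall_mul i j m i' j' m' p q : Sall i j m p -> Sall i' j' m' q ->
  Sall (i + i') (j + j') (m + m')%N (p * q).
Proof. by move=> Hp Hq; apply: monspan_mul Hp Hq _. Qed.
Lemma Sall_exp i j m p n : Sall i j m p -> Sall (n%:Z * i) (n%:Z * j) (n * m)%N (p ^+ n).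
Proof.
move=> Hp; elim: n => [|n IH].
  by rewrite expr0 !mul0r; apply: monspan_mon mon1 I.
by rewrite exprS; apply: (monspan_cast (Sall_mul Hp IH)) => //; lia.
Qed.
Lemma Slen_Sall l i j m p : monspan (fun l' => l' = l) i j m p -> Sall i j m p.
Proof. by move=> H; apply: (monspan_cast H). Qed.

Lemma Sall_u : Sall 4 2 2 (elt_u D).
Proof.
have Ha : Sall 2 1 1 (elt_a D) by apply: Slen_Sall; exact: Slen_a.
have Hb : Sall 4 2 2 (elt_b D) by apply: Slen_Sall; exact: Slen_b.
by apply: monspanB => //; apply: monspanZ; apply: (monspan_cast (Sall_exp (n := 2) Ha)).
Qed.
Lemma Sall_v : Sall 6 3 3 (elt_v D).
Proof.
have Ha : Sall 2 1 1 (elt_a D) by apply: Slen_Sall; exact: Slen_a.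
have Hb : Sall 4 2 2 (elt_b D) by apply: Slen_Sall; exact: Slen_b.
have Hc : Sall 6 3 3 (elt_c D) by apply: Slen_Sall; exact: Slen_c.
apply: monspanB; last exact: monspanZ.
apply: monspanB; first by apply: monspanZ; apply: (monspan_cast (Sall_exp (n := 3) Ha)).
by apply: (monspan_cast (Sall_mul Ha Hb)).
Qed.

Lemma e_u : comm e (elt_u D) = 0.
Proof. by rewrite commBr commZr (commX0 _ e_a) e_b scaler0 subrr. Qed.
Lemma e_v : comm e (elt_v D) = 0.
Proof.
rewrite !commBr !commZr (commX0 _ e_a) e_c !scaler0.
by rewrite (commM0r e_a e_b) !subr0.
Qed.

Lemma vacnull_loop x (r : int) (p : U) :
  vacnull (x @ r * p) <-> x @ r *: (p *: vac B k) = 0.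
Proof. by rewrite /vacnull scalerA. Qed.

Lemma nplus_loop0 x w : w \in posroots -> wt w x ->
  affine_nplus ((mono x 0, 0) : affine B).
Proof.
move=> wr wx; split=> //= [|r r0].
  rewrite mcoeffUU; apply: (span_sub (S := [set x | exists2 w, w \in posroots &
    weight_space (cartan D) (rootfun D w) x]%classic)); by exists w.
by rewrite mcoeffU; case: eqP => // E; rewrite -E ltxx in r0.
Qed.
Lemma nplus_loop1 x : affine_nplus ((mono x 1, 0) : affine B).
Proof.
split=> //= [|r r0].
  rewrite mcoeffU /=; case: (span_subspace [set x | exists2 w, w \in posroots &
    weight_space (cartan D) (rootfun D w) x]%classic) => H _; exact: H.
by rewrite mcoeffU; case: eqP => // E; rewrite -E in r0.
Qed.

(** In an ordered monomial the factors [w] stand on the right. *)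
Lemma ordsum_w_submodule n be : (forall a b c, be a b c 0%N = 0) ->
  w_submodule D k (ordsum n be *: vac B k).
Proof.
move=> H; exists (\sum_(a < n.+1) \sum_(b < n.+1) \sum_(c < n.+1) \sum_(d < n.+1)
    be a b c d *: ordmon a b c d.-1).
  do 4!(apply: U_minus_sum => ?); apply: U_minusZ; exact: Um_ordmon.
rewrite scalerA; congr (_ *: _); rewrite mulr_suml; apply: eq_bigr => a _.
rewrite mulr_suml; apply: eq_bigr => b _; rewrite mulr_suml; apply: eq_bigr => c _.
rewrite mulr_suml; apply: eq_bigr => -[[|d] lt] _ /=; first by rewrite H !scale0r mul0r.
by rewrite -scalerAl /ordmon exprSr !mulrA.
Qed.

Lemma wval_ordsum a0 e0 f0 n be : wval a0 e0 f0 (ordsum n be) =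
  \sum_(a < n.+1) \sum_(b < n.+1) \sum_(c < n.+1)
    be a b c 0%N * (a0 ^+ a * (- e0) ^+ b * (- f0) ^+ c).
Proof.
rewrite /ordsum wval_sum; apply: eq_bigr => a _; rewrite wval_sum; apply: eq_bigr => b _.
rewrite wval_sum; apply: eq_bigr => c _; rewrite wval_sum big_ord_recl /= big1 ?addr0.
  by rewrite wvalZ wval_ordmon mulr1.
by move=> d _; rewrite wvalZ wval_ordmon mulr0 mulr0.
Qed.

Section Singular.
Variables (M ep n : nat) (v0 : vacmod B k).
Hypothesis ep1 : (ep <= 1)%N.
Hypothesis nE : n = (2 * M + 3 * ep)%N.
Hypothesis nk : n%:R = 3 * k + 7.
Hypothesis wt0 : vac_weight_space D k ((2, 1) *+ n) n v0.
Hypothesis sing : singular D v0.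

Definition uvsum (b : nat -> K) : U :=
  \sum_(t < (M %/ 3).+1) b t *: (elt_u D ^+ (M - 3 * t) * elt_v D ^+ (ep + 2 * t)).

Lemma uvsum_Sall b : Sall (2 * n)%N%:Z n%:Z n (uvsum b).
Proof.
rewrite /uvsum; elim/big_ind: _ => [|p q|t _]; [exact: monspan0 | exact: monspanD |].
have t3 : (3 * t <= M)%N by have := ltn_ord t; lia.
apply: monspanZ; apply: (monspan_cast (Sall_mul (Sall_exp (n := M - 3 * t) Sall_u)
  (Sall_exp (n := ep + 2 * t) Sall_v))) => //; lia.
Qed.
Lemma uvsum_e b : comm e (uvsum b) = 0.
Proof.
rewrite /uvsum (big_morph (comm e) (commDr _) (comm0r _)) big1 // => t _.
by rewrite commZr commM0r ?scaler0 //; apply: commX0; rewrite ?e_u ?e_v.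
Qed.

(** The two parities of [n] are treated together through [n = 2 M + 3 ep]
    with [ep] equal to 0 or 1. *)
Lemma singular_uv : exists b : nat -> K,
  [/\ b 0%N != 0,
      forall t, (t < M %/ 3)%N ->
        3 * ((ep + 2 * t.+1) * (ep + 2 * t.+1).-1)%:R * b t.+1
        = ((M - 3 * t) * (M - 3 * t).-1)%:R * b t
    & w_submodule D k (v0 - uvsum b *: vac B k)].
Proof.
have [p Sp v0E] := vac_weight_spaceE wt0.
have [v0n killed] := sing.
have killE x (r : int) : affine_nplus ((mono x r, 0) : affine B) -> vacnull (x @ r * p).
  by move=> H; apply/vacnull_loop; rewrite -v0E; apply: killed.
have kE01 : vacnull (E01 @ 0 * p).
  by apply: killE; apply: (@nplus_loop0 _ (0, 1)) => //; apply: wtE.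
have kE11 : vacnull (E11 @ 0 * p).
  by apply: killE; apply: (@nplus_loop0 _ (1, 1)) => //; apply: wtE.
have k1 x : vacnull (x @ 1 * p) by apply: killE; apply: nplus_loop1.
have VS := vacnull_subspace.
have kep : vacnull (comm e p).
  apply: (subspaceB VS) => //. exact: (vacnull_r E01 0 p).
have [be sbe Hbe] := invariant_ordsum Sp kep.
have LpE a0 e0 f0 : wval a0 e0 f0 p = wval a0 e0 f0 (ordsum n be).
  by apply/eqP; rewrite -subr_eq0 -wvalB (wval_vacnull _ _ _ Hbe).
have flow := @wval_flow n be.
(* At a = 0 the elements b and c have the values - u and - v / 3, which
   accounts for the signs and the powers of 3. *)
pose b t := be 0%N (M - 3 * t)%N (ep + 2 * t)%N 0%N *
  ((-1) ^+ (M - 3 * t) * (- 3^-1) ^+ (ep + 2 * t)).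
have LQ a0 e0 f0 : wval a0 e0 f0 p = wval a0 e0 f0 (uvsum b).
  rewrite LpE flow => [|a1 e1 f1]; last first.
    have H : vacnull (E11 @ 0 * ordsum n be).
      have := subspaceB VS kE11 (vacnull_l (E11 @ 0) Hbe).
      by rewrite -mulrBr opprB addrC subrK.
    exact: wval_vacnull H.
  rewrite wval_ordsum big_ord_recl /= [X in _ + X]big1 ?addr0; last first.
    move=> a _; rewrite big1 // => b' _; rewrite big1 // => c' _.
    by rewrite expr0n /= !mul0r mulr0.
  rewrite (reindex_uv (G := fun b' c' => be 0%N b' c' 0%N * (0 ^+ 0 *
    (- (a0 ^+ 2 / 3 + e0)) ^+ b' * (- ((2 / 9 * a0 ^+ 3 + a0 * e0 + 3 * f0) / 3)) ^+ c')) ep1 nE);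
    last first.
    move=> b' c' ne; have [->|/sbe E] := eqVneq (be 0%N b' c' 0%N) 0; first by rewrite mul0r.
    by case/eqP: ne; lia.
  rewrite /uvsum wval_sum; apply: eq_bigr => t _.
  rewrite wvalZ wvalM ?wvalX ?wval_u ?wval_v; try exact: Um_u; try exact: Um_v; last first.
    by apply: U_minusX; apply: Um_u.
  rewrite /b expr0 mul1r -[RHS]mulrA; congr (_ * _).
  move: (a0 ^+ 2 / 3 + e0) (2 / 9 * a0 ^+ 3 + a0 * e0 + 3 * f0) => u1 v1.
  rewrite -[- u1]mulN1r (_ : - (v1 / 3) = - 3^-1 * v1); last by rewrite mulNr mulrC.
  by rewrite !exprMn; ring.
have Spq : Sall (2 * n)%N%:Z n%:Z n (p - uvsum b) by apply: monspanB => //; apply: uvsum_Sall.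
have kepq : vacnull (comm e (p - uvsum b)) by rewrite commBr uvsum_e subr0.
have [be' sbe' Hbe'] := invariant_ordsum Spq kepq.
(* The vector and the polynomial in u and v are both invariant and have the
   same values, so no term of their difference is free of w. *)
have be'0 a b' c : be' a b' c 0%N = 0.
  apply: (ordsum_coef0 (q := 0) (n := n)) => // a0 e0 f0.
  rewrite expr0 mul1r; have := wval_vacnull a0 e0 f0 Hbe'.
  by rewrite wvalB wvalB LQ subrr sub0r => /eqP; rewrite oppr_eq0 => /eqP.
have vE : v0 - uvsum b *: vac B k = ordsum n be' *: vac B k.
  by apply/eqP; rewrite v0E -subr_eq0 -!scalerBl; apply/eqP.
(* F10(1) annihilates the vector and the multiples of w have no effect. The
   recurrence is read off at u = 1, v = s, that is e0 = 1, f0 = s / 3. *)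
have rec : forall t, (t < M %/ 3)%N ->
    3 * ((ep + 2 * t.+1) * (ep + 2 * t.+1).-1)%:R * b t.+1
    = ((M - 3 * t) * (M - 3 * t).-1)%:R * b t.
  apply: (@uv_recurrence _ M ep b) => // s.
  have n3 : (3 : K) != 0 by rewrite pnatr_eq0.
  have H := wval_vacnull 0 1 (s / 3) (vacnull_l (F10 @ 1) Hbe').
  have G0 : fmode 1 (s / 3) p = 0 by apply: wval_vacnull.
  have G1 : fmode 1 (s / 3) (ordsum n be') = 0.
    rewrite /fmode /ordsum mulr_sumr wval_sum big1 // => a _; rewrite mulr_sumr wval_sum big1
      // => b' _.
    rewrite mulr_sumr wval_sum big1 // => c _; rewrite mulr_sumr wval_sum big1 // => -[[|d] lt]
      _ /=.
      by rewrite be'0 scale0r mulr0 wval0.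
    by rewrite -(scalerAr _ (F10 @ 1)) wvalZ -[wval _ _ _ _]/(fmode 1 (s / 3) (ordmon a b' c
      d.+1)) fmode_ordmon mulr0.
  have : fmode 1 (s / 3) (uvsum b) = 0.
    move: H; rewrite -[LHS]/(fmode 1 (s / 3) _) !fmodeB G0 G1 subr0 sub0r.
    by move/eqP; rewrite oppr_eq0 => /eqP.
  rewrite {1}/fmode /uvsum mulr_sumr wval_sum => EQ; rewrite -[RHS]EQ; apply: eq_bigr => t _.
  rewrite -(scalerAr _ (F10 @ 1)) wvalZ; congr (_ * _).
  have t3 : (3 * t <= M)%N by have := ltn_ord t; lia.
  rewrite -[RHS]/(fmode 1 (s / 3) _) fmode_uv !expr1n !mulr1 mulrCA divff // mulr1.
  congr (_ * _ - _).
  have k3 : 3 * k = n%:R - 7 by rewrite nk addrK.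
  have nE2 : n = (2 * (M - 3 * t) + 3 * (ep + 2 * t))%N by lia.
  rewrite k3 nE2 natrD !natrM.
  case: (M - 3 * t)%N => [|i] /=; first by rewrite !mul0r.
  by rewrite -natr1; ring.
exists b; split=> //; last by rewrite vE; apply: ordsum_w_submodule.
(* If b 0 vanished then so would all b t, and the singular vector would be
   a sum of multiples of w. Being annihilated by E01(1), it would then be
   zero. *)
apply/negP => /eqP b0.
have b_eq0 t : (t < (M %/ 3).+1)%N -> b t = 0.
  elim: t => // t IH lt; have /eqP := rec t lt; rewrite (IH (ltnW lt)) mulr0.
  rewrite mulf_eq0 => /orP[|/eqP //]; rewrite mulf_eq0 pnatr_eq0 /= pnatr_eq0.
  by lia.
have Q0 : uvsum b = 0.
  by rewrite /uvsum big1 // => t _; rewrite b_eq0 ?scale0r // ltn_ord.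
have v0E' : v0 = ordsum n be' *: vac B k by rewrite -vE Q0 scale0r subr0.
have killT (q : nat) a0 e0 f0 : (0 < q)%N -> wval a0 e0 f0 ((E01 @ 1) ^+ q * ordsum n be') = 0.
  case: q => // q _; apply: wval_vacnull; rewrite exprSr -mulrA; apply: vacnull_l.
  by apply/vacnull_loop; rewrite -v0E'; apply: killed; apply: nplus_loop1.
have be'_eq0 (q : nat) : (q <= n)%N -> forall a b' c, be' a b' c q = 0.
  have [m lt] := ubnP q; elim: m q lt => // m IH q lt qn.
  apply: (ordsum_coef0 (n := n)) => // [a b' c d dq|a0 e0 f0].
    by apply: IH; lia.
  have [->|q0] := posnP q; last exact: killT.
  rewrite expr0 mul1r wval_ordsum big1 // => a _; rewrite big1 // => b' _; rewrite big1 // => c _.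
  by rewrite be'0 mul0r.
move/eqP: v0n; apply; rewrite v0E' /ordsum.
rewrite big1 ?scale0r // => a _; rewrite big1 // => b' _; rewrite big1 // => c _.
by rewrite big1 // => d _; rewrite be'_eq0 ?scale0r // -ltnS.
Qed.
End Singular.

End G2.

Theorem proposition3p3 (R : realType) (g : finLieAlgType R[i])
    (D : G2_data g) (m i n : nat) (k : R[i]) (v0 : vacmod (bform D) k) :
  i = 1%N \/ i = 2%N ->
  k = - 2 + m%:R + i%:R / 3 ->
  n%:R = 3 * k + 7 ->
  vac_weight_space D k ((2, 1) *+ n) n v0 ->
  singular D v0 ->
  (~~ odd n ->
    exists b : nat -> R[i],
    [/\ b 0%N != 0,
        forall j : nat, (1 <= j <= (dnum n).-1)%N ->
          b j = (2 ^+ j * \prod_(l < j) 'C(n./2 - 3 * l, 2)%N%:R)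
                / (3 ^+ j * (2 * j)`!%N%:R) * b 0%N
      & w_submodule D k
          (v0 - (\sum_(j < dnum n)
                   b j *: (elt_u D ^+ (n./2 - 3 * j)%N * elt_v D ^+ (2 * j)%N))
                *: vac (bform D) k)]) /\
  (odd n ->
    exists b : nat -> R[i],
    [/\ b 0%N != 0,
        forall j : nat, (1 <= j <= (dnum n).-1)%N ->
          b j = (2 ^+ j * \prod_(l < j) 'C((n - 3)./2 - 3 * l, 2)%N%:R)
                / (3 ^+ j * (2 * j + 1)`!%N%:R) * b 0%N
      & w_submodule D k
          (v0 - (\sum_(j < dnum n)
                   b j *: (elt_u D ^+ ((n - 3)./2 - 3 * j)%N
                           * elt_v D ^+ (1 + 2 * j)%N))
                *: vac (bform D) k)]).
Proof.
move=> hi hk nk wt0 sing.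
have n3 : (3 : R[i]) != 0 by rewrite pnatr_eq0.
have nE : n = (1 + 3 * m + i)%N.
  apply/eqP; rewrite -(eqr_nat R[i]) nk hk 2!natrD natrM; apply/eqP; by field.
split=> [en|on].
  have nE2 : n = (2 * n./2 + 3 * 0)%N by lia.
  have dE := dnumE (isT : (0 <= 1)%N) nE2.
  have [b [b0 rec H]] := singular_uv (isT : (0 <= 1)%N) nE2 nk wt0 sing.
  exists b; split; [exact: b0 | | by rewrite dE; exact: H].
  move=> j /andP[_]; rewrite dE /= => jd.
  exact: (uv_closed rec).
have nE2 : n = (2 * (n - 3)./2 + 3 * 1)%N by case: hi => hi; subst i; lia.
have dE := dnumE (isT : (1 <= 1)%N) nE2.
have [b [b0 rec H]] := singular_uv (isT : (1 <= 1)%N) nE2 nk wt0 sing.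
exists b; split; [exact: b0 | | by rewrite dE; exact: H].
move=> j /andP[_]; rewrite dE /= addnC => jd.
exact: (uv_closed rec).
Qed.
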